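(* Let $M\subset\mathbb{R}^m$ be convex and bounded, and let $\mathcal{W}=\{w\in L^\infty(\Omega,\mathbb{R}^m): w(x)\in M \text{ for a.e. } x\in\Omega\}$. Let $$G(x,u,v,w)=G^1(x,u,v)+G^2(x,u,v)\,w,\qquad G^1:\Omega\times\mathbb{R}^2\to\mathbb{R},\quad G^2:\Omega\times\mathbb{R}^2\to\mathbb{R}^m,\quad w\in\mathbb{R}^m,$$ and for $w\in\mathcal{W}$ define on $\mathbb{H}_0^{\alpha/2}=H_0^{\alpha/2}(\Omega)\times H_0^{\alpha/2}(\Omega)$ $$F_w(u,v)=\int_\Omega\Big(\tfrac12|(-\Delta)^{\alpha/4}v(x)|^2-\tfrac12|(-\Delta)^{\alpha/4}u(x)|^2+G(x,u(x),v(x),w(x))\Big)dx .$$ Assume: (A1') $G^1,G^1_u,G^1_v,G^2,G^2_u,G^2_v$ are measurable in $x$ for every $(u,v)\in\mathbb{R}^2$ and continuous in $(u,v)$ for a.e. $x\in\Omega$. (A2') There are $s\in(1,2^*_\alpha)$ and $c>0$ such that, for $z\in\{u,v\}$ and $i\in\{1,2\}$, $|G^i_z(x,u,v)|\le c(1+|u|^{s-1}+|v|^{s-1})$ for a.e. $x\in\Omega$ and all $u,v\in\mathbb{R}$. (A3) For every $u\in H_0^{\alpha/2}(\Omega)$ there exist $b\in\mathbb{R}$ with $\rho_1^{\alpha/2}>2b$, $\beta_1\in L^2(\Omega)$, $\gamma_1\in L^1(\Omega)$ such that $G(x,u(x),v,w)\ge -b|v|^2-\beta_1(x)v-\gamma_1(x)$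 for all $v\in\mathbb{R}$, $w\in M$ and a.e. $x\in\Omega$. (A4) For every $v\in H_0^{\alpha/2}(\Omega)$ there exist $B\in\mathbb{R}$ with $\rho_1^{\alpha/2}>2B$, $\beta_2\in L^2(\Omega)$, $\gamma_2\in L^1(\Omega)$ such that $G(x,u,v(x),w)\le B|u|^2+\beta_2(x)u+\gamma_2(x)$ for all $u\in\mathbb{R}$, $w\in M$ and a.e. $x\in\Omega$. (A5) For every $w\in\mathcal{W}$, $F_w(\cdot,v)$ is concave for every $v\in H_0^{\alpha/2}(\Omega)$ and $F_w(u,\cdot)$ is convex for every $u\in H_0^{\alpha/2}(\Omega)$. Let $w_k\in\mathcal{W}$ for $k=0,1,2,\dots$, let $S_k$ be the set of saddle points of $F_{w_k}$, and suppose $w_k$ tends to $w_0$ in the weak-$\ast$ topology of $L^\infty(\Omega,\mathbb{R}^m)$ as $k\to\infty$. Then, with respect to the strong (norm) topology $(s)$ of $\mathbb{H}_0^{\alpha/2}$, $(s)\mathrm{Lim}\sup S_k\ne\emptyset$ and $(s)\mathrm{Lim}\sup S_k\subset S_0$.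
   Context: Standing assumptions: $n\ge 3$, $\Omega\subset\mathbb{R}^n$ is a bounded domain with Lipschitz boundary, $\alpha\in(1,2)$, $2^*_\alpha=\frac{2n}{n-\alpha}$. Subscripts $u,v$ on $G^1,G^2$ denote partial derivatives. Let $(z_k,\rho_k)_{k\in\mathbb{N}}$ be the system of ($L^2(\Omega)$-orthonormal) eigenfunctions and eigenvalues of $-\Delta$ on $\Omega$ with homogeneous Dirichlet boundary condition; $\rho_1$ is the principal (smallest) eigenvalue. $H_0^{\alpha/2}(\Omega)$ is the space of functions $z=\sum_k a_kz_k$ with $\sum_k a_k^2\rho_k^{\alpha/2}<\infty$, with norm $\|z\|^2_{H_0^{\alpha/2}(\Omega)}=\sum_k a_k^2\rho_k^{\alpha/2}=\|(-\Delta)^{\alpha/4}z\|^2_{L^2(\Omega)}$, where the (spectral Dirichlet) fractional powers are $(-\Delta)^{\alpha/2}z=\sum_k a_k\rho_k^{\alpha/2}z_k$ and $(-\Delta)^{\alpha/4}z=\sum_k a_k\rho_k^{\alpha/4}z_k$. The space $\mathbb{H}_0^{\alpha/2}$ carries the norm $\|(u,v)\|^2=\|u\|^2_{H_0^{\alpha/2}(\Omega)}+\|v\|^2_{H_0^{\alpha/2}(\Omega)}$. A pair $(u_0,v_0)\in\mathbb{H}_0^{\alpha/2}$ is a saddle point of $F_w$ if $F_w(u,v_0)\le F_w(u_0,v_0)\le F_w(u_0,v)$ for all $u,v\in H_0^{\alpha/2}(\Omega)$. For a sequence $\{X_k\}_{k\in\mathbb{N}}$ of subsets of a topological space $(\mathcal{H},\tau)$,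 the upper Kuratowski–Painlevé limit $(\tau)\mathrm{Lim}\sup X_k$ is the set of all $\tau$-cluster points of sequences $\{x_k\}_{k\in\mathbb{N}}$ with $x_k\in X_k$ for all $k\in\mathbb{N}$. *)

(* Defs.v *)
From HB Require Import structures.
From mathcomp Require Import all_boot all_order all_algebra.
From mathcomp Require Import all_classical all_reals all_analysis.
From mathcomp Require Import lra.

Set Implicit Arguments.
Unset Strict Implicit.
Unset Printing Implicit Defensive.

Import Order.TTheory GRing.Theory Num.Theory.
Import numFieldNormedType.Exports.

Local Open Scope classical_set_scope.
Local Open Scope ring_scope.

Definition measure_rV_display : measure_display.
Proof. exact: default_measure_display. Qed.

Section measurable_rV.
Context {R : realType} (n : nat).

Let coord (i : 'I_n) (x : 'rV[R]_n) : measurableTypeR R := x 0 i.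

Let rV_set0 : g_sigma_preimage coord set0.
Proof. exact: sigma_algebra0. Qed.

Let rV_setC A : g_sigma_preimage coord A -> g_sigma_preimage coord (~` A).
Proof. exact: sigma_algebraC. Qed.

Let rV_bigcup (F : _^nat) : (forall i, g_sigma_preimage coord (F i)) ->
  g_sigma_preimage coord (\bigcup_i (F i)).
Proof. exact: sigma_algebra_bigcup. Qed.

(* 'rV[R]_n carries the sigma-algebra generated by its coordinates; by
   [open_measurable_rV] it contains the open sets, so it is the Borel one. *)
HB.instance Definition _ := @isMeasurable.Build measure_rV_display
  'rV[R]_n (g_sigma_preimage coord) rV_set0 rV_setC rV_bigcup.

Lemma measurable_coord (i : 'I_n) :
  measurable_fun [set: 'rV[R]_n] (fun x => x 0 i : measurableTypeR R).
Proof.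
move=> _ Y mY; rewrite setTI; apply: sub_sigma_algebra => /=.
rewrite -bigcup_seq/=; exists i => /=; first by rewrite mem_index_enum.
by exists Y => //; rewrite setTI.
Qed.

Lemma measurable_rVP d (T : measurableType d) (f : T -> 'rV[R]_n) :
  (forall i, measurable_fun [set: T] (fun x => f x 0 i : measurableTypeR R)) ->
  measurable_fun [set: T] f.
Proof.
move=> mf; have sub : g_sigma_preimage coord `<=`
    image_set_system [set: T] f measurable.
  apply: smallest_sub; first exact/sigma_algebra_image/sigma_algebra_measurable.
  rewrite -bigcup_seq => B [i _] [A mA <-].
  rewrite /image_set_system /= !setTI; have := mf i measurableT A mA.
  by rewrite setTI.
by move=> _ B mB; exact: sub.
Qed.

Lemma open_measurable_rV (A : set 'rV[R]_n) : open A -> measurable A.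
Proof.
move=> oA.
pose box (p : 'rV[rat]_n * rat) : set 'rV[R]_n :=
  [set x | forall i, `|ratr (p.1 0 i) - x 0 i| < ratr p.2].
have mbox p : measurable (box p).
  rewrite (_ : box p = \bigcap_(i in [set: 'I_n])
    ((fun x : 'rV[R]_n => x 0 i : measurableTypeR R) @^-1`
       [set t | `|ratr (p.1 0 i) - t| < ratr p.2])); last first.
    by apply/seteqP; split => x /= h i; [move=> _; exact: h|exact: (h i I)].
  apply: fin_bigcap_measurable => // i _.
  rewrite -[X in measurable X]setTI; apply: measurable_coord => //.
  apply: measurable_realfun.open_measurable.
  rewrite (_ : [set _ | _] = ball (ratr (p.1 0 i) : R) (ratr p.2)) //.
  exact: ball_open.
have -> : A = \bigcup_p (if pselect (box p `<=` A) then box p else set0).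
  apply/seteqP; split => [x Ax|x [p _]]; last by case: pselect => // sub; exact: sub.
  have /nbhs_ballP[e /= e0 xeA] := open_nbhs_nbhs (conj oA Ax).
  have [r] := rat_in_itvoo (divr_gt0 e0 (ltr0n R 2)).
  rewrite in_itv/= => /andP[r0 re].
  have q_ i : {q : rat | `|ratr q - x 0 i| < ratr r}.
    apply: cid; have xr : x 0 i - ratr r < x 0 i + ratr r by lra.
    have [q] := rat_in_itvoo xr; rewrite in_itv/= => qx; exists q.
    by rewrite ltr_distlC; lra.
  pose p := (\row_i sval (q_ i), r).
  have boxx : box p x by move=> i; rewrite /p/= mxE; case: (q_ i).
  exists p => //; case: pselect => // nsub; exfalso; apply: nsub => y py.
  apply: xeA; split => // j i; rewrite ord1 /ball /=.
  have := boxx i; have := py i; rewrite !ltr_norml /p/=; lra.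
apply: countable_bigcupT_measurable => [|p]; first exact: countableP.
by case: pselect => ?; [exact: mbox|exact: measurable0].
Qed.

End measurable_rV.

Section lebesgue_rV.
Context {R : realType}.

Definition rV_cons n (p : measurableTypeR R * 'rV[R]_n) : 'rV[R]_n.+1 :=
  \row_(i < n.+1) oapp (p.2 0) p.1 (unlift ord0 i).

Lemma measurable_rV_cons n : measurable_fun [set: _] (@rV_cons n).
Proof.
apply: measurable_rVP => i; rewrite /rV_cons.
under eq_fun do rewrite mxE; case: unliftP => [j|] _ /=.
  exact: (measurableT_comp (measurable_coord j)).
exact: measurable_fst.
Qed.

Section step.
Variables (n : nat) (mu : {sigma_finite_measure set 'rV[R]_n -> \bar R}).
Local Open Scope ereal_scope.

Definition lebesgue_rV_step (A : set 'rV[R]_n.+1) : \bar R :=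
  (lebesgue_measure \x mu) (@rV_cons n @^-1` A).

Let mcons (A : set 'rV[R]_n.+1) :
  measurable A -> measurable (@rV_cons n @^-1` A).
Proof.
by move=> mA; rewrite -[X in measurable X]setTI; exact: measurable_rV_cons.
Qed.

Let step0 : lebesgue_rV_step set0 = 0.
Proof. by rewrite /lebesgue_rV_step preimage_set0 measure0. Qed.

Let step_ge0 A : 0 <= lebesgue_rV_step A.
Proof. exact: measure_ge0. Qed.

Let step_additive : semi_sigma_additive lebesgue_rV_step.
Proof.
move=> F mF tF mUF; rewrite /lebesgue_rV_step preimage_bigcup.
apply: measure_semi_sigma_additive.
- by move=> k; exact: mcons.
- apply/trivIsetP => /= i j _ _ ij; rewrite -preimage_setI.
  by move/trivIsetP : tF => /(_ _ _ _ _ ij) ->//; rewrite preimage_set0.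
- by rewrite -preimage_bigcup; exact: mcons.
Qed.

HB.instance Definition _ := isMeasure.Build _ _ _
  lebesgue_rV_step step0 step_ge0 step_additive.

Let step_sigma_finite : sigma_finite setT lebesgue_rV_step.
Proof.
have /sigma_finiteP[F [TF ndF Foo]] :=
  sigma_finiteT (lebesgue_measure : {measure set (measurableTypeR R) -> \bar R}).
have /sigma_finiteP[G [TG ndG Goo]] := sigma_finiteT mu.
pose uncons (x : 'rV[R]_n.+1) : (measurableTypeR R * 'rV[R]_n)%type :=
  (x 0%R ord0, \row_j x 0%R (lift ord0 j))%R.
have consK : cancel (@rV_cons n) uncons.
  move=> [t x]; rewrite /uncons /rV_cons /= mxE unlift_none/=; congr pair.
  by apply/rowP => j; rewrite !mxE liftK.
have munc : measurable_fun [set: _] uncons.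
  apply/measurable_fun_pairP; split; first exact: measurable_coord.
  apply: measurable_rVP => j /=.
  under eq_fun do rewrite mxE.
  exact: measurable_coord.
exists (fun k => uncons @^-1` (F k `*` G k)).
  apply/seteqP; split => // x _.
  have [k _ Fk] : (\bigcup_k F k) (uncons x).1 by rewrite -TF.
  have [l _ Gl] : (\bigcup_k G k) (uncons x).2 by rewrite -TG.
  exists (maxn k l) => //; split.
  - exact: (subsetPset (F k) (F (maxn k l)) (ndF _ _ (leq_maxl _ _))).
  - exact: (subsetPset (G l) (G (maxn k l)) (ndG _ _ (leq_maxr _ _))).
move=> k; have [mF Fk] := Foo k; have [mG Gk] := Goo k; split.
  by rewrite -[X in measurable X]setTI; apply: munc => //; exact: measurableX.
rewrite /lebesgue_rV_step -comp_preimage (_ : _ @^-1` _ = F k `*` G k).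
  by rewrite product_measure1E// lte_mul_pinfty// ge0_fin_numE.
by apply/funext => p; rewrite /preimage /mkset /comp consK.
Qed.

HB.instance Definition _ := @Measure_isSigmaFinite.Build _ _ _
  lebesgue_rV_step step_sigma_finite.

End step.

Fixpoint lebesgue_rV n : {sigma_finite_measure set 'rV[R]_n -> \bar R} :=
  if n is k.+1 then lebesgue_rV_step (lebesgue_rV k)
  else dirac (0 : 'rV[R]_0).

Lemma lebesgue_rV_box n (B : 'I_n -> set (measurableTypeR R)) :
  (forall i, measurable (B i)) ->
  lebesgue_rV n [set x : 'rV[R]_n | forall i, B i (x 0 i)] =
  (\prod_(i < n) lebesgue_measure (B i))%E.
Proof.
elim: n B => [|n IH] B mB.
  by rewrite big_ord0 /= diracE mem_set//; case.
rewrite big_ord_recl -IH//= /lebesgue_rV_step.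
have -> : @rV_cons n @^-1` [set x | forall i, B i (x 0 i)] =
    B ord0 `*` [set x : 'rV[R]_n | forall i, B (lift ord0 i) (x 0 i)].
  apply/seteqP; split => [[t x] h|[t x] [h0 h] i] /=.
    split=> [|i]; first by have := h ord0; rewrite /rV_cons mxE unlift_none.
    by have := h (lift ord0 i); rewrite /rV_cons mxE liftK.
  by rewrite /rV_cons mxE; case: unliftP => [j ->|->]//=; exact: h.
rewrite product_measure1E//.
rewrite (_ : [set _ | _] = \bigcap_(i in [set: 'I_n])
  ((fun x : 'rV[R]_n => x 0 i : measurableTypeR R) @^-1` B (lift ord0 i))).
  apply: fin_bigcap_measurable => // i _.
  by rewrite -[X in measurable X]setTI; exact: measurable_coord.
by apply/seteqP; split => x /= h i; [move=> _; exact: h|exact: (h i I)].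
Qed.

End lebesgue_rV.

Section l2.
Context {R : realType}.
Implicit Types a b : nat -> R.

Let sumsq a : \bar R := (\sum_(k <oo) (a k ^+ 2)%:E)%E.

Let sumsq_ge0 a : (0 <= sumsq a)%E.
Proof. by apply: nneseries_ge0 => k _ _; rewrite lee_fin sqr_ge0. Qed.

Let Lnorm_sumsq a : ('N[counting]_2%:E[EFin \o a] = sumsq a `^ 2^-1)%E.
Proof.
rewrite Lnorm_counting//; congr (_ `^ _)%E; apply: eq_eseriesr => k _.
by rewrite /= powR_mulrn// real_normK// num_real.
Qed.

Let sqrt_sumsq a : (sumsq a < +oo)%E ->
  'N[counting]_2%:E[EFin \o a]%E = (Num.sqrt (fine (sumsq a)))%:E.
Proof.
move=> afin; have aE : sumsq a = (fine (sumsq a))%:E.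
  by rewrite fineK// ge0_fin_numE.
by rewrite Lnorm_sumsq {1}aE poweR_EFin powR12_sqrt// fine_ge0.
Qed.

Lemma l2_triangle a b :
  (\sum_(k <oo) (a k ^+ 2)%:E < +oo)%E -> (\sum_(k <oo) (b k ^+ 2)%:E < +oo)%E ->
  Num.sqrt (fine (\sum_(k <oo) ((a k + b k) ^+ 2)%:E)%E) <=
  Num.sqrt (fine (\sum_(k <oo) (a k ^+ 2)%:E)%E) +
  Num.sqrt (fine (\sum_(k <oo) (b k ^+ 2)%:E)%E).
Proof.
move=> afin bfin; have mink : ('N[counting]_2%:E[EFin \o (a \+ b)%R] <=
    'N[counting]_2%:E[EFin \o a] + 'N[counting]_2%:E[EFin \o b])%E.
  by apply: eminkowski; rewrite ?lee1n// => _ Y _; exact: I.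
have abfin : (sumsq (a \+ b)%R < +oo)%E.
  apply: (@lty_poweRy _ _ 2^-1) => //.
  rewrite -Lnorm_sumsq (le_lt_trans mink)//.
  by rewrite (sqrt_sumsq afin) (sqrt_sumsq bfin) -EFinD ltry.
by move: mink; rewrite (sqrt_sumsq afin) (sqrt_sumsq bfin)
  (sqrt_sumsq abfin) -EFinD lee_fin.
Qed.

Lemma sqrt_triangle2 (x y z t : R) :
  Num.sqrt ((x + z) ^+ 2 + (y + t) ^+ 2) <=
  Num.sqrt (x ^+ 2 + y ^+ 2) + Num.sqrt (z ^+ 2 + t ^+ 2).
Proof.
set p := Num.sqrt (x ^+ 2 + _); set q := Num.sqrt (z ^+ 2 + _).
have p2 : p ^+ 2 = x ^+ 2 + y ^+ 2 by rewrite sqr_sqrtr// addr_ge0 ?sqr_ge0.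
have q2 : q ^+ 2 = z ^+ 2 + t ^+ 2 by rewrite sqr_sqrtr// addr_ge0 ?sqr_ge0.
have p0 : 0 <= p := sqrtr_ge0 _. have q0 : 0 <= q := sqrtr_ge0 _.
rewrite -[leRHS]ger0_norm ?addr_ge0// -sqrtr_sqr ler_wsqrtr//.
suff : x * z + y * t <= p * q by nra.
rewrite -[leRHS]ger0_norm ?mulr_ge0// -sqrtr_sqr.
apply: le_trans (ler_norm _) _; rewrite -sqrtr_sqr ler_wsqrtr//.
rewrite exprMn p2 q2; have := sqr_ge0 (x * t - y * z); nra.
Qed.

End l2.

Definition dotv {R : realType} n (x y : 'rV[R]_n) : R :=
  \sum_(i < n) x 0 i * y 0 i.

Definition enorm {R : realType} n (x : 'rV[R]_n) : R := Num.sqrt (dotv x x).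

(* Around each boundary point [A] is the strict epigraph of a Lipschitz function
   in some orthonormal frame with last vector [e]; a function of the remaining
   coordinates is a function on the whole space invariant along [e]. *)
Definition lipschitz_boundary {R : realType} n (A : set 'rV[R]_n) :=
  forall p, (closure A `\` interior A) p ->
  exists (U : set 'rV[R]_n) (e : 'rV[R]_n) (g : 'rV[R]_n -> R),
  [/\ nbhs p U, enorm e = 1, lipschitz g,
      forall x t, g (x + t *: e) = g x
    & A `&` U = [set x | g x < dotv x e] `&` U].

Record lipschitz_domain (R : realType) (n : nat) := LipschitzDomain {
  domain_set :> set 'rV[R]_n ;
  domain_open : open domain_set ;
  domain_nonempty : domain_set !=set0 ;
  domain_connected : connected domain_set ;
  domain_bounded : bounded_set domain_set ;
  domain_lipschitz : lipschitz_boundary domain_set }.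

(* A function on Om is represented by a function on the whole space, considered
   up to equality almost everywhere for [lebesgue_on Om]. *)
Definition lebesgue_on {R : realType} n (Om : lipschitz_domain R n) :
    {measure set 'rV[R]_n -> \bar R} :=
  mrestr (lebesgue_rV n) (open_measurable_rV (@domain_open _ _ Om)).

Section dirichlet_system.
Context {R : realType} {n : nat}.
Local Notation T := 'rV[R]_n.

Definition partial (i : 'I_n) (f : T -> R) : T -> R :=
  fun x => 'D_(delta_mx 0 i) f x.

Fixpoint Ck (k : nat) (f : T -> R) : Prop :=
  continuous f /\
  if k is l.+1 then
    forall i, (forall x, derivable f x (delta_mx 0 i)) /\ Ck l (partial i f)
  else True.

Definition test_function (A : set T) (f : T -> R) :=
  (forall k, Ck k f) /\
  exists K, [/\ compact K, K `<=` A & forall x, ~ K x -> f x = 0].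

Variable Om : lipschitz_domain R n.
Local Notation mu := (lebesgue_on Om).

Definition L2_cvg (f : nat -> T -> R) (g : T -> R) :=
  (fun k => 'N[mu]_2%:E[EFin \o (f k \- g)%R])%E @ \oo --> 0%E.

(* [u] belongs to the closure of the test functions for the H^1 norm, and [g]
   is its weak gradient. *)
Definition H10_grad (u : T -> R) (g : 'I_n -> T -> R) :=
  [/\ u \in Lfun mu 2%:E, forall i, g i \in Lfun mu 2%:E
    & exists f : nat -> T -> R,
      [/\ forall k, test_function Om (f k), L2_cvg f u
        & forall i, L2_cvg (fun k => partial i (f k)) (g i)]].

(* weak formulation of [- Laplacian z = rho z] in Om, [z = 0] on the boundary *)
Definition dirichlet_eigenpair (z : T -> R) (rho : R) :=
  exists2 g, H10_grad z g &
    forall f, test_function Om f ->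
      \int[mu]_x (\sum_(i < n) g i x * partial i f x) =
      rho * \int[mu]_x (z x * f x).

(* [u = \sum_k a k * z k] in L^2(Om) *)
Definition expansion (z : nat -> T -> R) (a : nat -> R) (u : T -> R) :=
  u \in Lfun mu 2%:E /\
  L2_cvg (fun N x => \sum_(k < N) a k * z k x) u.

(* An L^2(Om)-orthonormal basis of eigenfunctions, the eigenvalues being listed
   in nondecreasing order; the indices start at 0, so that the principal
   eigenvalue is [eigval 0]. *)
Record dirichlet_system := DirichletSystem {
  eigfun : nat -> T -> R ;
  eigval : nat -> R ;
  eigfunP : forall k, dirichlet_eigenpair (eigfun k) (eigval k) ;
  eigfun_orthonormal : forall j k,
    \int[mu]_x (eigfun j x * eigfun k x) = (j == k)%:R ;
  eigfun_basis : forall u, u \in Lfun mu 2%:E ->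
    expansion eigfun (fun k => \int[mu]_x (u x * eigfun k x)) u ;
  eigval_mono : {homo eigval : j k / (j <= k)%N >-> j <= k} }.

End dirichlet_system.

Section fractional_space.
Context {R : realType} {n : nat} {Om : lipschitz_domain R n}.
Variable E : dirichlet_system Om.
Local Notation T := 'rV[R]_n.
Local Notation mu := (lebesgue_on Om).

(* by orthonormality, the coefficients [a] of the expansion [u = \sum_k a k z_k] *)
Definition coef (u : T -> R) (k : nat) : R := \int[mu]_x (u x * eigfun E k x).

(* the power [s] of the Dirichlet Laplacian; the representative is arbitrary *)
Definition frac_laplacian (s : R) (u : T -> R) : T -> R :=
  xget (cst 0) [set h |
    expansion Om (eigfun E) (fun k => coef u k * eigval E k `^ s) h].

Variable alpha : R.

Definition fracH : set (T -> R) := [set u | exists a,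
  expansion Om (eigfun E) a u /\
  (\sum_(k <oo) (a k ^+ 2 * eigval E k `^ (alpha / 2))%:E < +oo)%E].

Definition fracH_norm (u : T -> R) : R := Num.sqrt
  (fine (\sum_(k <oo) (coef u k ^+ 2 * eigval E k `^ (alpha / 2))%:E)%E).

(* Pairs of functions equal almost everywhere are not identified, they are at
   distance zero from one another. *)
Record fracHH := fracHH_pair {
  fracHH_fst : T -> R ;
  fracHH_snd : T -> R ;
  fracHH_fstP : fracH fracHH_fst ;
  fracHH_sndP : fracH fracHH_snd }.

Definition fracHH_norm (u v : T -> R) : R :=
  Num.sqrt (fracH_norm u ^+ 2 + fracH_norm v ^+ 2).

Definition fracHH_dist (p q : fracHH) : R :=
  fracHH_norm (fracHH_fst p \- fracHH_fst q) (fracHH_snd p \- fracHH_snd q).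

Lemma Lfun2_coef u k : u \in Lfun mu 2%:E ->
  mu.-integrable setT (EFin \o (fun x => u x * eigfun E k x)).
Proof.
move=> uL; apply/Lfun1_integrable; apply: Lfun2_mul_Lfun1 => //.
by have [g [zL _ _] _] := eigfunP E k.
Qed.

Lemma coefB u v k : u \in Lfun mu 2%:E -> v \in Lfun mu 2%:E ->
  coef (u \- v) k = coef u k - coef v k.
Proof.
move=> uL vL; rewrite /coef -RintegralB//; last 2 first.
  exact: Lfun2_coef. exact: Lfun2_coef.
by apply: eq_Rintegral => x _ /=; rewrite mulrBl.
Qed.

Lemma eigfun_L2 k : eigfun E k \in Lfun mu 2%:E.
Proof. by have [g []] := eigfunP E k. Qed.

Let L2_0 : cst 0 \in Lfun mu 2%:E.
Proof. by have [] := Lfun_addr_closed mu (lee1n 2). Qed.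

Let L2_D u v : u \in Lfun mu 2%:E -> v \in Lfun mu 2%:E -> u \+ v \in Lfun mu 2%:E.
Proof. by have [_] := Lfun_addr_closed mu (lee1n 2); exact. Qed.

Let L2_N u : u \in Lfun mu 2%:E -> \- u \in Lfun mu 2%:E.
Proof. exact: Lfun_oppr_closed. Qed.

Lemma coef_sum (a : nat -> R) N k (S := fun N x => \sum_(j < N) a j * eigfun E j x) :
  S N \in Lfun mu 2%:E /\ coef (S N) k = if (k < N)%N then a k else 0.
Proof.
elim: N => [|N [IHL IH]].
  have -> : S 0%N = cst 0 by apply/funext => x; rewrite /S big_ord0.
  split; first exact: L2_0.
  by rewrite /coef; under eq_Rintegral do rewrite mul0r; rewrite /Rintegral integral0.
pose f x := a N * eigfun E N x.
have fL : f \in Lfun mu 2%:E.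
  rewrite (_ : f = a N \o* eigfun E N); last by apply/funext => x; exact: mulrC.
  by apply: Lfun_scale; [rewrite ler1n|exact: eigfun_L2].
have -> : S N.+1 = S N \+ f by apply/funext => x; rewrite /S big_ord_recr.
split; first exact: L2_D.
have -> : coef (S N \+ f) k = coef (S N) k + coef f k.
  rewrite /coef -RintegralD//; [|exact: Lfun2_coef|exact: Lfun2_coef].
  by apply: eq_Rintegral => x _ /=; rewrite mulrDl.
rewrite {}IH.
have -> : coef f k = a N * (N == k)%:R.
  rewrite -(eigfun_orthonormal E) -RintegralZl//; last exact/Lfun2_coef/eigfun_L2.
  by apply: eq_Rintegral => x _; rewrite /f mulrA.
rewrite ltnS [(k <= N)%N]leq_eqVlt eq_sym.
have [->|kN] := eqVneq k N; first by rewrite ltnn mulr1 add0r.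
by rewrite mulr0 addr0.
Qed.

Lemma expansion_coef a u : expansion Om (eigfun E) a u -> forall k, coef u k = a k.
Proof.
move=> [uL cu] k; pose S N x := \sum_(j < N) a j * eigfun E j x.
have SL N : S N \in Lfun mu 2%:E by have [] := coef_sum a N k.
have bound : ((fun N => 'N[mu]_2%:E[EFin \o (S N \- u)%R] *
    'N[mu]_2%:E[EFin \o eigfun E k])%E @ \oo --> 0%E).
  rewrite -[X in _ --> X](mul0e ('N[mu]_2%:E[EFin \o eigfun E k])%E).
  apply: cvgeZr => //; rewrite ge0_fin_numE ?Lnorm_ge0//.
  by have := eigfun_L2 k; rewrite inE => /andP[_]; rewrite inE.
have dist0 : (`|a k - coef u k|%:E <= 0)%E.
  apply: (cvge_ge _ bound); exists k.+1 => // N /= kN.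
  have [_] := coef_sum a N k; rewrite kN => <-.
  rewrite -/(S N) -coefB//.
  have dL : S N \- u \in Lfun mu 2%:E by apply: L2_D => //; exact: L2_N.
  rewrite /coef EFin_normr_Rintegral//; last exact: Lfun2_coef.
  apply: le_trans (hoelder mu _ _ _ _ _) => //; last by lra.
  - rewrite Lnorm1; apply: le_abse_integral => //.
    by have /integrableP[] := Lfun2_coef k dL.
  - by move: dL; rewrite inE => /andP[+ _]; rewrite inE.
  - by have := eigfun_L2 k; rewrite inE => /andP[+ _]; rewrite inE.
apply/esym/eqP; rewrite -subr_eq0 -normr_le0.
by rewrite -lee_fin.
Qed.

Let sqweight k := Num.sqrt (eigval E k `^ (alpha / 2)).

Let sqweightE c k : c ^+ 2 * eigval E k `^ (alpha / 2) = (c * sqweight k) ^+ 2.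
Proof. by rewrite exprMn sqr_sqrtr// powR_ge0. Qed.

Let fracH_L2 u : fracH u -> u \in Lfun mu 2%:E.
Proof. by move=> [a [[]]]. Qed.

Lemma fracH_summable u : fracH u ->
  (\sum_(k <oo) (coef u k ^+ 2 * eigval E k `^ (alpha / 2))%:E < +oo)%E.
Proof.
move=> [a [/expansion_coef ua]]; apply: le_lt_trans.
by rewrite (eq_eseriesr (fun k _ => congr1 (fun c =>
  (c ^+ 2 * eigval E k `^ (alpha / 2))%:E) (ua k))).
Qed.

Let fracH_normE u (c : nat -> R) : (forall k, coef u k = c k) ->
  fracH_norm u = Num.sqrt (fine (\sum_(k <oo) ((c k * sqweight k) ^+ 2)%:E)%E).
Proof.
move=> uc; rewrite /fracH_norm; congr (Num.sqrt (fine _)).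
by apply: eq_eseriesr => k _; rewrite uc sqweightE.
Qed.

Let fracH_fin u : fracH u ->
  (\sum_(k <oo) ((coef u k * sqweight k) ^+ 2)%:E < +oo)%E.
Proof.
move=> /fracH_summable; apply: le_lt_trans.
by rewrite (eq_eseriesr (fun k _ => congr1 EFin (sqweightE (coef u k) k))).
Qed.

Let fracHB_fin u v : fracH u -> fracH v ->
  (\sum_(k <oo) (((coef u k - coef v k) * sqweight k) ^+ 2)%:E < +oo)%E.
Proof.
move=> uH vH.
apply: (@le_lt_trans _ _ (\sum_(k <oo) ((2 * (coef u k * sqweight k) ^+ 2)%:E +
   (2 * (coef v k * sqweight k) ^+ 2)%:E))%E).
  apply: lee_nneseries => k _; first by rewrite lee_fin sqr_ge0.
  rewrite -EFinD lee_fin.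
  have := sqr_ge0 (coef u k * sqweight k + coef v k * sqweight k); nra.
rewrite nneseriesD; last 2 first.
  by move=> k _; rewrite lee_fin mulr_ge0// sqr_ge0.
  by move=> k _; rewrite lee_fin mulr_ge0// sqr_ge0.
under eq_eseriesr do rewrite EFinM.
under [X in (_ + X)%E]eq_eseriesr do rewrite EFinM.
rewrite !nneseriesZl ?lee_fin//; last 2 first.
  by move=> k _; rewrite lee_fin sqr_ge0.
  by move=> k _; rewrite lee_fin sqr_ge0.
by rewrite lte_add_pinfty// lte_mul_pinfty// ?lee_fin//; exact: fracH_fin.
Qed.

Let fracH_dist_triangle u v t : fracH u -> fracH v -> fracH t ->
  fracH_norm (u \- t) <= fracH_norm (u \- v) + fracH_norm (v \- t).
Proof.
move=> uH vH tH; have [[uL vL] tL] := (fracH_L2 uH, fracH_L2 vH, fracH_L2 tH).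
rewrite (fracH_normE (fun k => coefB k uL tL)).
rewrite (fracH_normE (fun k => coefB k uL vL)).
rewrite (fracH_normE (fun k => coefB k vL tL)).
have := l2_triangle (fracHB_fin uH vH) (fracHB_fin vH tH); apply: le_trans.
rewrite le_eqVlt; apply/orP; left; apply/eqP; congr (Num.sqrt (fine _)).
by apply: eq_eseriesr => k _; rewrite -mulrDl addrA subrK.
Qed.

Let fracH_dist_sym u v : fracH u -> fracH v ->
  fracH_norm (u \- v) = fracH_norm (v \- u).
Proof.
move=> /fracH_L2 uL /fracH_L2 vL; rewrite /fracH_norm; congr (Num.sqrt (fine _)).
by apply: eq_eseriesr => k _; rewrite !coefB// -sqrrN opprB.
Qed.

Let fracH_dist0 u : fracH u -> fracH_norm (u \- u) = 0.
Proof.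
move=> /fracH_L2 uL; rewrite /fracH_norm eseries0 ?sqrtr0//.
by move=> k _ _; rewrite coefB// subrr expr0n mul0r.
Qed.

Let fracHH_dist_refl p : fracHH_dist p p = 0.
Proof.
case: p => u v uH vH; rewrite /fracHH_dist /fracHH_norm /= !fracH_dist0//.
by rewrite expr0n addr0 sqrtr0.
Qed.

Let fracHH_dist_sym p q : fracHH_dist p q = fracHH_dist q p.
Proof.
case: p q => u v uH vH [u' v' uH' vH']; rewrite /fracHH_dist /fracHH_norm /=.
by rewrite (fracH_dist_sym uH uH') (fracH_dist_sym vH vH').
Qed.

Let fracHH_dist_triangle p q r :
  fracHH_dist p r <= fracHH_dist p q + fracHH_dist q r.
Proof.
have tri := sqrt_triangle2; apply: le_trans (tri _ _ _ _ _).
rewrite ler_wsqrtr// lerD//.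
- rewrite ler_pXn2r ?nnegrE ?addr_ge0 ?sqrtr_ge0//.
  by apply: fracH_dist_triangle; [case: p|case: q|case: r].
- rewrite ler_pXn2r ?nnegrE ?addr_ge0 ?sqrtr_ge0//.
  by apply: fracH_dist_triangle; [case: p|case: q|case: r].
Qed.

HB.instance Definition _ := gen_eqMixin fracHH.
HB.instance Definition _ := gen_choiceMixin fracHH.

Let fracHH_ball (p : fracHH) (e : R) : set fracHH :=
  [set q | fracHH_dist p q < e].
Let fracHH_ent : set_system (fracHH * fracHH) := entourage_ fracHH_ball.

HB.instance Definition _ := hasNbhs.Build fracHH (nbhs_ fracHH_ent).

Let ball_center p (e : R) : 0 < e -> fracHH_ball p e p.
Proof. by move=> e0; rewrite /fracHH_ball /= fracHH_dist_refl. Qed.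

Let ball_sym p q (e : R) : fracHH_ball p e q -> fracHH_ball q e p.
Proof. by rewrite /fracHH_ball /= fracHH_dist_sym. Qed.

Let ball_triangle p q r (d e : R) :
  fracHH_ball p d q -> fracHH_ball q e r -> fracHH_ball p (d + e) r.
Proof.
move=> pq qr; exact: le_lt_trans (fracHH_dist_triangle p q r) (ltrD pq qr).
Qed.

HB.instance Definition _ := @Nbhs_isPseudoMetric.Build R fracHH
  fracHH_ent erefl fracHH_ball ball_center ball_sym ball_triangle erefl.

End fractional_space.

Section problem.
Context {R : realType} {n m : nat} (Om : lipschitz_domain R n).
Variables (E : dirichlet_system Om) (alpha : R).
Local Notation T := 'rV[R]_n.
Local Notation mu := (lebesgue_on Om).

(* Lebesgue measurability on Om; [measurable_fun] is Borel measurability *)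
Definition ae_measurable (f : T -> R) :=
  exists2 g : T -> R, measurable_fun setT g &
    {ae mu, forall x, domain_set Om x -> f x = g x}.

Definition caratheodory (g : T -> R -> R -> R) :=
  (forall u v, ae_measurable (fun x => g x u v)) /\
  {ae mu, forall x, domain_set Om x -> continuous (fun p : R * R => g x p.1 p.2)}.

Definition partialu (g : T -> R -> R -> R) : T -> R -> R -> R :=
  fun x u v => derive1 (fun t => g x t v) u.

Definition partialv (g : T -> R -> R -> R) : T -> R -> R -> R :=
  fun x u v => derive1 (fun t => g x u t) v.

Definition caratheodory_C1 (g : T -> R -> R -> R) :=
  [/\ {ae mu, forall x, domain_set Om x -> forall u v,
        derivable (fun t => g x t v) u 1 /\ derivable (fun t => g x u t) v 1},
      caratheodory g, caratheodory (partialu g) & caratheodory (partialv g)].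

Definition component (g : T -> R -> R -> 'rV[R]_m) (i : 'I_m) : T -> R -> R -> R :=
  fun x u v => g x u v 0 i.

Definition partialu_vec (g : T -> R -> R -> 'rV[R]_m) : T -> R -> R -> 'rV[R]_m :=
  fun x u v => \row_i partialu (component g i) x u v.

Definition partialv_vec (g : T -> R -> R -> 'rV[R]_m) : T -> R -> R -> 'rV[R]_m :=
  fun x u v => \row_i partialv (component g i) x u v.

Definition admissible (M : set 'rV[R]_m) : set (T -> 'rV[R]_m) :=
  [set w : T -> 'rV[R]_m | (forall i, (fun x => w x 0 i) \in Lfun mu +oo%E) /\
           {ae mu, forall x, domain_set Om x -> M (w x)}].

(* L^oo(Om, R^m) is the dual of L^1(Om, R^m). *)
Definition weak_star_cvg (w : nat -> T -> 'rV[R]_m) (w0 : T -> 'rV[R]_m) :=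
  forall f : T -> 'rV[R]_m, (forall i, (fun x => f x 0 i) \in Lfun mu 1%:E) ->
  (\int[mu]_x dotv (w k x) (f x)) @[k --> \oo] --> \int[mu]_x dotv (w0 x) (f x).

Variables (G1 : T -> R -> R -> R) (G2 : T -> R -> R -> 'rV[R]_m).

Definition integrand (x : T) (u v : R) (y : 'rV[R]_m) : R :=
  G1 x u v + dotv (G2 x u v) y.

Definition functional (w : T -> 'rV[R]_m) (u v : T -> R) : R :=
  \int[mu]_x (2^-1 * `|frac_laplacian E (alpha / 4) v x| ^+ 2
            - 2^-1 * `|frac_laplacian E (alpha / 4) u x| ^+ 2
            + integrand x (u x) (v x) (w x)).

Definition saddle_points (w : T -> 'rV[R]_m) : set (fracHH E alpha) :=
  [set p | forall u v, fracH E alpha u -> fracH E alpha v ->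
    functional w u (fracHH_snd p) <= functional w (fracHH_fst p) (fracHH_snd p)
    <= functional w (fracHH_fst p) v].

End problem.
Arguments saddle_points {R n m Om} E alpha G1 G2 w.

Definition Kuratowski_Limsup {T : topologicalType} (X : nat -> set T) : set T :=
  [set y | exists2 x : nat -> T, forall k, X k (x k) & cluster (x @ \oo) y].

(* Main.v *)
Require Import Defs.
From HB Require Import structures.
From mathcomp Require Import all_boot all_order all_algebra.
From mathcomp Require Import all_classical all_reals all_analysis.
From mathcomp Require Import measurable_realfun.
From mathcomp Require Import ring lra.

Set Implicit Arguments.
Unset Strict Implicit.
Unset Printing Implicit Defensive.

Import Order.TTheory GRing.Theory Num.Theory.
Import numFieldNormedType.Exports.

Local Open Scope classical_set_scope.
Local Open Scope ring_scope.

(** Write [phi_w p z = F_w(z.u, p.v) - F_w(p.u, z.v)]; a pair [p] is a saddle point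
    of [F_w] iff [phi_w p z <= 0] for all [z], and [phi_w p p = 0].  By (A3), (A4) and
    the Poincare inequality, [phi_w p 0] is coercive in [p], uniformly in [w], and
    [H_0^(alpha/2)] embeds compactly in [L^2] because the eigenvalues are unbounded:
    tested on [cos (N x_0) f] and [sin (N x_0) f], a bound [C] on them would give
    [N^2 <= C] for every [N].  If [w_k] converges weakly-* and [p_k] is bounded and
    converges almost everywhere and in [L^2], then
    [phi_w p z <= liminf phi_(w_k) p_k z]: the integrand is bounded below by a
    continuous functional on [L^2] (so Fatou's argument applies to the nonlinear
    dependence on [p]), and it is affine in [w].  Existence of saddle points follows from
    a finite minimax theorem and compactness, closedness from this semicontinuity, and
    taking [z = p] in it shows that the norms of [p_k] converge, whence strong
    convergence. *)

(** * Square-integrable functions *)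

(** Two obstacles shape the proof. In (A3) and (A4) the exceptional null set may depend on the
    arguments, and the integrands are Caratheodory functions only up to null sets. They are replaced
    by [H1], [H2], which are well behaved at every point and agree with [G1], [G2] off one null set;
    the integral in [functional] does not notice the change. Moreover, a [dirichlet_system] asserts
    neither that its eigenvalues are positive nor that they are unbounded: the first comes from the
    Poincare inequality, the second from the trigonometric test functions. Weak convergence in
    [fracH] never appears. Bounded sets are compact for the L2 distance, the norm is lower
    semicontinuous for it, and sequences are always extracted at the rate [8^-1 ^+ j]: since
    [4 ^+ j * 8^-1 ^+ j] is summable, they converge almost everywhere without a further extraction.
    All integrability comes from (A3) at [u] and (A4) at [v], which together bound the integrand at
    [(u, v)] on both sides, uniformly over [M]. For existence the almost-saddle sets are indexed by
    finite sets of test points, hence a filter in place of a sequence. *)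

Section real_integral.
Context d (T : measurableType d) (R : realType) (mu : {measure set T -> \bar R}).
Implicit Types f g : T -> R.
Local Notation integ f := (mu.-integrable setT (EFin \o f)).

Lemma integrable_meas f : integ f -> measurable_fun setT f.
Proof. by move=> /(measurable_int mu)/measurable_EFinP. Qed.

Lemma integrable_add f g : integ f -> integ g -> integ (fun x => f x + g x).
Proof. by move=> fi gi; have := integrableD measurableT fi gi. Qed.

Lemma integrable_sub f g : integ f -> integ g -> integ (fun x => f x - g x).
Proof. by move=> fi gi; have := integrableB measurableT fi gi. Qed.

Lemma integrable_scale (a : R) f : integ f -> integ (fun x => a * f x).
Proof. by move=> fi; have := integrableZl measurableT a fi. Qed.

Lemma integrable_oppr f : integ f -> integ (fun x => - f x).
Proof.
move=> fi; have := integrable_scale (-1) fi.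
by apply: eq_integrable => // x _; rewrite /= mulN1r.
Qed.

Lemma integrable_normr f : integ f -> integ (fun x => `|f x|).
Proof. by move=> fi; have := integrable_abse fi. Qed.

Lemma integrable_dom f g : measurable_fun setT f -> integ g ->
  {ae mu, forall x, `|f x| <= g x} -> integ f.
Proof.
move=> mf gi fg; apply/integrableP; split; first exact/measurable_EFinP.
have [mg] := integrableP _ _ _ gi; apply: le_lt_trans.
apply: ae_ge0_le_integral => //.
- by apply: measurableT_comp => //; exact/measurable_EFinP.
- by apply: measurableT_comp.
by apply: filterS fg => x fgx _ /=; rewrite lee_fin (le_trans fgx)// ler_norm.
Qed.

Lemma integrable_sumr n (F : 'I_n -> T -> R) : (forall i, integ (F i)) ->
  integ (fun x => \sum_(i < n) F i x).
Proof.
elim: n F => [|n IH] F Fi.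
  have := integrable0 mu setT.
  by apply: eq_integrable => // x _; rewrite /= big_ord0.
have := integrable_add (Fi ord0) (IH _ (fun i => Fi (lift ord0 i))).
by apply: eq_integrable => // x _; rewrite /= big_ord_recl.
Qed.

Lemma Rintegral_sumr n (F : 'I_n -> T -> R) : (forall i, integ (F i)) ->
  \int[mu]_x (\sum_(i < n) F i x) = \sum_(i < n) \int[mu]_x F i x.
Proof.
elim: n F => [|n IH] F Fi.
  rewrite big_ord0; under eq_Rintegral do rewrite big_ord0.
  by rewrite /Rintegral integral0.
rewrite big_ord_recl -IH// -RintegralD//; last exact: integrable_sumr.
by apply: eq_Rintegral => x _; rewrite big_ord_recl.
Qed.

Lemma ae_eq_Rintegral f g : measurable_fun setT f -> measurable_fun setT g ->
  {ae mu, forall x, f x = g x} -> \int[mu]_x f x = \int[mu]_x g x.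
Proof.
move=> mf mg fg; congr fine; apply: ae_eq_integral => //.
- exact/measurable_EFinP.
- exact/measurable_EFinP.
by apply: filterS fg => x /= -> _.
Qed.

Lemma le_Rintegral_ae f g : integ f -> integ g ->
  {ae mu, forall x, f x <= g x} -> \int[mu]_x f x <= \int[mu]_x g x.
Proof.
move=> fi gi fg; rewrite -subr_ge0 -RintegralB//.
have [mf mg] := (integrable_meas fi, integrable_meas gi).
(* [g - f] is nonnegative only almost everywhere; its positive part is so everywhere. *)
rewrite (@ae_eq_Rintegral _ (fun x => Num.max (g x - f x) 0)).
- by apply: Rintegral_ge0 => x _; rewrite le_max lexx orbT.
- exact: measurable_funB.
- by apply: measurable_maxr => //; exact: measurable_funB.
by apply: filterS fg => x fgx; apply/esym/max_idPl; rewrite subr_ge0.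
Qed.

Lemma Rintegral_dominated (F : nat -> T -> R) f g :
  (forall k, measurable_fun setT (F k)) -> measurable_fun setT f ->
  integ g ->
  {ae mu, forall x, F ^~ x @ \oo --> f x} ->
  {ae mu, forall x, forall k, `|F k x| <= g x} ->
  integ f /\ \int[mu]_x F k x @[k --> \oo] --> \int[mu]_x f x.
Proof.
move=> mF mf gi Ff Fg.
have [||||fi _ cv] := @dominated_convergence _ T R mu setT measurableT
  (fun k => EFin \o F k) (EFin \o f) (EFin \o g) _ _ _ gi.
- by move=> k; exact/measurable_EFinP.
- exact/measurable_EFinP.
- by apply: filterS Ff => x cx _; apply: cvg_EFin => //; exact: nearW.
- by apply: filterS Fg => x h k _; rewrite /= lee_fin.
split => //; apply: fine_cvg; rewrite /Rintegral fineK//.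
exact: integrable_fin_num.
Qed.

End real_integral.

Section L2.
Context d (T : measurableType d) (R : realType) (mu : {measure set T -> \bar R}).
Implicit Types f g h : T -> R.
Local Notation integ f := (mu.-integrable setT (EFin \o f)).
Local Notation L2 f := (f \in Lfun mu 2%:E).

Definition ip f g := \int[mu]_x (f x * g x).

Lemma L2_meas f : L2 f -> measurable_fun setT f.
Proof. by rewrite inE => /andP[+ _]; rewrite inE. Qed.

Lemma L2P f : L2 f <-> measurable_fun setT f /\ integ (fun x => f x * f x).
Proof.
split=> [fL|[mf fi]].
  by split; [exact: L2_meas|have := Lfun2_mul_Lfun1 fL fL => /Lfun1_integrable].
rewrite inE; apply/andP; split; rewrite inE//= /finite_norm unlock.
apply: poweR_lty; have [_] := integrableP _ _ _ fi; apply: le_lt_trans.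
rewrite le_eqVlt; apply/orP; left; apply/eqP/eq_integral => x _ /=.
by rewrite powR_mulrn// expr2 normrM.
Qed.

Lemma L2_mul f g : L2 f -> L2 g -> integ (fun x => f x * g x).
Proof. by move=> fL gL; exact/Lfun1_integrable/Lfun2_mul_Lfun1. Qed.

Lemma L2_0 : L2 (fun=> 0).
Proof. by have [] := Lfun_addr_closed mu (lee1n 2). Qed.

Lemma L2_add f g : L2 f -> L2 g -> L2 (fun x => f x + g x).
Proof. by have [_] := Lfun_addr_closed mu (lee1n 2); exact. Qed.

Lemma L2_scale (a : R) f : L2 f -> L2 (fun x => a * f x).
Proof.
move=> fL; rewrite (_ : (fun _ => _) = a \o* f).
  by apply: Lfun_scale; rewrite ?ler1n.
by apply/funext => x; exact: mulrC.
Qed.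

Lemma L2_opp f : L2 f -> L2 (fun x => - f x).
Proof. by move=> fL; exact: Lfun_oppr_closed. Qed.

Lemma L2_sub f g : L2 f -> L2 g -> L2 (fun x => f x - g x).
Proof. by move=> fL gL; apply: L2_add => //; exact: L2_opp. Qed.

Lemma L2_sum n (F : 'I_n -> T -> R) :
  (forall i, L2 (F i)) -> L2 (fun x => \sum_(i < n) F i x).
Proof.
elim: n F => [|n IH] F FL.
  rewrite (_ : (fun _ => _) = fun=> 0); first exact: L2_0.
  by apply/funext => x; rewrite big_ord0.
rewrite (_ : (fun _ => _) = fun x => F ord0 x + \sum_(i < n) F (lift ord0 i) x).
  by apply: L2_add => //; exact: IH.
by apply/funext => x; rewrite big_ord_recl.
Qed.

Lemma ipC f g : ip f g = ip g f.
Proof. by apply: eq_Rintegral => x _; rewrite mulrC. Qed.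

Lemma ip_ge0 f : 0 <= ip f f.
Proof. by apply: Rintegral_ge0 => x _; rewrite -expr2 sqr_ge0. Qed.

Lemma ipD f g h : L2 f -> L2 g -> L2 h ->
  ip (fun x => f x + g x) h = ip f h + ip g h.
Proof.
move=> fL gL hL; rewrite /ip -RintegralD//; [|exact: L2_mul..].
by apply: eq_Rintegral => x _; rewrite mulrDl.
Qed.

Lemma ipZ a f g : L2 f -> L2 g -> ip (fun x => a * f x) g = a * ip f g.
Proof.
move=> fL gL; rewrite /ip -RintegralZl//; last exact: L2_mul.
by apply: eq_Rintegral => x _; rewrite mulrA.
Qed.

Lemma ipB f g h : L2 f -> L2 g -> L2 h ->
  ip (fun x => f x - g x) h = ip f h - ip g h.
Proof.
move=> fL gL hL; rewrite /ip -RintegralB//; [|exact: L2_mul..].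
by apply: eq_Rintegral => x _; rewrite mulrBl.
Qed.

Lemma ip_sum n (F : 'I_n -> T -> R) h : (forall i, L2 (F i)) -> L2 h ->
  ip (fun x => \sum_(i < n) F i x) h = \sum_(i < n) ip (F i) h.
Proof.
move=> FL hL; rewrite /ip -Rintegral_sumr; last by move=> i; exact: L2_mul.
by apply: eq_Rintegral => x _; rewrite mulr_suml.
Qed.

Lemma ip_pointwise (a b c e : T -> R) (t : R) :
  L2 a -> L2 b -> L2 c -> L2 e ->
  (forall x, a x * a x + b x * b x = t * (c x * c x) + e x * e x) ->
  ip a a + ip b b = t * ip c c + ip e e.
Proof.
move=> aL bL cL eL H; rewrite /ip -RintegralZl//; last exact: L2_mul.
rewrite -RintegralD//; [|exact: L2_mul..].
rewrite -RintegralD//; [|by apply: integrable_scale; exact: L2_mul|exact: L2_mul].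
by apply: eq_Rintegral => x _; exact: H.
Qed.

Lemma ip_sqrB f g : L2 f -> L2 g ->
  ip (fun x => f x - g x) (fun x => f x - g x) = ip f f - 2 * ip f g + ip g g.
Proof.
move=> fL gL; rewrite ipB//; last exact: L2_sub.
rewrite ![ip _ (fun x => _ - _)]ipC !ipB// (ipC g f); ring.
Qed.

(** Expand the square of [t * f - s * g], where [s] is a sign that produces the absolute value, and
    divide by [t]. *)
Lemma ip_young (t : R) f g : 0 < t -> L2 f -> L2 g ->
  2 * `|ip f g| <= t * ip f f + t^-1 * ip g g.
Proof.
move=> t0 fL gL.
have key (s : R) : s ^+ 2 = 1 -> 2 * (s * ip f g) <= t * ip f f + t^-1 * ip g g.
  move=> s2; have := ip_ge0 (fun x => t * f x - s * g x).
  rewrite ip_sqrB; [|exact: L2_scale..].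
  rewrite !ipZ//; [|exact: L2_scale..].
  rewrite ![ip _ (fun x => _ * _)]ipC !ipZ// (ipC g f).
  have ->: s * (s * ip g g) = ip g g by rewrite mulrA -expr2 s2 mul1r.
  move=> h; rewrite -subr_ge0 -(pmulr_rge0 _ t0).
  rewrite !mulrBr mulrDr [t * (_^-1 * _)]mulrA divff ?gt_eqF// mul1r.
  by move: h; rewrite (mulrCA 2 t); lra.
have [_|_] := ger0P (ip f g).
  by rewrite -[X in _ * X]mul1r; apply: key; rewrite expr1n.
by rewrite -[X in _ * X]mulN1r; apply: key; rewrite sqrrN expr1n.
Qed.

Lemma ip_CS f g : L2 f -> L2 g -> ip f g ^+ 2 <= ip f f * ip g g.
Proof.
move=> fL gL; have [f0 g0] := (ip_ge0 f, ip_ge0 g).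
have [->|fg0] := eqVneq (ip f g) 0; first by rewrite expr0n mulr_ge0.
have absp : 0 < `|ip f g| by rewrite normr_gt0.
rewrite -real_normK ?num_real//.
have [z|fn0] := eqVneq (ip f f) 0.
  (* With [ip f f = 0] only the [t^-1] term survives, and this [t] makes it at most [|ip f g|],
     which contradicts [absp]. *)
  have := ip_young (divr_gt0 (ltr_wpDl g0 ltr01) absp) fL gL.
  rewrite z mulr0 add0r invf_div mulrAC => h; exfalso.
  have : `|ip f g| * ip g g / (ip g g + 1) <= `|ip f g|.
    by rewrite ler_pdivrMr ?ltr_wpDl// ler_pM2l//; lra.
  by lra.
have fp : 0 < ip f f by rewrite lt_neqAle eq_sym fn0.
(* The optimal parameter [t = |ip f g| / ip f f]: the first term becomes [|ip f g|]. *)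
have := ip_young (divr_gt0 absp fp) fL gL.
rewrite divfK// invf_div => h.
have : `|ip f g| <= ip f f / `|ip f g| * ip g g by lra.
by rewrite mulrAC ler_pdivlMr// -expr2.
Qed.

Lemma ip_CS_sqrt f g : L2 f -> L2 g ->
  `|ip f g| <= Num.sqrt (ip f f) * Num.sqrt (ip g g).
Proof.
move=> fL gL; rewrite -sqrtrM ?ip_ge0// -sqrtr_sqr ler_wsqrtr//; exact: ip_CS.
Qed.

Lemma Lnorm2E f : L2 f -> ('N[mu]_2%:E[EFin \o f] = (Num.sqrt (ip f f))%:E)%E.
Proof.
move=> fL; rewrite unlock.
have -> : (\int[mu]_x `|(EFin \o f) x| `^ 2 = (ip f f)%:E)%E.
  rewrite /ip /Rintegral fineK; last exact/integrable_fin_num/L2_mul.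
  apply: eq_integral => x _ /=.
  by rewrite powR_mulrn// -normrX ger0_norm ?sqr_ge0// expr2.
by rewrite poweR_EFin powR12_sqrt// ip_ge0.
Qed.

Lemma cvg_dist_le (u e : nat -> R) l : (forall k, `|u k - l| <= e k) ->
  e @ \oo --> 0 -> u @ \oo --> l.
Proof.
move=> ue e0; apply/cvgrPdist_le => r r0.
have /cvgrPdist_le/(_ _ r0) := e0; apply: filterS => k.
rewrite sub0r normrN distrC => ek.
exact: le_trans (ue k) (le_trans (ler_norm _) ek).
Qed.

Lemma cvgn_le (u : nat -> R) l c K : u @ \oo --> l ->
  (forall k, (K <= k)%N -> u k <= c) -> l <= c.
Proof.
move=> ul uc; rewrite -(cvg_lim (@Rhausdorff R) ul).
by apply: limr_le; [exact: cvgP ul|exists K].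
Qed.

Lemma cvgn_ge (u : nat -> R) l c K : u @ \oo --> l ->
  (forall k, (K <= k)%N -> c <= u k) -> c <= l.
Proof.
move=> ul uc; rewrite -(cvg_lim (@Rhausdorff R) ul).
by apply: limr_ge; [exact: cvgP ul|exists K].
Qed.

Lemma sqrtr_cvg0 (u : nat -> R) : u @ \oo --> 0 -> Num.sqrt (u k) @[k --> \oo] --> 0.
Proof.
move=> u0; rewrite -[X in _ --> X]sqrtr0.
exact: (cvg_comp _ _ u0 (@sqrt_continuous _ 0)).
Qed.

(** Bridge from the extended-real norm used in the definitions to the real quantity [ip], the only
    one handled afterwards. *)
Lemma L2_cvgP (F : nat -> T -> R) f : (forall k, L2 (F k)) -> L2 f ->
  ('N[mu]_2%:E[EFin \o (F k \- f)%R] @[k --> \oo] --> 0)%E <->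
  ip (fun x => F k x - f x) (fun x => F k x - f x) @[k --> \oo] --> 0.
Proof.
move=> FL fL; set u := fun k => ip _ _.
have -> : (fun k => 'N[mu]_2%:E[EFin \o (F k \- f)%R])%E =
    (fun k => (Num.sqrt (u k))%:E).
  by apply/funext => k; rewrite Lnorm2E//; exact: L2_sub.
split => [/fine_cvg su|/sqrtr_cvg0 su]; last by apply: cvg_EFin => //; exact: nearW.
have -> : u = (fun k => (fine \o (fun k => (Num.sqrt (u k))%:E)) k *
    (fine \o (fun k => (Num.sqrt (u k))%:E)) k).
  by apply/funext => k; rewrite /= -expr2 sqr_sqrtr// ip_ge0.
by rewrite -[X in _ --> X](mulr0 0); exact: cvgM.
Qed.

Lemma ip_cvg (F : nat -> T -> R) f g : (forall k, L2 (F k)) -> L2 f -> L2 g ->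
  ip (fun x => F k x - f x) (fun x => F k x - f x) @[k --> \oo] --> 0 ->
  ip (F k) g @[k --> \oo] --> ip f g.
Proof.
move=> FL fL gL Ff; set u := fun k => ip _ _ in Ff.
apply: (@cvg_dist_le _ (fun k => Num.sqrt (u k) * Num.sqrt (ip g g))).
  by move=> k; rewrite -ipB// ip_CS_sqrt//; exact: L2_sub.
rewrite -[X in _ --> X](mul0r (Num.sqrt (ip g g))); apply: cvgM; last exact: cvg_cst.
exact: sqrtr_cvg0.
Qed.

Lemma ip_sqr_cvg (F : nat -> T -> R) f : (forall k, L2 (F k)) -> L2 f ->
  ip (fun x => F k x - f x) (fun x => F k x - f x) @[k --> \oo] --> 0 ->
  ip (F k) (F k) @[k --> \oo] --> ip f f.
Proof.
move=> FL fL Ff; have Fff := ip_cvg FL fL fL Ff.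
have -> : (fun k => ip (F k) (F k)) = (fun k =>
    ip (fun x => F k x - f x) (fun x => F k x - f x) + 2 * ip (F k) f - ip f f).
  by apply/funext => k; rewrite ip_sqrB//; ring.
rewrite [X in _ --> X](_ : _ = 0 + 2 * ip f f - ip f f); last by ring.
by apply: cvgB; [apply: cvgD => //; apply: cvgM => //; exact: cvg_cst|exact: cvg_cst].
Qed.

Lemma nneseries_le (a : nat -> R) C : (forall k, 0 <= a k) ->
  (forall N, \sum_(k < N) a k <= C) -> (\sum_(k <oo) (a k)%:E <= C%:E)%E.
Proof.
move=> a0 aC; apply: lime_le.
  by apply: is_cvg_nneseries => k _ _; rewrite lee_fin.
by apply: nearW => N; rewrite big_mkord sumEFin lee_fin.
Qed.

Lemma nneseries_ge_partial (a : nat -> R) N : (forall k, 0 <= a k) ->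
  ((\sum_(k < N) a k)%:E <= \sum_(k <oo) (a k)%:E)%E.
Proof.
move=> a0; rewrite -sumEFin -(big_mkord xpredT (fun k => (a k)%:E)).
by apply: nneseries_lim_ge => k _ _; rewrite lee_fin.
Qed.

Lemma geom_half_le N : \sum_(k < N) (2^-1 : R) ^+ k <= 2.
Proof.
suff -> : \sum_(k < N) (2^-1 : R) ^+ k = 2 - 2 * 2^-1 ^+ N.
  by rewrite gerBl mulr_ge0// exprn_ge0.
elim: N => [|N IH]; first by rewrite big_ord0 expr0; lra.
by rewrite big_ord_recr/= IH exprS; lra.
Qed.

(* The dominating function is the square root of [\sum_k 4^k (e_k)^2], whose integral is at
   most 2. *)
Lemma L2_fast_dom (e : nat -> T -> R) : (forall k, L2 (e k)) ->
  (forall k, ip (e k) (e k) <= 8^-1 ^+ k) ->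
  exists h, [/\ L2 h, forall x, 0 <= h x &
    {ae mu, forall x, forall k, `|e k x| <= h x * 2^-1 ^+ k}].
Proof.
move=> eL e8.
pose t k x := 4 ^+ k * (e k x * e k x).
have t0 k x : 0 <= t k x by rewrite mulr_ge0// ?exprn_ge0// -expr2 sqr_ge0.
have ti k : integ (t k) by apply: integrable_scale; exact: L2_mul.
pose D x : \bar R := (\sum_(k <oo) (t k x)%:E)%E.
have D0 x : (0 <= D x)%E by apply: nneseries_ge0 => k _ _; rewrite lee_fin.
have mD : measurable_fun setT D.
  apply: (@ge0_emeasurable_sum _ _ _ _ (fun k x => (t k x)%:E) xpredT) => [k x _ _|k _].
    by rewrite lee_fin.
  exact/measurable_EFinP/integrable_meas.
have intD : (\int[mu]_x D x <= 2%:E)%E.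
  rewrite integral_nneseries//; last 2 first.
  - by move=> k; exact/measurable_EFinP/integrable_meas.
  - by move=> k x _; rewrite lee_fin.
  have -> : (\sum_(k <oo) \int[mu]_x (t k x)%:E =
      \sum_(k <oo) (\int[mu]_x t k x)%:E)%E.
    apply: eq_eseriesr => k _; rewrite /Rintegral fineK//.
    exact: (integrable_fin_num measurableT (ti k)).
  apply: nneseries_le => [k|N]; first exact: Rintegral_ge0.
  apply: le_trans (geom_half_le N); apply: ler_sum => k _.
  rewrite /t RintegralZl//; last exact: L2_mul.
  rewrite (_ : 2^-1 ^+ k = 4 ^+ k * 8^-1 ^+ k).
    by rewrite ler_pM2l ?exprn_gt0//; exact: e8.
  by rewrite -exprMn; congr (_ ^+ _); lra.
have iD : mu.-integrable setT D.
  apply/integrableP; split => //.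
  by under eq_integral do rewrite gee0_abs//; exact: le_lt_trans intD (ltry _).
have aeD := integrable_ae measurableT iD.
have mh : measurable_fun setT (fun x => Num.sqrt (fine (D x))).
  apply: (@measurableT_comp _ _ _ _ _ _ (fun r : R => Num.sqrt r)).
    by apply: continuous_measurable_fun => //; exact: sqrt_continuous.
  exact: measurableT_comp.
exists (fun x => Num.sqrt (fine (D x))); split.
- apply/L2P; split => //.
  apply/integrableP; split; first exact/measurable_EFinP/measurable_funM.
  apply: le_lt_trans (le_lt_trans intD (ltry _)).
  apply: ge0_le_integral => // [|x _ /=].
    by apply: measurableT_comp => //; exact/measurable_EFinP/measurable_funM.
  rewrite -expr2 sqr_sqrtr ?fine_ge0// ger0_norm ?fine_ge0//.
  by move: (D0 x); case: (D x) => //= *; exact: leey.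
- by move=> x; exact: sqrtr_ge0.
apply: filterS aeD => x /(_ I) Dx k.
have : t k x <= fine (D x).
  rewrite -lee_fin fineK//; apply: le_trans (nneseries_ge_partial k.+1 (t0^~ x)).
  by rewrite lee_fin big_ord_recr/= lerDr sumr_ge0.
move=> tD; rewrite -sqrtr_sqr.
have -> : (2^-1 : R) ^+ k = Num.sqrt ((2^-1 ^+ k) ^+ 2).
  by rewrite sqrtr_sqr ger0_norm// exprn_ge0.
rewrite -sqrtrM ?fine_ge0// ler_wsqrtr// -exprM mulnC exprM.
rewrite (_ : (2^-1) ^+ 2 = (4 : R)^-1); last by lra.
rewrite exprVn ler_pdivlMr ?exprn_gt0//.
by rewrite mulrC expr2.
Qed.

(** The dominating function makes the errors at a fixed point decay geometrically. *)
Lemma L2_fast_ae (F : nat -> T -> R) f : (forall k, L2 (F k)) -> L2 f ->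
  (forall k, ip (fun x => F k x - f x) (fun x => F k x - f x) <= 8^-1 ^+ k) ->
  {ae mu, forall x, F ^~ x @ \oo --> f x}.
Proof.
move=> FL fL F8.
have [h [_ _]] := L2_fast_dom (fun k => L2_sub (FL k) fL) F8.
apply: filterS => x hx; apply: (@cvg_dist_le _ (fun k => h x * 2^-1 ^+ k)) => //.
rewrite -[X in _ --> X](mulr0 (h x)); apply: cvgM; first exact: cvg_cst.
by apply: cvg_expr; rewrite ger0_norm// invf_lt1// ltr1n.
Qed.

(** Completeness of L2 along fast Cauchy sequences: the increments are dominated by [h * 2^-1 ^+ k],
    so the sequence converges pointwise with an error that is square integrable. *)
Lemma L2_fast_complete (F : nat -> T -> R) : (forall k, L2 (F k)) ->
  (forall k, ip (fun x => F k.+1 x - F k x) (fun x => F k.+1 x - F k x)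
     <= 8^-1 ^+ k) ->
  exists2 f, L2 f &
    ip (fun x => F k x - f x) (fun x => F k x - f x) @[k --> \oo] --> 0.
Proof.
move=> FL F8.
have [h [hL h0 [N [mN N0 hN]]]] := L2_fast_dom (fun k => L2_sub (FL k.+1) (FL k)) F8.
(* Setting the functions to 0 on the null set makes every estimate hold at every point, so the limit
   exists everywhere and is measurable. *)
pose G k x := F k x * \1_(~` N) x.
have dG k x : `|G k.+1 x - G k x| <= h x * 2^-1 ^+ k.
  rewrite /G -mulrBl indicE; case: (boolP (x \in ~` N)) => [xN|_]; last first.
    by rewrite mulr0 normr0 mulr_ge0// exprn_ge0.
  rewrite mulr1; apply: contrapT => nx; move: xN; rewrite inE; apply.
  by apply: hN => /= /(_ k); exact: nx.
(* Telescoping; [2 * 2^-1 ^+ k] is the geometric tail from index [k]. *)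
have dG2 k j x : `|G (k + j)%N x - G k x| <= h x * (2 * 2^-1 ^+ k - 2 * 2^-1 ^+ (k + j)).
  elim: j => [|j IH]; first by rewrite addn0 !subrr normr0 mulr0.
  rewrite addnS; apply: le_trans (ler_distD (G (k + j)%N x) _ _) _.
  apply: le_trans (lerD (dG _ _) IH) _; rewrite -mulrDr ler_wpM2l// exprS; lra.
have dG3 k j x : (k <= j)%N -> `|G j x - G k x| <= h x * (2 * 2^-1 ^+ k).
  move=> kj; have := dG2 k (j - k)%N x; rewrite subnKC// => /le_trans; apply.
  by rewrite ler_wpM2l// gerBl mulr_ge0// exprn_ge0.
have half0 x : h x * (2 * 2^-1 ^+ k) @[k --> \oo] --> 0.
  rewrite -[X in _ --> X](mulr0 (h x)); apply: cvgM; first exact: cvg_cst.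
  rewrite -[X in _ --> X](mulr0 2); apply: cvgM; first exact: cvg_cst.
  by apply: cvg_expr; rewrite ger0_norm// invf_lt1// ltr1n.
have cG x : cvgn (G ^~ x).
  apply: R_complete; apply: cauchy_exP => e e0.
  have /cvgrPdist_lt/(_ _ e0)[k _ kh] := half0 x.
  exists (G k x); exists k => // j /= kj; rewrite /ball/= distrC.
  apply: le_lt_trans (dG3 _ _ x kj) _.
  by have := kh k (leqnn k); rewrite sub0r normrN; apply: le_lt_trans; exact: ler_norm.
pose f x := limn (G ^~ x).
have fk k x : `|G k x - f x| <= h x * (2 * 2^-1 ^+ k).
  rewrite distrC; have cd : `|G j x - G k x| @[j --> \oo] --> `|f x - G k x|.
    by apply: cvg_norm; apply: cvgB; [exact: cG|exact: cvg_cst].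
  by apply: (cvgn_le (K := k) cd) => j kj; exact: dG3.
have mG k : measurable_fun setT (G k).
  apply: measurable_funM; first exact: L2_meas.
  by apply: measurable_indic; exact: measurableC.
have mf : measurable_fun setT f by apply: measurable_fun_cvg mG _ => x _; exact: cG.
have mGf k : measurable_fun setT (fun x => G k x - f x) by exact: measurable_funB.
have GF k : {ae mu, forall x, G k x = F k x}.
  exists N; split => // x /= GFx; apply: contrapT => xN; apply: GFx.
  by rewrite /G indicE mem_set// mulr1.
have dL k : L2 (fun x => h x * (2 * 2^-1 ^+ k)).
  rewrite (_ : (fun _ => _) = fun x => 2 * 2^-1 ^+ k * h x); first exact: L2_scale.
  by apply/funext => x; rewrite mulrC.
have GfL k : L2 (fun x => G k x - f x).
  apply/L2P; split; first exact: mGf.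
  apply: (integrable_dom _ (L2_mul (dL k) (dL k))); first exact: measurable_funM.
  by apply: aeW => x; rewrite normrM ler_pM.
have FfL : L2 f.
  have G0 : L2 (G 0%N).
    apply/L2P; split => //; apply: (integrable_dom _ (L2_mul (FL 0%N) (FL 0%N))).
      exact: measurable_funM.
    by apply: filterS (GF 0%N) => x ->; rewrite -expr2 ger0_norm ?sqr_ge0.
  rewrite (_ : f = fun x => G 0%N x - (G 0%N x - f x)); first exact: L2_sub.
  by apply/funext => x; rewrite subKr.
exists f => //.
apply: (@cvg_dist_le _ (fun k => (2 * 2^-1 ^+ k) ^+ 2 * ip h h)) => [k|].
  rewrite subr0 ger0_norm ?ip_ge0//.
  have -> : (2 * 2^-1 ^+ k) ^+ 2 * ip h h =
      ip (fun x => h x * (2 * 2^-1 ^+ k)) (fun x => h x * (2 * 2^-1 ^+ k)).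
    rewrite -RintegralZl//; last exact: L2_mul.
    by rewrite /ip; apply: eq_Rintegral => x _; ring.
  apply: le_Rintegral_ae; [by apply: L2_mul; exact: L2_sub|exact: L2_mul|].
  apply: filterS (GF k) => x <-.
  by rewrite -!expr2 -(real_normK (num_real (_ - _))) lerXn2r ?nnegrE// (le_trans _ (fk k x)).
rewrite -[X in _ --> X](mul0r (ip h h)); apply: cvgM; last exact: cvg_cst.
have c0 : 2 * 2^-1 ^+ k @[k --> \oo] --> (0 : R).
  rewrite -[X in _ --> X](mulr0 2); apply: cvgM; first exact: cvg_cst.
  by apply: cvg_expr; rewrite ger0_norm// invf_lt1// ltr1n.
by rewrite -[X in _ --> X](mulr0 0); under eq_fun do rewrite expr2; exact: cvgM.
Qed.

End L2.

(** * Integration by parts *)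

Section integration_by_parts.
Context {R : realType}.
Local Notation leb n := (lebesgue_rV n : {measure set 'rV[R]_n -> \bar R}).

Definition off_box n (L : R) (x : 'rV[R]_n) := exists i, L < `|x 0 i|.

Lemma continuous_rV_cons_r n (t : R) :
  continuous (fun y : 'rV[R]_n => rV_cons (t, y)).
Proof.
move=> y A /nbhs_ballP[e /= e0 eA]; apply/nbhs_ballP; exists e => // z [_ yz].
apply: eA; split => // i j; rewrite /rV_cons !mxE; case: unliftP => [k _|_] /=.
  exact: yz.
exact: ballxx.
Qed.

Lemma continuous_rV_cons_l n (y : 'rV[R]_n) :
  continuous (fun t : R => rV_cons (t, y)).
Proof.
move=> t A /nbhs_ballP[e /= e0 eA]; apply/nbhs_ballP; exists e => // z tz.
apply: eA; split => // i j; rewrite /rV_cons !mxE; case: unliftP => [k _|_] //=.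
exact: ballxx.
Qed.

Lemma continuous_rV_measurable n (F : 'rV[R]_n -> R) :
  continuous F -> measurable_fun setT F.
Proof.
move=> cF; apply: (measurability _ (RGenOpens.measurableE R)).
move=> _ [_ [a [b ->] <-]]; rewrite setTI.
apply: open_measurable_rV; apply: open_comp => //; exact: interval_open.
Qed.

Definition boxT (n : nat) (L : R) : set 'rV[R]_n := [set x | forall i, `[- L, L]%classic (x 0 i)].
Arguments boxT : clear implicits.

Lemma box_measurable n (L : R) : measurable (boxT n L).
Proof.
rewrite (_ : boxT n L = \bigcap_(i in [set: 'I_n])
  ((fun x : 'rV[R]_n => x 0 i : measurableTypeR R) @^-1` `[- L, L]%classic)).
  apply: fin_bigcap_measurable => // i _.
  by rewrite -[X in measurable X]setTI; apply: measurable_coord => //; exact: measurable_itv.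
by apply/seteqP; split => x /= h i; [move=> _; exact: h|exact: (h i I)].
Qed.

Lemma box_finite n (L : R) : (leb n (boxT n L) < +oo)%E.
Proof.
have mL : measurable (`[- L, L]%classic : set (measurableTypeR R)) by exact: measurable_itv.
have -> : leb n (boxT n L) =
    (\prod_(i < n) lebesgue_measure (`[(- L)%R, L]%classic : set R))%E.
  exact: (@lebesgue_rV_box R n (fun=> `[- L, L]%classic) (fun=> mL)).
have [r ->] : exists r : R, (\prod_(i < n) lebesgue_measure (`[(- L)%R, L]%classic : set R))%E = r%:E.
  have [c ->] : exists c : R, lebesgue_measure (`[- L, L]%classic : set R) = c%:E.
    by rewrite lebesgue_measure_itv/=; case: ifPn => _; [exists (L - - L)|exists 0].
  by exists (\prod_(i < n) c); rewrite -prodEFin.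
exact: ltry.
Qed.

Lemma not_boxT n (L : R) x : ~ boxT n L x -> off_box L x.
Proof.
move=> nx; apply: contrapT => h; apply: nx => i; rewrite /= in_itv/= -ler_norml.
by rewrite leNgt; apply/negP => Lx; apply: h; exists i.
Qed.

Lemma boxed_integrable n (G : 'rV[R]_n -> R) (L : R) : continuous G ->
  (forall x, off_box L x -> G x = 0) ->
  (exists B, forall x, `|G x| <= B) /\ (leb n).-integrable setT (EFin \o G).
Proof.
move=> cG G0.
have [B0 GB] : exists B, forall x, `|G x| <= B.
  have cK : compact (boxT n L).
    exact: (@rV_compact R n (fun=> `[- L, L]%classic) (fun=> @segment_compact _ _ _)).
  have /compact_bounded[B [_ BG]] : compact (G @` boxT n L).
    by apply: continuous_compact => //; exact: continuous_subspaceT.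
  exists (Num.max 0 (B + 1)) => x; rewrite le_max.
  have [xb|/not_boxT/G0 ->] := pselect (boxT n L x); last by rewrite normr0 lexx.
  by rewrite (BG (B + 1)) ?orbT// ?ltrDl//; exists x.
split; first by exists B0.
have mG := continuous_rV_measurable cG.
apply: (@integrable_dom _ _ _ _ _ (fun x => B0 * \1_(boxT n L) x)) => //.
  apply: integrable_scale; apply/integrableP; split.
    by apply/measurable_EFinP/measurable_indic; exact: box_measurable.
  rewrite (eq_integral (fun x => (\1_(boxT n L) x)%:E)); last first.
    by move=> x _; rewrite /= ger0_norm.
  by rewrite integral_indic ?setIT//; [exact: box_finite|exact: box_measurable].
apply: aeW => x; rewrite indicE.
have [xb|xb] := pselect (boxT n L x); first by rewrite mem_set// mulr1.
by rewrite memNset// mulr0 (G0 _ (not_boxT xb)) normr0.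
Qed.

(** The set where a coordinate exceeds [L] in absolute value is open, so [F] vanishes near each of
    its points. *)
Lemma partial_off_box n (F : 'rV[R]_n -> R) (L : R) i :
  (forall x, off_box L x -> F x = 0) -> forall x, off_box L x -> partial i F x = 0.
Proof.
move=> F0 x [j xj]; rewrite /partial.
have -> : 'D_(delta_mx 0 i) F x = 'D_(delta_mx 0 i) (cst 0) x.
  apply: near_eq_derive; apply/nbhs_ballP; exists (`|x 0 j| - L) => /=.
    by rewrite subr_gt0.
  move=> y [_ /(_ 0 j)]; rewrite /ball/= => xy; apply: F0; exists j.
  by have := ler_distD (y 0 j) (x 0 j) 0; rewrite !subr0; lra.
exact: derive_cst.
Qed.

Lemma rV_cons_delta0 n t (y : 'rV[R]_n) h :
  h *: delta_mx 0 ord0 + rV_cons (t, y) = rV_cons (h + t, y).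
Proof.
apply/rowP => i; rewrite /rV_cons !mxE; case: unliftP => [k ->|->] /=.
  by rewrite mulr0 add0r.
by rewrite mulr1.
Qed.

Lemma rV_cons_deltaS n t (y : 'rV[R]_n) j h :
  h *: delta_mx 0 (lift ord0 j) + rV_cons (t, y) = rV_cons (t, h *: delta_mx 0 j + y).
Proof.
apply/rowP => i; rewrite /rV_cons !mxE; case: unliftP => [k ->|->] /=.
  by rewrite !mxE eqxx/= (inj_eq lift_inj).
by rewrite mulr0 add0r.
Qed.

(** Both sides are limits of the same difference quotient, so the equality holds whether or not the
    limit exists. The next three lemmas rest on the same remark. *)
Lemma partial_cons0 n (F : 'rV[R]_n.+1 -> R) t (y : 'rV[R]_n) :
  partial ord0 F (rV_cons (t, y)) = derive1 (fun s => F (rV_cons (s, y))) t.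
Proof.
pose f1 (h : R) : R := h^-1 *: (F (h *: delta_mx 0 ord0 + rV_cons (t, y)) - F (rV_cons (t, y))).
pose f2 (h : R) : R := h^-1 *: (F (rV_cons (h + t, y)) - F (rV_cons (t, y))).
have E : f1 = f2 by apply/funext => h; rewrite /f1 rV_cons_delta0.
by change (lim (f1 @ 0^') = lim (f2 @ 0^')); rewrite E.
Qed.

Lemma derivable_cons0 n (F : 'rV[R]_n.+1 -> R) t (y : 'rV[R]_n) :
  derivable F (rV_cons (t, y)) (delta_mx 0 ord0) ->
  derivable (fun s => F (rV_cons (s, y))) t 1.
Proof.
pose f1 (h : R) : R := h^-1 *: (F (h *: delta_mx 0 ord0 + rV_cons (t, y)) - F (rV_cons (t, y))).
pose f2 (h : R) : R := h^-1 *: (F (rV_cons (h *: 1 + t, y)) - F (rV_cons (t, y))).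
have E : f1 = f2.
  by apply/funext => h; rewrite /f1 rV_cons_delta0 /f2 [h *: 1]mulr1.
by change (cvg (f1 @ 0^') -> cvg (f2 @ 0^')); rewrite E.
Qed.

Lemma partial_consS n (F : 'rV[R]_n.+1 -> R) t (y : 'rV[R]_n) j :
  partial (lift ord0 j) F (rV_cons (t, y)) =
  partial j (fun z => F (rV_cons (t, z))) y.
Proof.
pose f1 (h : R) : R :=
  h^-1 *: (F (h *: delta_mx 0 (lift ord0 j) + rV_cons (t, y)) - F (rV_cons (t, y))).
pose f2 (h : R) : R := h^-1 *: (F (rV_cons (t, h *: delta_mx 0 j + y)) - F (rV_cons (t, y))).
have E : f1 = f2 by apply/funext => h; rewrite /f1 rV_cons_deltaS.
by change (lim (f1 @ 0^') = lim (f2 @ 0^')); rewrite E.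
Qed.

Lemma derivable_consS n (F : 'rV[R]_n.+1 -> R) t (y : 'rV[R]_n) j :
  derivable F (rV_cons (t, y)) (delta_mx 0 (lift ord0 j)) ->
  derivable (fun z => F (rV_cons (t, z))) y (delta_mx 0 j).
Proof.
pose f1 (h : R) : R :=
  h^-1 *: (F (h *: delta_mx 0 (lift ord0 j) + rV_cons (t, y)) - F (rV_cons (t, y))).
pose f2 (h : R) : R := h^-1 *: (F (rV_cons (t, h *: delta_mx 0 j + y)) - F (rV_cons (t, y))).
have E : f1 = f2 by apply/funext => h; rewrite /f1 rV_cons_deltaS.
by change (cvg (f1 @ 0^') -> cvg (f2 @ 0^')); rewrite E.
Qed.

Lemma integral_derive1_boxed (f : R -> R) (L : R) : 0 < L ->
  (forall t, derivable f t 1) -> continuous (derive1 f) ->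
  (forall t, L < `|t| -> f t = 0) ->
  (\int[lebesgue_measure]_t (derive1 f t)%:E = 0)%E.
Proof.
move=> L0 df cf f0.
have cvf : continuous f.
  by move=> t; apply: differentiable_continuous; exact/derivable1_diffP.
(* The extra 1 puts both endpoints strictly outside the support, where [f0] gives the value 0. *)
have LL : - (L + 1) < L + 1 by lra.
have := @continuous_FTC2 _ (derive1 f) f _ _ LL.
rewrite !f0; last 2 first.
- by rewrite ltr_normr; apply/orP; right; lra.
- by rewrite ltr_normr; apply/orP; left; lra.
rewrite subee// => <-.
- rewrite [RHS]integral_mkcond; apply: eq_integral => t _.
  rewrite patchE; case: ifPn => //; rewrite notin_setE/= in_itv/= => /negP; rewrite -ler_norml.
  rewrite -ltNge => Lt; congr EFin; rewrite derive1E.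
  have -> : 'D_1 f t = 'D_1 (cst 0) t; last exact: derive_cst.
  apply: near_eq_derive; apply/nbhs_ballP; exists 1 => //= s; rewrite /ball/= => st.
  by apply: f0; have := ler_distD s t 0; rewrite !subr0; lra.
- exact: continuous_subspaceT.
- split => [t _|//|//]; first exact: df.
  exact/cvg_at_right_filter/cvf.
  exact/cvg_at_left_filter/cvf.
- by [].
Qed.

(** The measure in dimension [n.+1] is by construction the image of the product measure under
    [rV_cons]; this is the entry point for Fubini. *)
Lemma integral_rV_cons n (f : 'rV[R]_n.+1 -> \bar R) :
  measurable_fun setT f -> (leb n.+1).-integrable setT f ->
  let m := (@lebesgue_measure R \x lebesgue_rV n)%E in
  m.-integrable setT (f \o @rV_cons R n) /\
  (\int[leb n.+1]_x f x = \int[m]_p f (rV_cons p))%E.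
Proof.
move=> mf fi m.
have E g : measurable_fun setT g -> (forall x, 0 <= g x)%E ->
    (\int[leb n.+1]_x g x = \int[m]_p g (rV_cons p))%E.
  move=> mg g0.
  by rewrite -(@ge0_integral_pushforward _ _ _ _ _ _ (@measurable_rV_cons R n) m setT g).
have ci : m.-integrable setT (f \o @rV_cons R n).
  apply/integrableP; split.
    exact: (measurableT_comp mf (@measurable_rV_cons R n)).
  have [_] := integrableP _ _ _ fi; rewrite E//.
  exact: measurableT_comp.
split => //.
by rewrite -(integral_pushforward (@measurable_rV_cons R n) (D := setT)).
Qed.

(** Induction on the dimension. If [i] is the first coordinate, integrate along it first and use the
    fundamental theorem of calculus; otherwise freeze the first coordinate and use the induction
    hypothesis on the slice. *)
Lemma integral_partial_boxed n (F : 'rV[R]_n -> R) i (L : R) : 0 < L ->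
  continuous F -> continuous (partial i F) ->
  (forall x, derivable F x (delta_mx 0 i)) ->
  (forall x, off_box L x -> F x = 0) ->
  (\int[leb n]_x (partial i F x)%:E = 0)%E.
Proof.
move=> L0; elim: n F i => [F []//|n IH] F i cF cdF dF F0.
have dF0 := @partial_off_box _ F L i F0.
have [_ iF] := boxed_integrable cdF dF0.
have mF := continuous_rV_measurable cdF.
have [ici ->] := integral_rV_cons ((measurable_EFinP _ _).2 mF) iF.
case: (unliftP ord0 i) => [j|] ij; subst i.
- rewrite -integral12_prod_meas1//; apply: integral0_eq => t _.
  rewrite /fubini_F.
  under eq_integral do rewrite /= partial_consS.
  apply: IH.
  + by move=> y; apply: continuous_comp; [exact: continuous_rV_cons_r|exact: cF].
  + rewrite (_ : partial j _ = fun y => partial (lift ord0 j) F (rV_cons (t, y))).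
      by move=> y; apply: continuous_comp; [exact: continuous_rV_cons_r|exact: cdF].
    by apply/funext => y; rewrite partial_consS.
  + by move=> y; exact: derivable_consS.
  + move=> y [k Lk]; apply: F0; exists (lift ord0 k).
    by rewrite /rV_cons mxE liftK.
- rewrite -integral21_prod_meas1//; apply: integral0_eq => y _.
  rewrite /fubini_G.
  under eq_integral do rewrite /= partial_cons0.
  apply: (integral_derive1_boxed L0).
  + by move=> t; exact: derivable_cons0.
  + rewrite (_ : derive1 _ = fun t => partial ord0 F (rV_cons (t, y))).
      by move=> t; apply: continuous_comp; [exact: continuous_rV_cons_l|exact: cdF].
    by apply/funext => t; rewrite partial_cons0.
  + move=> t Lt; apply: F0; exists ord0.
    by rewrite /rV_cons mxE unlift_none.
Qed.

End integration_by_parts.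

(** * The Dirichlet system *)

Lemma cvgn_sum (R : realType) m (u : 'I_m -> nat -> R) (l : 'I_m -> R) :
  (forall i, u i @ \oo --> l i) ->
  \sum_(i < m) u i k @[k --> \oo] --> \sum_(i < m) l i.
Proof.
elim: m u l => [|m IH] u l ul.
  by under eq_fun do rewrite big_ord0; rewrite big_ord0; exact: cvg_cst.
under eq_fun do rewrite big_ord_recl.
by rewrite big_ord_recl; apply: cvgD => //; apply: (IH (fun i => u (lift ord0 i))).
Qed.

(** * Calculus of partial derivatives and of the classes [Ck] *)

Section smooth.
Context {R : realType} {n : nat}.
Local Notation T := 'rV[R]_n.
Implicit Types f g : T -> R.

Lemma rV_contD f g : continuous f -> continuous g -> continuous (fun x => f x + g x).
Proof. by move=> cf cg x; exact: (continuousD (cf x) (cg x)). Qed.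

Lemma rV_contM f g : continuous f -> continuous g -> continuous (fun x => f x * g x).
Proof. by move=> cf cg x; exact: (continuousM (cf x) (cg x)). Qed.

Lemma coord_cont (j : 'I_n) : continuous (fun x : T => x 0 j).
Proof. exact: coord_continuous. Qed.

Lemma partial_mul i f g x : derivable f x (delta_mx 0 i) ->
  derivable g x (delta_mx 0 i) ->
  partial i (fun x => f x * g x) x = f x * partial i g x + g x * partial i f x.
Proof. by move=> df dg; exact: (deriveM df dg). Qed.

Lemma partial_add i f g x : derivable f x (delta_mx 0 i) ->
  derivable g x (delta_mx 0 i) ->
  partial i (fun x => f x + g x) x = partial i f x + partial i g x.
Proof. by move=> df dg; exact: (deriveD df dg). Qed.

Lemma Ck_cont k f : Ck k f -> continuous f.
Proof. by case: k => [|k] []. Qed.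

Lemma Ck_pred k f : Ck k.+1 f -> Ck k f.
Proof.
elim: k f => [|k IH] f [cf df]; first by split.
by split => // i; have [dfi cfi] := df i; split => //; exact: IH.
Qed.

Lemma Ck_cst k (c : R) : Ck k (fun _ : T => c).
Proof.
elim: k c => [|k IH] c; split => //; [exact: cst_continuous|exact: cst_continuous|].
move=> i; split => [x|]; first exact: derivable_cst.
rewrite (_ : partial i _ = fun=> 0); first exact: IH.
by apply/funext => x; exact: derive_cst.
Qed.

Lemma Ck_add k f g : Ck k f -> Ck k g -> Ck k (fun x => f x + g x).
Proof.
elim: k f g => [|k IH] f g [cf df] [cg dg].
  by split => //; exact: rV_contD.
split=> [|i]; first exact: rV_contD.
have [[dfi cfi] [dgi cgi]] := (df i, dg i); split => [x|].
  exact: (derivableD (dfi x) (dgi x)).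
rewrite (_ : partial i _ = fun x => partial i f x + partial i g x); first exact: IH.
by apply/funext => x; exact: partial_add.
Qed.

Lemma Ck_mul k f g : Ck k f -> Ck k g -> Ck k (fun x => f x * g x).
Proof.
elim: k f g => [|k IH] f g [cf df] [cg dg].
  by split => //; exact: rV_contM.
split=> [|i]; first exact: rV_contM.
have [[dfi cfi] [dgi cgi]] := (df i, dg i); split => [x|].
  exact: (derivableM (dfi x) (dgi x)).
rewrite (_ : partial i _ = fun x => f x * partial i g x + g x * partial i f x).
  by apply: Ck_add; apply: IH => //; apply: Ck_pred; split.
by apply/funext => x; exact: partial_mul.
Qed.

Lemma coord_derive (h : R -> R) (i j : 'I_n) (x : T) : derivable h (x 0 j) 1 ->
  derivable (fun y : T => h (y 0 j)) x (delta_mx 0 i) /\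
  partial i (fun y : T => h (y 0 j)) x = (i == j)%:R * derive1 h (x 0 j).
Proof.
move=> dh; rewrite /partial.
have [ij|ij] := eqVneq i j; last first.
  have E t : (fun y : T => h (y 0 j)) (t *: delta_mx 0 i + x) = h (x 0 j).
    by rewrite !mxE eqxx /= eq_sym (negbTE ij) mulr0 add0r.
  pose f1 (t : R) : R := t^-1 *: (h ((t *: delta_mx 0 i + x) 0 j) - h (x 0 j)).
  have E1 : f1 = cst 0.
    by apply/funext => t; rewrite /f1 (E t) subrr scaler0.
  rewrite mul0r; split.
    by change (cvg (f1 @ 0^')); rewrite E1; exact: is_cvg_cst.
  by change (lim (f1 @ 0^') = 0); rewrite E1; exact: lim_cst.
subst j; pose f1 (t : R) : R := t^-1 *: (h ((t *: delta_mx 0 i + x) 0 i) - h (x 0 i)).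
pose f2 (t : R) : R := t^-1 *: (h (t *: 1 + x 0 i) - h (x 0 i)).
have E1 : f1 = f2.
  by apply/funext => t; rewrite /f1 /f2 !mxE !eqxx /=.
rewrite mul1r derive1E; split.
  by change (cvg (f1 @ 0^')); rewrite E1.
by change (lim (f1 @ 0^') = lim (f2 @ 0^')); rewrite E1.
Qed.

Lemma is_derive_cosM (N t : R) :
  is_derive t 1 (fun t : R => cos (N * t)) (- N * sin (N * t)).
Proof.
have dN : is_derive t 1 (fun t : R => N * t) N.
  have -> : (fun t : R => N * t) = N \*: id by [].
  by apply: is_derive_eq; rewrite [LHS]mulr1.
have := @is_derive1_comp _ cos (fun t => N * t) t _ _ (is_derive_cos _) dN.
by rewrite (_ : - N * sin (N * t) = - sin (N * t) * N)//; ring.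
Qed.

Lemma is_derive_sinM (N t : R) :
  is_derive t 1 (fun t : R => sin (N * t)) (N * cos (N * t)).
Proof.
have dN : is_derive t 1 (fun t : R => N * t) N.
  have -> : (fun t : R => N * t) = N \*: id by [].
  by apply: is_derive_eq; rewrite [LHS]mulr1.
have := @is_derive1_comp _ sin (fun t => N * t) t _ _ (is_derive_sin _) dN.
by rewrite mulrC.
Qed.

Lemma coord_is_derive (h : R -> R) (d : R) (i j : 'I_n) (x : T) :
  is_derive (x 0 j) 1 h d ->
  derivable (fun y : T => h (y 0 j)) x (delta_mx 0 i) /\
  partial i (fun y : T => h (y 0 j)) x = (i == j)%:R * d.
Proof.
move=> dh; have [? ->] := coord_derive i (@ex_derive _ _ _ _ _ _ _ dh).
by rewrite derive1E derive_val.
Qed.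

(** Cosine and sine are treated together because each derivative involves the other function. *)
Lemma Ck_trig k (N : R) (j : 'I_n) :
  Ck k (fun x : T => cos (N * x 0 j)) /\ Ck k (fun x : T => sin (N * x 0 j)).
Proof.
have cN : continuous (fun x : T => N * x 0 j).
  by apply: rV_contM; [exact: cst_continuous|exact: coord_cont].
have cc : continuous (fun x : T => cos (N * x 0 j)).
  by move=> x; apply: continuous_comp; [exact: cN|exact: continuous_cos].
have cs : continuous (fun x : T => sin (N * x 0 j)).
  by move=> x; apply: continuous_comp; [exact: cN|exact: continuous_sin].
elim: k => [|k [IHc IHs]]; first by split; split.
split; split => // i; split => [x|].
- by have [] := coord_is_derive i (is_derive_cosM N (x 0 j)).
- rewrite (_ : partial i _ = fun x => ((i == j)%:R * - N) * sin (N * x 0 j)).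
    by apply: Ck_mul => //; exact: Ck_cst.
  apply/funext => x; have [_ ->] := coord_is_derive i (is_derive_cosM N (x 0 j)).
  by rewrite mulrA.
- by have [] := coord_is_derive i (is_derive_sinM N (x 0 j)).
- rewrite (_ : partial i _ = fun x => ((i == j)%:R * N) * cos (N * x 0 j)).
    by apply: Ck_mul => //; exact: Ck_cst.
  apply/funext => x; have [_ ->] := coord_is_derive i (is_derive_sinM N (x 0 j)).
  by rewrite mulrA.
Qed.

End smooth.

(** * Integration by parts and the Poincare inequality for test functions *)

Section domain.
Context {R : realType} {n : nat} (Om : lipschitz_domain R n).
Local Notation T := 'rV[R]_n.
Local Notation mu := (lebesgue_on Om).
Local Notation leb := (lebesgue_rV n : {measure set T -> \bar R}).
Implicit Types f g : T -> R.

Lemma domain_box : exists2 L : R, 0 < L & forall x : T, domain_set Om x -> forall i, `|x 0 i| <= L.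
Proof.
have [M [Mr MO]] := domain_bounded Om.
exists (Num.max 1 (M + 1)) => [|x xO i]; first by rewrite lt_max ltr01.
rewrite le_max; apply/orP; right.
have := MO (M + 1); rewrite ltrDl ltr01 => /(_ isT x xO); apply: le_trans.
rewrite [`|x|]mx_normrE.
exact: (le_bigmax _ (fun ij : 'I_1 * 'I_n => `|x ij.1 ij.2|) (0, i)).
Qed.

Lemma domain_finite : (mu setT < +oo)%E.
Proof.
have [L L0 OL] := domain_box.
rewrite /lebesgue_on /= /mrestr setTI.
apply: le_lt_trans (box_finite n L); apply: le_measure; rewrite ?inE.
- exact: (open_measurable_rV (@domain_open _ _ Om)).
- exact: box_measurable.
by move=> x xO i; rewrite /= in_itv/= -ler_norml; exact: OL.
Qed.

(** Moves integrals from [Om] to the whole space, where the iterated integration of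
    [integral_partial_boxed] is available. *)
Lemma integral_on (g : T -> \bar R) : (forall x, ~ domain_set Om x -> g x = 0%E) ->
  (\int[mu]_x g x = \int[leb]_x g x)%E.
Proof.
move=> g0.
have E (m : {measure set T -> \bar R}) :
    (\int[m]_x g x = \int[m]_(x in domain_set Om) g x)%E.
  rewrite [RHS]integral_mkcond; apply: eq_integral => x _; rewrite patchE.
  by case: ifPn => // /negP; rewrite inE; exact: g0.
rewrite !E; apply: eq_measure_integral => A mA AO.
by rewrite /lebesgue_on /= /mrestr setIidl.
Qed.

Lemma cont_on_integrable g : continuous g -> (forall x, ~ domain_set Om x -> g x = 0) ->
  (exists B : R, forall x, `|g x| <= B) /\
  mu.-integrable setT (EFin \o g) /\ leb.-integrable setT (EFin \o g).
Proof.
move=> cg g0; have [L L0 OL] := domain_box.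
have Z x : off_box L x -> g x = 0.
  by move=> [i Li]; apply: g0 => xO; have := OL x xO i; lra.
have [B gi] := boxed_integrable cg Z.
split => //; split => //; apply/integrableP; split.
  by apply/measurable_EFinP; exact: continuous_rV_measurable.
have [_] := integrableP _ _ _ gi; rewrite integral_on//.
by move=> x xO; rewrite /= g0// normr0.
Qed.

Section test.
Variable f : T -> R.
Hypothesis tf : test_function Om f.

Lemma test_Ck k : Ck k f. Proof. by case: tf. Qed.

Lemma test_cont : continuous f. Proof. exact: Ck_cont (test_Ck 0). Qed.

Lemma test_derivable i x : derivable f x (delta_mx 0 i).
Proof. by have [_ /(_ i)[]] := test_Ck 1. Qed.

Lemma test_partial i : test_function Om (partial i f).
Proof.
split => [k|]; first by have [_ /(_ i)[]] := test_Ck k.+1.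
have [_ [K [cK KO f0]]] := tf; exists K; split => // x Kx.
rewrite /partial; have -> : 'D_(delta_mx 0 i) f x = 'D_(delta_mx 0 i) (cst 0) x.
  apply: near_eq_derive.
  have : nbhs x (~` K).
    apply: open_nbhs_nbhs; split => //; apply: closed_openC.
    by apply: compact_closed => //; exact: norm_hausdorff.
  by apply: filterS => y; exact: f0.
exact: derive_cst.
Qed.

Lemma test_out x : ~ domain_set Om x -> f x = 0.
Proof. by move=> xO; have [_ [K [_ KO f0]]] := tf; apply: f0 => /KO. Qed.

Lemma test_L2 : f \in Lfun mu 2%:E.
Proof.
apply/L2P; split; first by apply: continuous_rV_measurable; exact: test_cont.
have [|x xO|_ []//] := @cont_on_integrable (fun x => f x * f x).
  by apply: rV_contM; exact: test_cont.
by rewrite test_out// mul0r.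
Qed.

End test.

Lemma test_mul f g : test_function Om f -> (forall k, Ck k g) ->
  test_function Om (fun x => g x * f x).
Proof.
move=> tf cg; split=> [k|]; first by apply: Ck_mul => //; exact: test_Ck.
have [_ [K [cK KO f0]]] := tf; exists K; split => // x /f0 ->.
by rewrite mulr0.
Qed.

(** The product [f * g] is supported in [Om], hence in a box, so its partial derivative integrates
    to 0. Compact support is asked of [f] alone. *)
Lemma ibp i f g : test_function Om f -> continuous g ->
  (forall x, derivable g x (delta_mx 0 i)) -> continuous (partial i g) ->
  ip mu (partial i f) g + ip mu f (partial i g) = 0.
Proof.
move=> tf cg dg cdg.
have cont0 (a b : T -> R) : test_function Om a -> continuous b ->
    continuous (fun x => a x * b x) /\ forall x, ~ domain_set Om x -> a x * b x = 0.
  move=> ta cb; split => [|x xO]; first by apply: rV_contM => //; exact: test_cont.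
  by rewrite (test_out ta xO) mul0r.
have [c1 z1] := cont0 _ _ tf cg.
have [c2 z2] := cont0 _ _ (test_partial tf i) cg.
have [c3 z3] := cont0 _ _ tf cdg.
have [_ [i2 _]] := cont_on_integrable c2 z2.
have [_ [i3 _]] := cont_on_integrable c3 z3.
have pE x : partial i (fun x => f x * g x) x = partial i f x * g x + f x * partial i g x.
  rewrite partial_mul//; last exact: test_derivable.
  by rewrite addrC [g x * _]mulrC.
rewrite /ip -RintegralD// /Rintegral.
have [L L0 OL] := domain_box.
have Z x : off_box L x -> f x * g x = 0.
  by move=> [j Lj]; apply: z1 => xO; have := OL x xO j; lra.
have dfg x : derivable (fun x => f x * g x) x (delta_mx 0 i).
  by apply: derivableM; [exact: test_derivable|exact: dg].
pose d x := partial i f x * g x + f x * partial i g x.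
have dE : partial i (fun x => f x * g x) = d by exact/funext.
have cd : continuous (partial i (fun x => f x * g x)) by rewrite dE; exact: rV_contD.
have d0 (x : T) : ~ domain_set Om x -> (d x)%:E = 0%E.
  by move=> xO; rewrite /d z2// z3// addr0.
have H := integral_partial_boxed L0 c1 cd dfg Z; rewrite dE in H.
exact: (congr1 fine (etrans (integral_on d0) H)).
Qed.

Lemma ibp_test i f g : test_function Om f -> test_function Om g ->
  ip mu (partial i f) g = - ip mu f (partial i g).
Proof.
move=> tf tg; apply/eqP; rewrite -subr_eq0 opprK; apply/eqP; apply: ibp => //.
- exact: test_cont.
- exact: test_derivable.
- by apply: test_cont; exact: test_partial.
Qed.

(* Integrate [partial_i (x_i f^2)] over Om, on which [x_i] is bounded. *)
Lemma poincare_test (i : 'I_n) : exists2 C : R, 0 < C & forall f, test_function Om f ->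
  ip mu f f <= C * ip mu (partial i f) (partial i f).
Proof.
have [L L0 OL] := domain_box; exists (4 * L ^+ 2); first by rewrite mulr_gt0// exprn_gt0.
move=> f tf; pose X (x : T) := x 0 i.
have dX x : derivable X x (delta_mx 0 i) /\ partial i X x = 1.
  have [? ->] := @coord_derive _ _ id i i x (@derivable_id _ _ _ _).
  by rewrite eqxx mul1r derive1_id.
have cX : continuous X by exact: coord_cont.
pose g x := X x * f x.
have cf := test_cont tf.
have cdf : continuous (partial i f) by apply: test_cont; exact: test_partial.
have pg : partial i g = fun x => X x * partial i f x + f x.
  apply/funext => x; rewrite partial_mul//; last 2 first.
  - by have [] := dX x.
  - exact: test_derivable.
  by have [_ ->] := dX x; rewrite mulr1.
have := @ibp i f g tf; rewrite pg => H.
have {H} : ip mu (partial i f) g + ip mu f (fun x => X x * partial i f x + f x) = 0.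
  apply: H.
  - exact: rV_contM.
  - by move=> x; apply: derivableM; [have [] := dX x|exact: test_derivable].
  - by apply: rV_contD => //; exact: rV_contM.
pose h x := X x * partial i f x.
have fL := test_L2 tf.
have hc : continuous h by exact: rV_contM.
have pO x : ~ domain_set Om x -> partial i f x = 0 by apply: test_out; exact: test_partial.
have hL : h \in Lfun mu 2%:E.
  apply/L2P; split; first exact: continuous_rV_measurable.
  have [||_ []//] := @cont_on_integrable (fun x => h x * h x).
    exact: rV_contM.
  by move=> x xO; rewrite /h pO// mulr0 mulr0.
rewrite [X in _ + X]ipC ipD//.
have -> : ip mu (partial i f) g = ip mu h f.
  by apply: eq_Rintegral => x _; rewrite /g /h mulrA [partial i f x * _]mulrC.
(* [H] reads [ip f f = - 2 * ip h f]. Young's inequality with [t = 1/2] bounds this by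
   [ip f f / 2 + 2 * ip h h], so [ip f f <= 4 * ip h h]; with [|X| <= L] on [Om] this is the
   constant [4 * L ^+ 2]. *)
move=> H; have half : 0 < 2^-1 :> R by [].
have := ip_young half fL hL; rewrite invrK (ipC _ f h) => Y.
have hh : ip mu h h <= L ^+ 2 * ip mu (partial i f) (partial i f).
  have pL := test_L2 (test_partial tf i).
  rewrite /ip -RintegralZl//; last exact: L2_mul.
  apply: le_Rintegral => //; [exact: L2_mul|apply: integrable_scale; exact: L2_mul|].
  move=> x _; rewrite /h mulrACA.
  have [xO|/pO ->] := pselect (domain_set Om x); last by rewrite !mul0r !mulr0.
  rewrite ler_wpM2r -?expr2 ?sqr_ge0// -(real_normK (num_real (X x))).
  by rewrite lerXn2r ?nnegrE// ?(ltW L0)//; exact: OL.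
move: H Y hh; rewrite -/h.
have := ler_norm (- ip mu h f); rewrite normrN.
set a := ip mu h f; set b := ip mu f f; set c := ip mu h h.
rewrite -mulrA; set e := L ^+ 2 * _; move: `|a| => a'; lra.
Qed.

(** * Energy identities, Parseval, unboundedness of the eigenvalues *)

Section system.
Variable E : dirichlet_system Om.
Local Notation z := (eigfun E).
Local Notation rho := (eigval E).

Lemma eig_approx k : exists (g : 'I_n -> T -> R) (F : nat -> T -> R),
  [/\ forall i, g i \in Lfun mu 2%:E, forall j, test_function Om (F j),
    ip mu (fun x => F j x - z k x) (fun x => F j x - z k x) @[j --> \oo] --> 0,
    forall i, ip mu (fun x => partial i (F j) x - g i x)
      (fun x => partial i (F j) x - g i x) @[j --> \oo] --> 0 &
    forall f, test_function Om f ->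
      \sum_(i < n) ip mu (g i) (partial i f) = rho k * ip mu (z k) f].
Proof.
have [g [zL gL [F [tF cF cdF]]] wk] := eigfunP E k.
exists g, F; split => //.
- by apply: (L2_cvgP (fun j => test_L2 (tF j)) zL).1; exact: cF.
- move=> i; apply: (L2_cvgP (fun j => test_L2 (test_partial (tF j) i)) (gL i)).1.
  exact: cdF.
move=> f tf; rewrite -wk// -Rintegral_sumr// => i.
by apply: L2_mul => //; exact: test_L2 (test_partial tf i).
Qed.

(** An eigenfunction may not itself be a test function, so each property is proved for the
    approximating test functions [F j] and passed to the limit. *)
Lemma eig_energy k : exists g : 'I_n -> T -> R,
  [/\ forall i, g i \in Lfun mu 2%:E,
     \sum_(i < n) ip mu (g i) (g i) = rho k,
     forall i f, test_function Om f ->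
       ip mu (z k) (partial i (partial i f)) = - ip mu (g i) (partial i f),
     forall f, test_function Om f ->
      \sum_(i < n) ip mu (g i) (partial i f) = rho k * ip mu (z k) f &
     forall i C, (forall f, test_function Om f ->
       ip mu f f <= C * ip mu (partial i f) (partial i f)) ->
       1 <= C * ip mu (g i) (g i)].
Proof.
have [g [F [gL tF cF cdF wk]]] := eig_approx k.
have zL := eigfun_L2 E k.
have FL j := test_L2 (tF j).
have dFL i j := test_L2 (test_partial (tF j) i).
exists g; split => //.
(* The weak formulation is tested with [F j]; its two sides tend to the energy and, since [z k] has
   norm 1, to [rho k]. *)
- have c1 : \sum_(i < n) ip mu (g i) (partial i (F j)) @[j --> \oo] -->
      \sum_(i < n) ip mu (g i) (g i).
    apply: cvgn_sum => i; under eq_fun do rewrite ipC.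
    exact: ip_cvg (dFL i) (gL i) (gL i) (cdF i).
  have c2 : \sum_(i < n) ip mu (g i) (partial i (F j)) @[j --> \oo] --> rho k.
    have -> : (fun j => \sum_(i < n) ip mu (g i) (partial i (F j))) =
        (fun j => rho k * ip mu (F j) (z k)).
      by apply/funext => j; rewrite wk// ipC.
    rewrite -[X in _ --> X]mulr1; apply: cvgM; first exact: cvg_cst.
    have -> : 1 = ip mu (z k) (z k) by rewrite /ip eigfun_orthonormal eqxx.
    exact: (ip_cvg FL zL zL cF).
  exact: cvg_unique c1 c2.
- move=> i f tf.
  have pL := test_L2 (test_partial tf i).
  have ppL := test_L2 (test_partial (test_partial tf i) i).
  have c1 := ip_cvg FL zL ppL cF.
  have c2 := ip_cvg (dFL i) (gL i) pL (cdF i).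
  have c3 : ip mu (F j) (partial i (partial i f)) @[j --> \oo] -->
      - ip mu (g i) (partial i f).
    have -> : (fun j => ip mu (F j) (partial i (partial i f))) =
        (fun j => - ip mu (partial i (F j)) (partial i f)).
      apply/funext => j; rewrite ibp_test ?opprK//; exact: test_partial.
    exact: cvgN.
  exact: cvg_unique c1 c3.
move=> i C PC.
have c1 := ip_sqr_cvg FL zL cF.
have c2 := ip_sqr_cvg (dFL i) (gL i) (cdF i).
have -> : 1 = ip mu (z k) (z k) by rewrite /ip eigfun_orthonormal eqxx.
rewrite -subr_ge0.
apply: (@cvgn_ge _ (fun j => C * ip mu (partial i (F j)) (partial i (F j)) - ip mu (F j) (F j)) _ _ 0).
  by apply: cvgB => //; apply: cvgM => //; exact: cvg_cst.
by move=> j _; rewrite subr_ge0; exact: PC.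
Qed.

(** The Poincare inequality passes to [z k], which has norm 1, and one partial derivative has at
    most the full energy [rho k]. In particular the eigenvalues are positive. *)
Lemma eigval_lb : (0 < n)%N -> exists2 c : R, 0 < c & forall k, c <= rho k.
Proof.
move=> n0; have [C C0 PC] := poincare_test (Ordinal n0).
exists C^-1; first by rewrite invr_gt0.
move=> k; have [g [_ <- _ _ /(_ _ _ PC)]] := eig_energy k.
rewrite mulrC -ler_pdivrMr// mul1r => /le_trans; apply.
rewrite (bigD1 (Ordinal n0))//= lerDl sumr_ge0// => i _; exact: ip_ge0.
Qed.

Definition psum (a : nat -> R) N (x : T) := \sum_(k < N) a k * z k x.

Lemma psum_L2 a N : psum a N \in Lfun mu 2%:E.
Proof. by apply: L2_sum => k; apply: L2_scale; exact: eigfun_L2. Qed.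

Lemma ip_psum a N g : g \in Lfun mu 2%:E ->
  ip mu (psum a N) g = \sum_(k < N) a k * ip mu (z k) g.
Proof.
move=> gL; rewrite ip_sum// => [|k]; last by apply: L2_scale; exact: eigfun_L2.
by apply: eq_bigr => k _; rewrite ipZ//; exact: eigfun_L2.
Qed.

Lemma ip_psum2 a b N : ip mu (psum a N) (psum b N) = \sum_(k < N) a k * b k.
Proof.
rewrite ip_psum; last exact: psum_L2.
apply: eq_bigr => k _; congr (_ * _).
have [_ /=] := Defs.coef_sum E b N k; rewrite /coef ltn_ord => <-.
by rewrite ipC.
Qed.

Lemma coefE f k : coef E f k = ip mu (z k) f.
Proof. by rewrite ipC. Qed.

Lemma expansion_cvg a f : expansion Om z a f ->
  f \in Lfun mu 2%:E /\
  ip mu (fun x => psum a N x - f x) (fun x => psum a N x - f x) @[N --> \oo] --> 0.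
Proof.
move=> [fL cf]; split => //; apply: (L2_cvgP (psum_L2 a) fL).1; exact: cf.
Qed.

Lemma basis_cvg f : f \in Lfun mu 2%:E ->
  ip mu (fun x => psum (coef E f) N x - f x) (fun x => psum (coef E f) N x - f x)
    @[N --> \oo] --> 0.
Proof. by move=> fL; have [] := expansion_cvg (eigfun_basis E fL). Qed.

Lemma parseval f : f \in Lfun mu 2%:E ->
  \sum_(k < N) coef E f k ^+ 2 @[N --> \oo] --> ip mu f f.
Proof.
move=> fL; have := ip_sqr_cvg (psum_L2 _) fL (basis_cvg fL).
by under eq_fun do rewrite ip_psum2.
Qed.

Lemma bessel f N : f \in Lfun mu 2%:E -> \sum_(k < N) coef E f k ^+ 2 <= ip mu f f.
Proof.
move=> fL; apply: (cvgn_ge (K := N) (parseval fL)) => M NM.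
rewrite -(subnKC NM) big_split_ord/= lerDl sumr_ge0// => k _; exact: sqr_ge0.
Qed.

(** Formally, the gradient energy is [- ip f lap], that is the sum of [rho k * coef f k ^+ 2], to be
    compared with Parseval's sum for [ip f f]. *)
Lemma gradient_bound C f : (forall k, rho k <= C) -> test_function Om f ->
  \sum_(i < n) ip mu (partial i f) (partial i f) <= C * ip mu f f.
Proof.
move=> rC tf; have fL := test_L2 tf.
have pL i := test_L2 (test_partial tf i).
have ppL i := test_L2 (test_partial (test_partial tf i) i).
pose lap x := \sum_(i < n) partial i (partial i f) x.
have lapL : lap \in Lfun mu 2%:E by exact: L2_sum.
have lapE k : ip mu (z k) lap = - (rho k * coef E f k).
  have [g [_ _ pp wk _]] := eig_energy k.
  rewrite ipC ip_sum//; last exact: eigfun_L2.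
  rewrite coefE -wk// -sumrN; apply: eq_bigr => i _.
  by rewrite ipC pp.
have -> : \sum_(i < n) ip mu (partial i f) (partial i f) = - ip mu f lap.
  rewrite ipC ip_sum// -sumrN; apply: eq_bigr => i _.
  rewrite (ibp_test i (test_partial tf i) tf) opprK.
  by [].
have c1 := ip_cvg (psum_L2 _) fL lapL (basis_cvg fL).
(* Only [f] is expanded: for its partial sums the difference of the two sides is a finite sum of
   nonnegative terms. *)
have c2 : C * \sum_(k < N) coef E f k ^+ 2 + ip mu (psum (coef E f) N) lap
    @[N --> \oo] --> C * ip mu f f + ip mu f lap.
  by apply: cvgD => //; apply: cvgM; [exact: cvg_cst|exact: parseval].
rewrite -subr_ge0 opprK; apply: (cvgn_ge (K := 0) c2) => N _.
rewrite ip_psum// mulr_sumr -big_split/= sumr_ge0// => k _.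
rewrite lapE mulrN subr_ge0 mulrCA -expr2.
by rewrite ler_wpM2r// sqr_ge0.
Qed.

Lemma eigval_unbounded C : (0 < n)%N -> exists k, C < rho k.
Proof.
move=> n0; apply: contrapT => nC.
have rC k : rho k <= C by rewrite leNgt; apply/negP => Ck; apply: nC; exists k.
pose i0 := Ordinal n0.
(* A nonzero test function exists because test functions approximate the first eigenfunction, whose
   norm is 1. *)
have [f [tf f0]] : exists f, test_function Om f /\ 0 < ip mu f f.
  have [g [F [_ tF cF _ _]]] := eig_approx 0; apply: contrapT => nf.
  have zL := eigfun_L2 E 0.
  have := ip_sqr_cvg (fun j => test_L2 (tF j)) zL cF.
  rewrite {2}/ip eigfun_orthonormal eqxx => c1.
  have : 1 <= 0 :> R; last by lra.
  apply: (cvgn_le (K := 0) c1) => j _; rewrite leNgt; apply/negP => j0.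
  by apply: nf; exists (F j).
(* Any [N] with [N ^+ 2 > C] would do; here [N ^+ 2 = |C| ^+ 2 + 2 * |C| + 1]. *)
pose N : R := `|C| + 1.
pose fc (x : T) := cos (N * x 0 i0) * f x; pose fs (x : T) := sin (N * x 0 i0) * f x.
have tc : test_function Om fc by apply: test_mul => // k; have [] := Ck_trig (n := n) k N i0.
have ts : test_function Om fs by apply: test_mul => // k; have [] := Ck_trig (n := n) k N i0.
have fL := test_L2 tf; have [fcL fsL] := (test_L2 tc, test_L2 ts).
have dL h (th : test_function Om h) := test_L2 (test_partial th i0).
have GB h : test_function Om h ->
    ip mu (partial i0 h) (partial i0 h) <= C * ip mu h h.
  move=> /(gradient_bound rC); apply: le_trans.
  by rewrite (bigD1 i0)//= lerDl sumr_ge0// => i _; exact: ip_ge0.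
have pc x : partial i0 fc x = cos (N * x 0 i0) * partial i0 f x - N * sin (N * x 0 i0) * f x.
  have [d1 e1] := coord_is_derive i0 (is_derive_cosM N (x 0 i0)).
  rewrite (partial_mul d1 (@test_derivable _ tf i0 x)).
  by rewrite e1 eqxx mul1r mulNr mulrN [f x * _]mulrC.
have ps x : partial i0 fs x = sin (N * x 0 i0) * partial i0 f x + N * cos (N * x 0 i0) * f x.
  have [d1 e1] := coord_is_derive i0 (is_derive_sinM N (x 0 i0)).
  rewrite (partial_mul d1 (@test_derivable _ tf i0 x)).
  by rewrite e1 eqxx mul1r [f x * _]mulrC.
have E1 : ip mu fc fc + ip mu fs fs = ip mu f f.
  rewrite /ip -RintegralD//; [|exact: L2_mul..].
  apply: eq_Rintegral => x _; rewrite /fc /fs.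
  set c := cos _; set s := sin _; set b := f x.
  have cs : c ^+ 2 + s ^+ 2 = 1 by exact: cos2Dsin2.
  transitivity ((c ^+ 2 + s ^+ 2) * (b * b)); first by ring.
  by rewrite cs mul1r.
(* The cross terms cancel between the cosine and the sine, which is why both functions are
   tested. *)
have E2 : ip mu (partial i0 fc) (partial i0 fc) + ip mu (partial i0 fs) (partial i0 fs) =
    N ^+ 2 * ip mu f f + ip mu (partial i0 f) (partial i0 f).
  apply: ip_pointwise; [exact: dL|exact: dL|exact: fL|exact: dL|] => x; rewrite pc ps.
  set c := cos _; set s := sin _; set a := partial _ _ _; set b := f x.
  have cs : c ^+ 2 + s ^+ 2 = 1 by exact: cos2Dsin2.
  transitivity ((c ^+ 2 + s ^+ 2) * (a * a + N ^+ 2 * b * b)); first by ring.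
  by rewrite cs; ring.
have := lerD (GB _ tc) (GB _ ts); rewrite E2 -mulrDr E1.
have p0 := ip_ge0 mu (partial i0 f).
move=> h; have : N ^+ 2 * ip mu f f <= C * ip mu f f.
  by apply: le_trans h; rewrite lerDl.
rewrite (ler_pM2r f0) => NC.
have C1 := ler_norm C; have C2 := normr_ge0 C.
clear -NC C1 C2; have : N ^+ 2 = `|C| * `|C| + 2 * `|C| + 1 by rewrite /N; ring.
by have := mulr_ge0 C2 C2; lra.
Qed.

End system.

End domain.

(** * Fractional spaces and compactness *)

Section fractional.
Context {R : realType} {n : nat} {Om : lipschitz_domain R n}.
Variables (E : dirichlet_system Om) (alpha : R).
Hypotheses (n_gt0 : (0 < n)%N) (alpha_gt0 : 0 < alpha).
Local Notation T := 'rV[R]_n.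
Local Notation mu := (lebesgue_on Om).
Local Notation z := (eigfun E).
Local Notation rho := (eigval E).
Local Notation L2 f := (f \in Lfun mu 2%:E).
Local Notation fH := (fracH E alpha).
Implicit Types u v : T -> R.

Definition om k := rho k `^ (alpha / 2).

Lemma rho_gt0 k : 0 < rho k.
Proof. by have [c c0 cr] := eigval_lb E n_gt0; exact: lt_le_trans (cr k). Qed.

Lemma om_gt0 k : 0 < om k. Proof. exact/powR_gt0/rho_gt0. Qed.

Lemma om_ge0 k : 0 <= om k. Proof. exact/ltW/om_gt0. Qed.

Lemma om_mono j k : (j <= k)%N -> om j <= om k.
Proof.
move=> jk; apply: ge0_ler_powR; last exact: eigval_mono.
- by rewrite divr_ge0// ltW.
- by rewrite nnegrE ltW ?rho_gt0.
- by rewrite nnegrE ltW ?rho_gt0.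
Qed.

Lemma om_unbounded C : 0 < C -> exists N, forall k, (N <= k)%N -> C <= om k.
Proof.
move=> C0; have [N CN] := eigval_unbounded E (C `^ (2 / alpha)) n_gt0.
exists N => k /om_mono; apply: le_trans.
have -> : C = (C `^ (2 / alpha)) `^ (alpha / 2).
  rewrite -powRrM (_ : 2 / alpha * (alpha / 2) = 1) ?powRr1 ?ltW//.
  by field; rewrite gt_eqF.
by apply: ge0_ler_powR; rewrite ?nnegrE ?ltW ?divr_gt0 ?powR_gt0 ?rho_gt0.
Qed.

Lemma coefZ a u k : L2 u -> coef E (fun x => a * u x) k = a * coef E u k.
Proof. by move=> uL; rewrite !coefE ipC ipZ ?(ipC _ u)//; exact: eigfun_L2. Qed.

Lemma coefD u v k : L2 u -> L2 v ->
  coef E (fun x => u x + v x) k = coef E u k + coef E v k.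
Proof. by move=> uL vL; exact: (ipD uL vL (eigfun_L2 E k)). Qed.

Lemma coefS u v k : L2 u -> L2 v ->
  coef E (fun x => u x - v x) k = coef E u k - coef E v k.
Proof. by move=> uL vL; exact: (ipB uL vL (eigfun_L2 E k)). Qed.

Definition esum u N := \sum_(k < N) coef E u k ^+ 2 * om k.

Definition sqn u := fracH_norm E alpha u ^+ 2.

Lemma term_ge0 u k : 0 <= coef E u k ^+ 2 * om k.
Proof. by rewrite mulr_ge0 ?sqr_ge0 ?om_ge0. Qed.

Lemma sqnE u : sqn u = fine (\sum_(k <oo) (coef E u k ^+ 2 * om k)%:E)%E.
Proof.
rewrite /sqn /fracH_norm sqr_sqrtr// fine_ge0// nneseries_ge0// => k _ _.
by rewrite lee_fin term_ge0.
Qed.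

Lemma fH_L2 u : fH u -> L2 u. Proof. by move=> [a [[]]]. Qed.

Lemma fH_fin u : fH u -> (\sum_(k <oo) (coef E u k ^+ 2 * om k)%:E = (sqn u)%:E)%E.
Proof.
move=> uH; rewrite sqnE fineK// ge0_fin_numE; first exact: fracH_summable.
by apply: nneseries_ge0 => k _ _; rewrite lee_fin term_ge0.
Qed.

Lemma esum_cvg u : fH u -> esum u @ \oo --> sqn u.
Proof.
move=> uH; have := fH_fin uH => H.
have cv : (\sum_(0 <= k < N) (coef E u k ^+ 2 * om k)%:E @[N --> \oo] --> (sqn u)%:E)%E.
  rewrite -H; apply: is_cvg_nneseries => k _ _; rewrite lee_fin; exact: term_ge0.
rewrite (_ : esum u = fine \o (fun N => \sum_(0 <= k < N) (coef E u k ^+ 2 * om k)%:E)%E).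
  exact: fine_cvg cv.
by apply/funext => N; rewrite /= sumEFin big_mkord.
Qed.

Lemma esum_mono u N M : (N <= M)%N -> esum u N <= esum u M.
Proof.
move=> NM; rewrite /esum -(subnKC NM) big_split_ord/= lerDl sumr_ge0// => k _.
exact: term_ge0.
Qed.

Lemma esum_le u N : fH u -> esum u N <= sqn u.
Proof. by move=> uH; apply: (cvgn_ge (K := N) (esum_cvg uH)) => M; exact: esum_mono. Qed.

(** The membership test behind scaling, sums and limits: a uniform bound on the partial sums
    suffices. *)
Lemma fH_bound u C : L2 u -> (forall N, esum u N <= C) -> fH u /\ sqn u <= C.
Proof.
move=> uL uC; have H := nneseries_le (term_ge0 u) uC.
have uH : fH u.
  exists (coef E u); split; last exact: le_lt_trans H (ltry _).
  exact: eigfun_basis.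
by split => //; rewrite -lee_fin -fH_fin.
Qed.

Lemma sqn_ge0 u : 0 <= sqn u. Proof. exact: sqr_ge0. Qed.

(** Poincare inequality in spectral form: [om 0] is the smallest weight. It is the constant against
    which (A3) and (A4) measure their quadratic terms. *)
Lemma L2_le_sqn u : fH u -> om 0%N * ip mu u u <= sqn u.
Proof.
move=> uH; have uL := fH_L2 uH.
have c1 : om 0%N * \sum_(k < N) coef E u k ^+ 2 @[N --> \oo] --> om 0%N * ip mu u u.
  by apply: cvgM; [exact: cvg_cst|exact: parseval].
apply: (cvgn_le (K := 0%N) c1) => N _; apply: le_trans (esum_le N uH).
rewrite mulr_sumr; apply: ler_sum => k _; rewrite mulrC ler_wpM2l ?sqr_ge0//.
exact: om_mono.
Qed.

Lemma fH_scale a u : fH u -> fH (fun x => a * u x) /\ sqn (fun x => a * u x) = a ^+ 2 * sqn u.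
Proof.
move=> uH; have uL := fH_L2 uH; have auL := L2_scale a uL.
have eE N : esum (fun x => a * u x) N = a ^+ 2 * esum u N.
  rewrite mulr_sumr; apply: eq_bigr => k _.
  by rewrite coefZ// exprMn mulrA.
have [auH _] : fH (fun x => a * u x) /\ sqn (fun x => a * u x) <= a ^+ 2 * sqn u.
  apply: fH_bound => // N; rewrite eE ler_wpM2l ?sqr_ge0//; exact: esum_le.
split => //; apply: cvg_unique (esum_cvg auH) _ => //.
have -> : esum (fun x => a * u x) = fun N => a ^+ 2 * esum u N by exact/funext.
by apply: cvgM; [exact: cvg_cst|exact: esum_cvg].
Qed.

(** The parallelogram law holds term by term. Both summands on its left are nonnegative, so each is
    bounded by the right-hand side, which gives the two memberships. *)
Lemma fH_add_sub u v : fH u -> fH v ->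
  [/\ fH (fun x => u x + v x), fH (fun x => u x - v x) &
     sqn (fun x => u x + v x) + sqn (fun x => u x - v x) = 2 * sqn u + 2 * sqn v].
Proof.
move=> uH vH; have [uL vL] := (fH_L2 uH, fH_L2 vH).
have [aL sL] := (L2_add uL vL, L2_sub uL vL).
have eE N : esum (fun x => u x + v x) N + esum (fun x => u x - v x) N =
    2 * esum u N + 2 * esum v N.
  rewrite !mulr_sumr -!big_split/=; apply: eq_bigr => k _.
  by rewrite coefD// coefS//; ring.
have eC N : esum (fun x => u x + v x) N + esum (fun x => u x - v x) N <=
    2 * sqn u + 2 * sqn v.
  by rewrite eE lerD// ler_wpM2l//; exact: esum_le.
have e0 w N : 0 <= esum w N by rewrite sumr_ge0// => k _; exact: term_ge0.
have [aH _] : fH (fun x => u x + v x) /\ sqn (fun x => u x + v x) <= 2 * sqn u + 2 * sqn v.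
  by apply: fH_bound => // N; apply: le_trans (eC N); rewrite lerDl.
have [sH _] : fH (fun x => u x - v x) /\ sqn (fun x => u x - v x) <= 2 * sqn u + 2 * sqn v.
  by apply: fH_bound => // N; apply: le_trans (eC N); rewrite lerDr.
split => //.
have c1 : esum (fun x => u x + v x) N + esum (fun x => u x - v x) N @[N --> \oo]
    --> sqn (fun x => u x + v x) + sqn (fun x => u x - v x).
  by apply: cvgD; exact: esum_cvg.
have c2 : 2 * esum u N + 2 * esum v N @[N --> \oo] --> 2 * sqn u + 2 * sqn v.
  by apply: cvgD; apply: cvgM; [exact: cvg_cst|exact: esum_cvg|exact: cvg_cst|exact: esum_cvg].
move: c1; under eq_fun do rewrite eE.
by move=> c1; exact: cvg_unique c1 c2.
Qed.

Lemma fH_0 : fH (fun=> 0).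
Proof.
have L0 := L2_0 mu; have [] := @fH_bound (fun=> 0) 0 L0 => // N.
rewrite /esum big1// => k _; rewrite coefE ipC /ip.
under eq_Rintegral do rewrite mul0r.
by rewrite /Rintegral integral0 expr0n mul0r.
Qed.

Lemma psum_sub a N M : (N <= M)%N ->
  ip mu (fun x => psum E a M x - psum E a N x) (fun x => psum E a M x - psum E a N x) =
  \sum_(k < M) a k ^+ 2 - \sum_(k < N) a k ^+ 2.
Proof.
move=> NM; pose b k := if (k < N)%N then 0 else a k.
have -> : (fun x => psum E a M x - psum E a N x) = psum E b M.
  apply/funext => x; rewrite /psum -(subnKC NM) !big_split_ord/= addrAC subrr add0r.
  rewrite [X in _ = X + _]big1 ?add0r.
    by apply: eq_bigr => k _; rewrite /b ltnNge leq_addr.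
  by move=> k _; rewrite /b ltn_ord mul0r.
rewrite ip_psum2 -(subnKC NM) !big_split_ord/= addrAC subrr add0r big1 ?add0r.
  by apply: eq_bigr => k _; rewrite /b ltnNge leq_addr expr2.
by move=> k _; rewrite /b ltn_ord mul0r.
Qed.

(** The partial sums are Cauchy in L2; along a fast subsequence they converge by [L2_fast_complete],
    and coefficients pass to the limit. *)
Lemma riesz_fischer (a : nat -> R) C : (forall N, \sum_(k < N) a k ^+ 2 <= C) ->
  exists2 u, L2 u & forall k, coef E u k = a k.
Proof.
move=> aC; pose s N := \sum_(k < N) a k ^+ 2.
have smono : nondecreasing_seq s.
  move=> N M NM; rewrite /s -(subnKC NM) big_split_ord/= lerDl sumr_ge0// => k _.
  exact: sqr_ge0.
have subs : has_ubound (range s) by exists C => _ [N _ <-]; exact: aC.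
have cs := nondecreasing_cvgn smono subs.
set S := sup _ in cs.
have sS N : s N <= S by apply: (cvgn_ge (K := N) cs) => M; exact: smono.
have [K KP] : {K : nat -> nat & forall j, S - s (K j) <= 8^-1 ^+ j}.
  apply: (@choice _ _ (fun j k => S - s k <= 8^-1 ^+ j)) => j.
  have j0 : 0 < 8^-1 ^+ j :> R by rewrite exprn_gt0.
  have /cvgrPdist_le/(_ _ j0)[k _ kh] := cs; exists k.
  by apply: le_trans (kh k (leqnn k)); exact: ler_norm.
(* Adding up the [K i] makes the indices monotone and at least [K j], so tails are below
   [8^-1 ^+ j]; adding [j] ensures that every mode is eventually included. *)
pose N j := (j + \sum_(i < j.+1) K i)%N.
have NK j : (K j <= N j)%N by rewrite /N big_ord_recr/= addnA leq_addl.
have Nj j : (j <= N j)%N by rewrite leq_addr.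
have NS j : (N j <= N j.+1)%N.
  by rewrite /N [X in (_ <= _ + X)%N]big_ord_recr/= addSn ltnW// ltnS leq_add2l leq_addr.
have [|f fL Ff] := @L2_fast_complete _ _ _ mu (fun j => psum E a (N j))
    (fun j => psum_L2 E a (N j)).
  move=> j; rewrite psum_sub//; apply: le_trans (KP j); apply: lerB; first exact: sS.
  exact: smono.
exists f => // k; have zL := eigfun_L2 E k.
have c1 := ip_cvg (fun j => psum_L2 E a (N j)) fL zL Ff.
have Nk j : (k < j)%N -> ip mu (psum E a (N j)) (z k) = a k.
  move=> kj; have [_ /=] := Defs.coef_sum E a (N j) k.
  by rewrite (leq_trans kj (Nj j)).
apply/eqP; rewrite eq_le; apply/andP; split.
  by apply: (cvgn_le (K := k.+1) c1) => j kj; rewrite Nk.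
by apply: (cvgn_ge (K := k.+1) c1) => j kj; rewrite Nk.
Qed.

(** [frac_laplacian] is picked by [xget], so a function with the required expansion must first be
    produced; Riesz-Fischer gives one. Parseval then identifies the norm, since squaring the power
    [alpha / 4] gives the weight [om]. *)
Lemma frac_laplacian_sqn u : fH u ->
  L2 (frac_laplacian E (alpha / 4) u) /\
  ip mu (frac_laplacian E (alpha / 4) u) (frac_laplacian E (alpha / 4) u) = sqn u.
Proof.
move=> uH; pose a k := coef E u k * rho k `^ (alpha / 4).
have a2 k : a k ^+ 2 = coef E u k ^+ 2 * om k.
  rewrite /a exprMn /om (_ : alpha / 2 = alpha / 4 * 2%:R); last by field.
  by rewrite (powRrM _ (alpha / 4)) powR_mulrn// powR_ge0.
have aE N : \sum_(k < N) a k ^+ 2 = esum u N by apply: eq_bigr => k _; exact: a2.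
have [f fL fa] : exists2 u, L2 u & forall k, coef E u k = a k.
  by apply: (@riesz_fischer _ (sqn u)) => N; rewrite aE; exact: esum_le.
have ex : expansion Om z a f.
  by rewrite (_ : a = coef E f); [exact: eigfun_basis|apply/funext => k; rewrite fa].
set h := frac_laplacian _ _ _.
have hx : expansion Om z a h.
  by have := @xgetI _ (cst 0) [set h | expansion Om z a h] f ex.
have hL : L2 h by case: hx.
split => //; have hc := expansion_coef hx.
apply: cvg_unique (parseval E hL) _ => //.
have -> : (fun N => \sum_(k < N) coef E h k ^+ 2) = esum u; last exact: esum_cvg.
by apply/funext => N; rewrite -aE; apply: eq_bigr => k _; rewrite hc.
Qed.

(** [sqn] is the supremum of its partial sums, each depending on finitely many coefficients and
    hence continuous in L2. *)
Lemma sqn_lsc (U : nat -> T -> R) u e : (forall j, fH (U j)) -> fH u ->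
  ip mu (fun x => U j x - u x) (fun x => U j x - u x) @[j --> \oo] --> 0 ->
  0 < e -> \forall j \near \oo, sqn u - e <= sqn (U j).
Proof.
move=> UH uH Uu e0; have e20 : 0 < e / 2 by rewrite divr_gt0.
have /cvgrPdist_le/(_ _ e20)[N _ Nh] := esum_cvg uH.
have {Nh} NS : sqn u - esum u N <= e / 2.
  by apply: le_trans (Nh N (leqnn N)); exact: ler_norm.
have cU : esum (U j) N @[j --> \oo] --> esum u N.
  apply: cvgn_sum => k; apply: cvgM; last exact: cvg_cst.
  have ck : coef E (U j) k @[j --> \oo] --> coef E u k.
    apply: ip_cvg Uu; [by move=> j; exact: fH_L2|exact: fH_L2|exact: eigfun_L2].
  by rewrite expr2; under eq_fun do rewrite expr2; exact: cvgM.
have /cvgrPdist_le/(_ _ e20) := cU; apply: filterS => j jh.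
apply: le_trans (esum_le N (UH j)).
have := le_trans (ler_norm _) jh; move: NS; move: (sqn u) (esum u N) (esum _ N) => a b c.
by lra.
Qed.

(** The compactness mechanism: beyond mode [N] the weights exceed [C], so the high modes carry an L2
    mass that is small uniformly on bounded sets. *)
Lemma L2_tail u N C : fH u -> 0 < C -> (forall k, (N <= k)%N -> C <= om k) ->
  ip mu u u <= \sum_(k < N) coef E u k ^+ 2 + C^-1 * sqn u.
Proof.
move=> uH C0 CN; have uL := fH_L2 uH.
apply: (cvgn_le (K := N) (parseval E uL)) => M NM.
have {NM}[d ->] : exists d, M = (N + d)%N by exists (M - N)%N; rewrite subnKC.
rewrite big_split_ord/= lerD2l.
rewrite -ler_pdivrMl ?invr_gt0// invrK; apply: le_trans (esum_le (N + d) uH).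
rewrite /esum big_split_ord/=; apply: ler_wpDl.
  by rewrite sumr_ge0// => k _; exact: term_ge0.
rewrite mulr_sumr; apply: ler_sum => k _; rewrite mulrC ler_wpM2l ?sqr_ge0//.
by apply: CN; rewrite leq_addr.
Qed.

(** * Compactness of bounded sets of pairs for the L2 distance *)

Local Notation X := (fracHH E alpha).

(** A single index set for the coefficients of both components, so that a pair is a point of one
    product space. *)
Definition hcoef (p : X) (i : bool * nat) : R :=
  coef E (if i.1 then fracHH_fst p else fracHH_snd p) i.2.

Definition sqnn (p : X) := sqn (fracHH_fst p) + sqn (fracHH_snd p).

(** The squared L2 distance, weaker than the distance of [fracHH]. *)
Definition dist2 (p q : X) :=
  ip mu (fun x => fracHH_fst p x - fracHH_fst q x)
        (fun x => fracHH_fst p x - fracHH_fst q x) +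
  ip mu (fun x => fracHH_snd p x - fracHH_snd q x)
        (fun x => fracHH_snd p x - fracHH_snd q x).

(* Tychonoff for the sequences of Fourier coefficients; working with filters rather than
   sequences lets the same lemma serve the existence proof and the limit of saddle points. *)
Lemma fracHH_cluster (F : set_system X) (FF : ProperFilter F) (r : R) :
  F [set p | sqnn p <= r] ->
  exists a : bool * nat -> R, forall A N (e : R), F A -> 0 < e ->
    exists p, [/\ A p, sqnn p <= r & forall b k, (k < N)%N -> `|hcoef p (b, k) - a (b, k)| < e].
Proof.
(* A coefficient satisfies [c ^+ 2 <= r / om 0]; adding 1 bounds [|c|] without a square root, as
   [c <= c ^+ 2 + 1/4]. *)
move=> Fr; pose B : set R := `[- (r / om 0 + 1), r / om 0 + 1]%classic.
pose K : set (prod_topology (fun _ : bool * nat => R)) := [set f | forall i, B (f i)].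
have cK : compact K.
  by apply: (@tychonoff _ (fun=> R) (fun=> B)) => i; exact: segment_compact.
have FK : (hcoef @ F) K.
  rewrite /fmap/=; apply: filterS Fr => p /= pr [b k].
  have [u [uH uE ur]] : exists u, [/\ fH u, hcoef p (b, k) = coef E u k & sqn u <= r].
    exists (if b then fracHH_fst p else fracHH_snd p); split => //.
      by case: b; [exact: fracHH_fstP|exact: fracHH_sndP].
    apply: le_trans pr; rewrite /sqnn; case: b; [rewrite lerDl|rewrite lerDr]; exact: sqn_ge0.
  rewrite uE /B /= in_itv/= -ler_norml.
  have c2 : coef E u k ^+ 2 <= r / om 0.
    rewrite ler_pdivlMr ?om_gt0// mulrC; apply: le_trans ur; apply: le_trans (L2_le_sqn uH).
    rewrite ler_wpM2l ?om_ge0//; apply: le_trans (bessel E k.+1 (fH_L2 uH)).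
    by rewrite big_ord_recr/= lerDr sumr_ge0// => j _; exact: sqr_ge0.
  move: c2; rewrite -(real_normK (num_real (coef E u k))).
  move: (normr_ge0 (coef E u k)); move: `|_| (r / _) => c d c0 cd.
  have := sqr_ge0 (c - 2^-1); rewrite sqrrB => ?; nra.
have [a [Ka ca]] := cK _ _ FK.
exists a => A N e FA e0.
have FA' : (hcoef @ F) (hcoef @` (A `&` [set p | sqnn p <= r])).
  by rewrite /fmap/=; apply: filterS (filterI FA Fr) => p Ap; exists p.
pose V : set (prod_topology (fun _ : bool * nat => R)) :=
  [set f | forall i : bool * 'I_N, ball (a (i.1, i.2 : nat) : R) e (f (i.1, i.2 : nat))].
have nV : nbhs a V.
  apply: (@filter_forall _ (bool * 'I_N)%type (fun i =>
    [set f : prod_topology (fun _ : bool * nat => R) |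
      ball (a (i.1, i.2 : nat) : R) e (f (i.1, i.2 : nat))]) (nbhs a)) => i.
  have := @proj_continuous _ (fun _ : bool * nat => R) (i.1, i.2 : nat) a.
  by move=> /(_ (ball (a (i.1, i.2 : nat) : R) e)); apply; exact: nbhsx_ballx.
have [f [[p [Ap pr] <-] Vf]] := ca _ _ FA' nV.
exists p; split => // b k kN.
by have := Vf (b, Ordinal kN); rewrite /ball/= distrC.
Qed.

Lemma sqr_le_of_norm (x e : R) : `|x| < e -> x ^+ 2 <= e ^+ 2.
Proof.
move=> xe; rewrite -(real_normK (num_real x)) lerXn2r ?nnegrE ?(ltW xe)//.
exact: le_trans (ltW xe).
Qed.

Lemma fracHH_compact (F : set_system X) (FF : ProperFilter F) (r : R) :
  F [set p | sqnn p <= r] ->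
  exists p0 : X, forall A (e : R), F A -> 0 < e -> exists2 p, A p & dist2 p p0 <= e.
Proof.
move=> Fr; have [a aP] := fracHH_cluster FF Fr.
(* The cluster point is only a family of numbers. Its weighted partial sums are limits of those of
   pairs with [sqnn <= r], so they stay below [r] and Riesz-Fischer realises it by a function. *)
have aE (b : bool) : exists u, [/\ fH u, sqn u <= r & forall k, coef E u k = a (b, k)].
  have [P PP] : {P : nat -> X & forall j, sqnn (P j) <= r /\
      forall k, (k < j.+1)%N -> `|hcoef (P j) (b, k) - a (b, k)| < j.+1%:R^-1}.
    apply: (@choice _ _ (fun j p => sqnn p <= r /\
      forall k, (k < j.+1)%N -> `|hcoef p (b, k) - a (b, k)| < j.+1%:R^-1)) => j.
    have j0 : 0 < j.+1%:R^-1 :> R by rewrite invr_gt0 ltr0n.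
    have [p [_ pr ph]] := aP _ j.+1 _ filterT j0.
    by exists p; split => // k kj; exact: ph.
  pose U j := if b then fracHH_fst (P j) else fracHH_snd (P j).
  have UH j : fH (U j) by rewrite /U; case: (b); [exact: fracHH_fstP|exact: fracHH_sndP].
  have Ur j : sqn (U j) <= r.
    have [+ _] := PP j; apply: le_trans; rewrite /U /sqnn.
    by case: (b); [rewrite lerDl|rewrite lerDr]; exact: sqn_ge0.
  have ck k : coef E (U j) k @[j --> \oo] --> a (b, k).
    apply/cvgrPdist_le => e e0.
    have [J J0 JP] : \forall j \near \oo, (j.+1%:R^-1 : R) < e.
      exact: near_infty_natSinv_lt (PosNum e0).
    exists (maxn J k) => // j /=; rewrite geq_max => /andP[Jj kj].
    have [_ /(_ k kj)] := PP j; rewrite distrC => /ltW /le_trans; apply.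
    by apply: ltW; exact: JP.
  have cN N : \sum_(k < N) coef E (U j) k ^+ 2 * om k @[j --> \oo] -->
      \sum_(k < N) a (b, k : nat) ^+ 2 * om k.
    apply: cvgn_sum => k; apply: cvgM; last exact: cvg_cst.
    by rewrite expr2; under eq_fun do rewrite expr2; apply: cvgM; exact: ck.
  have aN N : \sum_(k < N) a (b, k : nat) ^+ 2 * om k <= r.
    apply: (cvgn_le (K := 0%N) (cN N)) => j _.
    exact: le_trans (esum_le N (UH j)) (Ur j).
  have [u uL uE] : exists2 u, L2 u & forall k, coef E u k = a (b, k).
    apply: (@riesz_fischer _ (r / om 0)) => N; rewrite ler_pdivlMr ?om_gt0//.
    apply: le_trans (aN N); rewrite mulr_suml; apply: ler_sum => k _.
    by rewrite ler_wpM2l ?sqr_ge0//; exact: om_mono.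
  have uN N : esum u N <= r by rewrite /esum; under eq_bigr do rewrite uE.
  by exists u; have [uH ur] := fH_bound uL uN.
have [u [uH ur uE]] := aE true; have [v [vH vr vE]] := aE false.
exists (fracHH_pair uH vH) => A e FA e0.
have r0 : 0 <= r by apply: le_trans ur; exact: sqn_ge0.
(* The parallelogram law bounds the [sqn] of a difference by [4 * r], and [4 * (r + 1) / C = e / 4]:
   the high modes cost [e / 4]. The added 1 keeps [C] positive. *)
pose C := 16 * (r + 1) / e.
have C0 : 0 < C by rewrite divr_gt0// mulr_gt0// ltr_wpDl.
have [N NC] := om_unbounded C0.
(* The [N] low modes cost at most [N * d ^+ 2 <= (N + 1) * d <= e / 4], where [d <= 1] is used. Two
   such quarters per component add up to [e]. *)
pose d := Num.min 1 (e / (4 * (N%:R + 1))).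
have Np : 0 < (N%:R + 1 : R) by rewrite ltr_wpDl.
have d0 : 0 < d by rewrite lt_min ltr01/= divr_gt0// mulr_gt0.
have [p [Ap pr ph]] := aP A N d FA d0.
exists p => //.
have dN : N%:R * d ^+ 2 <= e / 4.
  have d1 : d <= 1 by rewrite ge_min lexx.
  have d2 : d <= e / (4 * (N%:R + 1)) by rewrite ge_min lexx orbT.
  have : N%:R * d ^+ 2 <= (N%:R + 1) * d.
    apply: ler_pM => //; [exact: sqr_ge0|by rewrite lerDl|].
    by rewrite expr2 ler_piMl// ltW.
  move=> /le_trans; apply; rewrite -ler_pdivlMl// (le_trans d2)//.
  by rewrite le_eqVlt; apply/orP; left; apply/eqP; field; rewrite gt_eqF.
have half (b : bool) (w w' : T -> R) : fH w -> fH w' -> sqn w <= r -> sqn w' <= r ->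
    (forall k, (k < N)%N -> `|coef E w k - coef E w' k| < d) ->
    ip mu (fun x => w x - w' x) (fun x => w x - w' x) <= e / 2.
  move=> wH wH' wr wr' wk; have [aH sH sE] := fH_add_sub wH wH'.
  have [wL wL'] := (fH_L2 wH, fH_L2 wH').
  apply: le_trans (L2_tail sH C0 NC) _.
  have t1 : \sum_(k < N) coef E (fun x => w x - w' x) k ^+ 2 <= N%:R * d ^+ 2.
    rewrite -[N in N%:R]card_ord -sum1_card natr_sum mulr_suml; apply: ler_sum => k _.
    by rewrite mul1r coefS//; apply: sqr_le_of_norm; exact: wk.
  have t2 : C^-1 * sqn (fun x => w x - w' x) <= e / 4.
    rewrite -ler_pdivlMl ?invr_gt0// invrK.
    have -> : C * (e / 4) = 4 * (r + 1) by rewrite /C; field; rewrite gt_eqF.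
    have := sqn_ge0 (fun x => w x + w' x); move: sE wr wr'.
    move: (sqn _) (sqn _) (sqn w) (sqn w') => q1 q2 q3 q4; lra.
  apply: le_trans (lerD (le_trans t1 dN) t2) _.
  by rewrite (_ : e / 4 + e / 4 = e / 2)//; field.
have [p1 p2] : sqn (fracHH_fst p) <= r /\ sqn (fracHH_snd p) <= r.
  have := sqn_ge0 (fracHH_fst p); have := sqn_ge0 (fracHH_snd p); move: pr.
  by rewrite /sqnn; move: (sqn _) (sqn _) => q1 q2; lra.
rewrite /dist2 [leRHS]splitr; apply: lerD => /=.
  apply: (half true) => //; first exact: fracHH_fstP.
  by move=> k kN; rewrite uE; exact: (ph true k kN).
apply: (half false) => //; first exact: fracHH_sndP.
by move=> k kN; rewrite vE; exact: (ph false k kN).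
Qed.

End fractional.

(** * Finite minimax *)

Section minimax.
Context {R : realType} (X : eqType) (comb : R -> X -> X -> X).
Implicit Types (D : set X) (f : X -> R).

(** [comb t x y] stands for [t x + (1 - t) y]. It is an abstract operation because the type [fracHH]
    carries no vector space structure. *)
Definition conv_closed D := forall t x y, 0 <= t <= 1 -> D x -> D y -> D (comb t x y).

Definition conv_fun f :=
  forall t x y, 0 <= t <= 1 -> f (comb t x y) <= t * f x + (1 - t) * f y.

(* The two-function case of the minimax theorem: [t] separates the ratios [psi] and [phi],
   which are ordered because otherwise some convex combination of two points would violate
   the hypothesis. *)
Lemma convex_pair_alternative D f1 f2 (e : R) : conv_closed D -> conv_fun f1 -> conv_fun f2 ->
  (forall x, D x -> e <= f1 x \/ e <= f2 x) ->
  exists2 t, 0 <= t <= 1 & forall x, D x -> e <= t * f1 x + (1 - t) * f2 x.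
Proof.
move=> cD c1 c2 H.
have [[x1 [Dx1 x1n]]|n1] := pselect (exists x, D x /\ f1 x < e); last first.
  exists 1; first by rewrite ler01 lexx.
  move=> x Dx; rewrite mul1r subrr mul0r addr0 leNgt; apply/negP => h.
  by apply: n1; exists x.
have [[x2 [Dx2 x2n]]|n2] := pselect (exists x, D x /\ f2 x < e); last first.
  exists 0; first by rewrite ler01 lexx.
  move=> x Dx; rewrite mul0r subr0 mul1r add0r leNgt; apply/negP => h.
  by apply: n2; exists x.
have key x y : D x -> D y -> f1 x < e -> f2 y < e ->
    (e - f2 y) * (e - f1 x) <= (f1 y - e) * (f2 x - e).
  move=> Dx Dy xn yn; rewrite leNgt; apply/negP => lt.
  have bx : 0 <= f2 x - e by case: (H x Dx) => ?; lra.
  have cy : 0 <= f1 y - e by case: (H y Dy) => ?; lra.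
  pose a := e - f1 x; pose b := f2 x - e; pose c := f1 y - e; pose d := e - f2 y.
  have [a0 d0] : 0 < a /\ 0 < d by rewrite /a /d; split; lra.
  have [b0 c0] : 0 <= b /\ 0 <= c by [].
  have lt' : 0 < d * a - c * b by rewrite subr_gt0.
  pose S := a + b + c + d; have S0 : 0 < S by rewrite /S; lra.
  (* The weight at which the two convex combinations coincide; their common value
     [e - (d * a - c * b) / S] is below [e], against [H] at the combined point. *)
  pose t := (c + d) / S.
  have t01 : 0 <= t <= 1.
    apply/andP; split; first by apply: divr_ge0; [rewrite addr_ge0 // ltW|exact: ltW].
    by rewrite /t ler_pdivrMr// /S; lra.
  have tS : t * S = c + d by rewrite /t divfK// gt_eqF.
  have p1 := c1 t x y t01; have p2 := c2 t x y t01.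
  have q1 : t * f1 x + (1 - t) * f1 y = e - (d * a - c * b) / S.
    apply: (mulIf (lt0r_neq0 S0)); rewrite [RHS]mulrBl divfK ?gt_eqF//.
    have -> : (t * f1 x + (1 - t) * f1 y) * S = t * S * (f1 x - f1 y) + f1 y * S by ring.
    by rewrite tS /S /a /b /c /d; ring.
  have q2 : t * f2 x + (1 - t) * f2 y = e - (d * a - c * b) / S.
    apply: (mulIf (lt0r_neq0 S0)); rewrite [RHS]mulrBl divfK ?gt_eqF//.
    have -> : (t * f2 x + (1 - t) * f2 y) * S = t * S * (f2 x - f2 y) + f2 y * S by ring.
    by rewrite tS /S /a /b /c /d; ring.
  have r0 : 0 < (d * a - c * b) / S by rewrite divr_gt0.
  rewrite q1 in p1; rewrite q2 in p2; move: ((d * a - c * b) / S) p1 p2 r0 => r p1 p2 r0.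
  by case: (H _ (cD _ _ _ t01 Dx Dy)) => ?; lra.
(* Where [f1 x < e], the conclusion at [x] says that [t <= phi x]; where [f2 y < e], that
   [psi y <= t]. *)
pose phi x := (f2 x - e) / ((e - f1 x) + (f2 x - e)).
pose psi y := (e - f2 y) / ((f1 y - e) + (e - f2 y)).
pose P := [set psi y | y in [set y | D y /\ f2 y < e]].
have psiphi x y : D x -> D y -> f1 x < e -> f2 y < e -> psi y <= phi x.
  move=> Dx Dy xn yn; have := key _ _ Dx Dy xn yn.
  have bx : 0 <= f2 x - e by case: (H x Dx) => ?; lra.
  have cy : 0 <= f1 y - e by case: (H y Dy) => ?; lra.
  rewrite /psi /phi => k.
  rewrite ler_pdivrMr; last lra.
  rewrite mulrAC ler_pdivlMr; last lra.
  move: k; rewrite -subr_ge0 => k; rewrite -subr_ge0; apply: le_trans k _.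
  by rewrite le_eqVlt; apply/orP; left; apply/eqP; ring.
have ubP x : D x -> f1 x < e -> ubound P (phi x).
  by move=> Dx xn _ [y [Dy yn] <-]; exact: psiphi.
have P0 : P !=set0 by exists (psi x2), x2.
have Psup y : D y -> f2 y < e -> psi y <= sup P.
  by move=> Dy yn; apply: ub_le_sup; [exists (phi x1); exact: ubP|exists y].
have supP x : D x -> f1 x < e -> sup P <= phi x.
  by move=> Dx xn; apply: ge_sup => //; exact: ubP.
have t0 : 0 <= sup P.
  apply: le_trans (Psup _ Dx2 x2n).
  have : 0 <= f1 x2 - e by case: (H x2 Dx2) => ?; lra.
  by move=> ?; rewrite /psi divr_ge0//; lra.
have t1 : sup P <= 1.
  apply: le_trans (supP _ Dx1 x1n) _.
  have : 0 <= f2 x1 - e by case: (H x1 Dx1) => ?; lra.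
  by move=> ?; rewrite /phi ler_pdivrMr; lra.
exists (sup P); first by rewrite t0.
move=> x Dx; have [x1e|x1e] := ltP (f1 x) e.
  have := supP _ Dx x1e; rewrite /phi.
  have bx : 0 <= f2 x - e by case: (H x Dx) => ?; lra.
  rewrite ler_pdivlMr; last lra.
  by move: (sup P) => t ?; nra.
have [x2e|x2e] := ltP (f2 x) e.
  have := Psup _ Dx x2e; rewrite /psi ler_pdivrMr; last lra.
  by move: (sup P) => t ?; nra.
by move: (sup P) t0 t1 => t ? ?; nra.
Qed.

Variable phi : X -> X -> R.
Hypothesis phi_convex : forall z, conv_fun (phi ^~ z).
Hypothesis phi_concave : forall p t z z', 0 <= t <= 1 ->
  t * phi p z + (1 - t) * phi p z' <= phi p (comb t z z').

(** Induction on [s], whence the arbitrary [D]: the points where the head [z] fails form a convex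
    set, on which the induction hypothesis gives a single [zb]. The two-function case then merges
    [z] and [zb], and concavity absorbs the combination. *)
Lemma finite_minimax (z0 : X) (s : seq X) D (e : R) : conv_closed D ->
  (forall p, D p -> exists2 z, z \in s & e <= phi p z) ->
  exists z, forall p, D p -> e <= phi p z.
Proof.
elim: s D => [|z s IH] D cD H; first by exists z0 => p /H[].
have [|p [Dp pz]|zb zbP] := IH (D `&` [set p | phi p z < e]).
- move=> t x y t01 [Dx xz] [Dy yz]; split; first exact: cD.
  rewrite /=; apply: le_lt_trans (phi_convex z _ _ t01) _.
  move: xz yz t01; rewrite /=; move: (phi x z) (phi y z) => a b ae be /andP[t0 t1].
  by have [->|tn] := eqVneq t 0; [lra|have : 0 < t by rewrite lt_neqAle eq_sym tn]; nra.
- have [z' + ez'] := H p Dp; rewrite inE => /predU1P[z'z|z's]; last by exists z'.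
  by move: ez'; rewrite z'z leNgt pz.
have [|t t01 tP] := @convex_pair_alternative D (phi ^~ z) (phi ^~ zb) e cD
    (@phi_convex z) (@phi_convex zb).
  move=> p Dp; have [|pz] := leP e (phi p z); first by left.
  by right; apply: zbP.
by exists (comb t z zb) => p Dp; apply: le_trans (tP p Dp) (phi_concave _ _ _ t01).
Qed.

(** Otherwise the minimax theorem yields one [z] with [phi p z >= e] for all [p], which fails at
    [p = z]. *)
Lemma finite_saddle (z0 : X) (s : seq X) (e : R) : (forall p, phi p p = 0) -> 0 < e ->
  exists p, forall z, z \in s -> phi p z < e.
Proof.
move=> phi0 e0; apply: contrapT => nP.
have [] := @finite_minimax z0 s setT e; first by [].
  move=> p _; apply: contrapT => np; apply: nP; exists p => z zs.
  by rewrite ltNge; apply/negP => pz; apply: np; exists z.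
by move=> z /(_ z I); rewrite phi0; lra.
Qed.

End minimax.

(** * Integrals and countable families of null sets *)

Section null_sets.
Context d (T : measurableType d) (R : realType) (mu : {measure set T -> \bar R}).
Import HBNNSimple.

(** Stated for arbitrary nonnegative functions, since the integrand of [functional] is measurable
    only up to null sets. The integral is a supremum over simple functions, and cutting one off on
    [N] keeps its integral. *)
Lemma ge0_integral_null (N : set T) (f g : T -> \bar R) : measurable N -> mu N = 0%E ->
  (forall x, 0 <= f x)%E -> (forall x, 0 <= g x)%E ->
  (forall x, ~ N x -> f x = g x) -> (\int[mu]_x f x = \int[mu]_x g x)%E.
Proof.
move=> mN N0; suff le (a b : T -> \bar R) : (forall x, 0 <= a x)%E ->
    (forall x, 0 <= b x)%E -> (forall x, ~ N x -> a x = b x) ->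
    (\int[mu]_x a x <= \int[mu]_x b x)%E.
  move=> f0 g0 fg; apply/eqP; rewrite eq_le !le// => x /fg //.
move=> a0 b0 ab; rewrite !ge0_integralTE//; apply: ge_ereal_sup => _ [h /= ha <-].
pose h' := proj_nnsfun h (measurableC mN).
have h'E x : h' x = h x * \1_(~` N) x by rewrite /h' /= mindicE indicE.
have -> : sintegral mu h = sintegral mu h'.
  rewrite -!integralT_nnsfun; apply: ae_eq_integral => //.
  - exact/measurable_EFinP.
  - exact/measurable_EFinP.
  exists N; split => // x /= nx; apply: contrapT => Nx; apply: nx => _.
  by rewrite [RHS](_ : _ = (h' x)%:E)// h'E indicE mem_set// mulr1.
apply: ereal_sup_ubound; exists h' => // x; rewrite h'E indicE.
have [Nx|Nx] := pselect (N x).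
  by rewrite memNset ?mulr0//; apply.
by rewrite mem_set// mulr1 -ab.
Qed.

Lemma Rintegral_null (N : set T) (f g : T -> R) : measurable N -> mu N = 0%E ->
  (forall x, ~ N x -> f x = g x) -> \int[mu]_x f x = \int[mu]_x g x.
Proof.
move=> mN N0 fg; rewrite /Rintegral integralE [in RHS]integralE.
congr (fine (_ - _)); apply: (ge0_integral_null mN N0) => //.
- by move=> x /fg; rewrite funepos.unlock /= => ->.
- by move=> x /fg; rewrite funeneg.unlock /= => ->.
Qed.

Lemma ae_null (P : T -> Prop) : {ae mu, forall x, P x} ->
  exists N, [/\ measurable N, mu N = 0%E & forall x, ~ N x -> P x].
Proof.
move=> [N [mN N0 sub]]; exists N; split => // x Nx.
by apply: contrapT => Px; apply: Nx; exact: sub.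
Qed.

Lemma null_ae (N : set T) (P : T -> Prop) : measurable N -> mu N = 0%E ->
  (forall x, ~ N x -> P x) -> {ae mu, forall x, P x}.
Proof.
move=> mN N0 NP; exists N; split => // x /= Px.
by apply: contrapT => Nx; apply: Px; exact: NP.
Qed.

Lemma ae_countable (I : countType) (P : I -> T -> Prop) :
  (forall i, {ae mu, forall x, P i x}) -> {ae mu, forall x, forall i, P i x}.
Proof.
move=> H.
have [N NP] : {N : I -> set T & forall i, [/\ measurable (N i), mu (N i) = 0%E &
    forall x, ~ N i x -> P i x]}.
  by apply: (@choice _ _ (fun i N => [/\ measurable N, mu N = 0%E &
    forall x, ~ N x -> P i x])) => i; exact: ae_null.
pose M k := if unpickle k is Some i then N i else set0.
have MP k : measurable (M k) /\ mu (M k) = 0%E.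
  by rewrite /M; case: unpickle => [i|]; [have [] := NP i|rewrite measure0].
have : mu.-negligible (\bigcup_k M k).
  apply: negligible_bigcup => k; have [mM M0] := MP k.
  by exists (M k); split.
move=> [N' [mN' N'0 sub]]; apply: (null_ae mN' N'0) => x N'x i.
have [_ _] := NP i; apply => Nix; apply: N'x; apply: sub.
by exists (pickle i) => //; rewrite /M pickleK.
Qed.

End null_sets.

(** * Lower semicontinuity under weak-* convergence *)

Section caratheodory_composition.
Context d (T : measurableType d) (R : realType).

Definition everywhere_caratheodory (h : T -> R -> R -> R) :=
  (forall x, continuous (fun p : R * R => h x p.1 p.2)) /\
  forall u v : T -> R, measurable_fun setT u -> measurable_fun setT v ->
    measurable_fun setT (fun x => h x (u x) (v x)).

(* A Caratheodory function composed with measurable functions is a limit of functions that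
   are measurable because they only involve rational values of the arguments. *)
Definition grid (j : nat) (a : R) : R := (Num.floor (j.+1%:R * a))%:~R / j.+1%:R.

Lemma grid_cvg (a : R) : grid j a @[j --> \oo] --> a.
Proof.
apply/cvgrPdist_le => e e0.
have [J _ JP] : \forall j \near \oo, (j.+1%:R^-1 : R) < e.
  exact: near_infty_natSinv_lt (PosNum e0).
exists J => // j /= /JP /ltW; apply: le_trans.
have j0 : 0 < (j.+1%:R : R) by rewrite ltr0n.
have := floor_itv (j.+1%:R * a); rewrite intrD rmorph1 => /andP[f1 f2].
have -> : a - grid j a = (j.+1%:R * a - (Num.floor (j.+1%:R * a))%:~R) / j.+1%:R.
  by rewrite /grid mulrBl mulrAC divff ?mul1r// gt_eqF.
rewrite normrM [`|_^-1|]ger0_norm ?invr_ge0 ?(ltW j0)//.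
rewrite -[leRHS]mul1r ler_pM2r ?invr_gt0// ger0_norm ?subr_ge0//.
by rewrite lerBlDl ltW.
Qed.

Lemma caratheodory_comp (h : T -> R -> R -> R) :
  (forall x, continuous (fun p : R * R => h x p.1 p.2)) ->
  (forall q1 q2 : rat, measurable_fun setT (fun x => h x (ratr q1) (ratr q2))) ->
  everywhere_caratheodory h.
Proof.
move=> ch mh; split => // u v mu mv.
pose F j x := h x (grid j (u x)) (grid j (v x)).
apply: (@measurable_fun_cvg _ _ _ setT F) => [j|x _]; last first.
  have c1 : (fun j => (grid j (u x), grid j (v x))) @ \oo --> (u x, v x).
    by apply: (@cvg_pair _ _ _ _ (nbhs (u x)) (nbhs (v x))); exact: grid_cvg.
  exact: (cvg_comp _ _ c1 (ch x (u x, v x))).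
move=> _ B mB; rewrite setTI.
(* On a cell of the grid both rounded arguments are fixed rationals; there are countably many
   cells. *)
have -> : F j @^-1` B = \bigcup_(p : int * int)
    (((fun x => j.+1%:R * u x) @^-1` `[p.1%:~R, (p.1 + 1)%:~R[) `&`
     ((fun x => j.+1%:R * v x) @^-1` `[p.2%:~R, (p.2 + 1)%:~R[) `&`
     ((fun x => h x (ratr (p.1%:~R / j.+1%:R)) (ratr (p.2%:~R / j.+1%:R))) @^-1` B)).
  have E (k : int) : ratr (k%:~R / j.+1%:R) = k%:~R / j.+1%:R :> R.
    by rewrite fmorph_div rmorph_int rmorph_nat.
  apply/seteqP; split => [x Bx|x [[k l] _ [[/= xk xl]]]].
    exists (Num.floor (j.+1%:R * u x), Num.floor (j.+1%:R * v x)) => //.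
    by split; [split; rewrite /= in_itv/=; exact: floor_itv|rewrite /= !E].
  rewrite /= !E => Bx; move: xk xl; rewrite !in_itv/= -!floor_eq => /eqP xk /eqP xl.
  by rewrite /F /grid xk xl.
have mitv (f : T -> R) (k : int) : measurable_fun setT f ->
    measurable ((fun x => j.+1%:R * f x) @^-1` `[k%:~R, (k + 1)%:~R[).
  move=> mf; rewrite -[X in measurable X]setTI.
  by apply: (measurable_funM (measurable_cst _) mf) => //; exact: measurable_itv.
apply: countable_bigcupT_measurable => [|p]; first exact: countableP.
apply: measurableI; first by apply: measurableI; exact: mitv.
by rewrite -[X in measurable X]setTI; apply: mh.
Qed.

End caratheodory_composition.

(** * Removing the exceptional null sets of a Caratheodory function *)

Section normalisation.
Context {R : realType} {n : nat} (Om : lipschitz_domain R n).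
Local Notation T := 'rV[R]_n.
Local Notation mu := (lebesgue_on Om).

Definition zero_on (N : set T) (g : T -> R -> R -> R) : T -> R -> R -> R :=
  fun x a b => if x \in N then 0 else g x a b.

Lemma compl_domain_null : measurable (~` domain_set Om) /\ mu (~` domain_set Om) = 0%E.
Proof.
have mO := open_measurable_rV (@domain_open _ _ Om).
split; first exact: measurableC.
by rewrite /lebesgue_on /= /mrestr setICl measure0.
Qed.

Lemma ae_domain : {ae mu, forall x, domain_set Om x}.
Proof.
have [mC C0] := compl_domain_null; apply: (null_ae mC C0) => x.
by move=> /contrapT.
Qed.

Lemma ae_domainE (P : T -> Prop) :
  {ae mu, forall x, domain_set Om x -> P x} -> {ae mu, forall x, P x}.
Proof. by move=> H; apply: filterS2 ae_domain H => x xO; apply. Qed.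

(** Countably many null sets are discarded: one for each pair of rational arguments, and the one
    where continuity fails. Allowing any larger [N'] lets several integrands share one null set. *)
Lemma caratheodory_nice g : caratheodory Om g ->
  exists N, [/\ measurable N, mu N = 0%E &
    forall N', measurable N' -> N `<=` N' -> everywhere_caratheodory (zero_on N' g)].
Proof.
move=> [mg cg].
pose PP (q : rat * rat) (f : T -> R) := measurable_fun setT f /\
  {ae mu, forall x, g x (ratr q.1) (ratr q.2) = f x}.
have [f fP] : {f : rat * rat -> T -> R & forall q, PP q (f q)}.
  apply: (@choice _ _ PP) => q; have [f mf ff] := mg (ratr q.1) (ratr q.2).
  by exists f; split => //; exact: ae_domainE.
have /ae_null[N [mN N0 NP]] : {ae mu, forall x,
    (forall q : rat * rat, g x (ratr q.1) (ratr q.2) = f q x) /\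
    continuous (fun p : R * R => g x p.1 p.2)}.
  have := ae_countable (fun q => (fP q).2).
  by apply: filterS2 (ae_domainE cg) => x cx qx; split.
exists N; split => // N' mN' NN'; apply: caratheodory_comp.
  move=> x; have [xN'|/negP xN'] := boolP (x \in N').
    by rewrite /zero_on xN' => p; exact: cvg_cst.
  rewrite /zero_on; have -> : (x \in N') = false by apply/negP.
  have [|_ //] := NP x; move=> /NN' Nx; apply: xN'; exact/mem_set.
move=> q1 q2; have [mf _] := fP (q1, q2).
have -> : (fun x => zero_on N' g x (ratr q1) (ratr q2)) =
    (fun x => f (q1, q2) x * \1_(~` N') x).
  apply/funext => x; rewrite /zero_on indicE in_setC; case: ifPn => xN' /=.
    by rewrite mulr0.
  have [|+ _] := NP x; first by move=> /NN' xN; move/negP: xN'; apply; exact/mem_set.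
  by move=> /(_ (q1, q2)) /= ->; rewrite mulr1.
by apply: measurable_funM => //; apply: measurable_indic; exact: measurableC.
Qed.

End normalisation.

Section lower_semicontinuity.
Context d (T : measurableType d) (R : realType) (mu : {measure set T -> \bar R}).
Hypothesis mu_fin : (mu setT < +oo)%E.
Context (m : nat).
Local Notation V := 'rV[R]_m.
Local Notation integ f := (mu.-integrable setT (EFin \o f)).
Local Notation L2 f := (f \in Lfun mu 2%:E).

Lemma dotvC (x y : V) : dotv x y = dotv y x.
Proof. by apply: eq_bigr => i _; rewrite mulrC. Qed.

Lemma dotvBl (x y z : V) : dotv (x - y) z = dotv x z - dotv y z.
Proof.
by rewrite /dotv -sumrB; apply: eq_bigr => i _; rewrite !mxE mulrBl.
Qed.

Lemma dotvZl a (x y : V) : dotv (a *: x) y = a * dotv x y.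
Proof. by rewrite /dotv mulr_sumr; apply: eq_bigr => i _; rewrite !mxE mulrA. Qed.

Lemma dotv_le (x y : V) C : (forall i, `|y 0 i| <= C) ->
  `|dotv x y| <= (\sum_(i < m) `|x 0 i|) * C.
Proof.
move=> yC; apply: le_trans (ler_norm_sum _ _ _) _; rewrite mulr_suml.
by apply: ler_sum => i _; rewrite normrM ler_wpM2l.
Qed.

Lemma dotv_measurable (f g : T -> V) :
  (forall i, measurable_fun setT (fun x => f x 0 i)) ->
  (forall i, measurable_fun setT (fun x => g x 0 i)) ->
  measurable_fun setT (fun x => dotv (f x) (g x)).
Proof. by move=> mf mg; apply: measurable_sum => i; exact: measurable_funM. Qed.

Lemma integrable_cst (c : R) : integ (fun=> c).
Proof.
apply/integrableP; split; first exact: measurable_cst.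
have -> : (\int[mu]_x `|(EFin \o (fun=> c)) x| = \int[mu]_x (cst `|c|%:E x))%E by [].
by rewrite integral_cst// lte_mul_pinfty.
Qed.

Variables (M : set V) (CM : R).
Hypothesis MC : forall y, M y -> forall i, `|y 0 i| <= CM.

Definition adm (w : T -> V) := (forall i, measurable_fun setT (fun x => w x 0 i)) /\
  {ae mu, forall x, M (w x)}.

Variables (w : nat -> T -> V) (w0 : T -> V).
Hypotheses (wA : forall j, adm (w j)) (w0A : adm w0).
Hypothesis w_cvg : forall f : T -> V, (forall i, integ (fun x => f x 0 i)) ->
  \int[mu]_x dotv (w j x) (f x) @[j --> \oo] --> \int[mu]_x dotv (w0 x) (f x).

Lemma cut_cvg (E : nat -> set T) (L : T -> R) : (forall N, measurable (E N)) ->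
  (forall x, exists N0, forall N, (N0 <= N)%N -> E N x) -> integ L ->
  \int[mu]_x (\1_(~` E N) x * L x) @[N --> \oo] --> 0.
Proof.
move=> mE E0 Li.
have mF N : measurable_fun setT (fun x => \1_(~` E N) x * L x).
  apply: measurable_funM; last exact: integrable_meas Li.
  by apply: measurable_indic; exact: measurableC.
have Ff : {ae mu, forall x, (fun N => \1_(~` E N) x * L x) @ \oo --> (0 : R)}.
  apply: aeW => x; have [N0 N0P] := E0 x.
  apply: cvg_near_cst; exists N0 => // N /= /N0P EN.
  by rewrite indicE memNset ?mul0r//; apply.
have Fg : {ae mu, forall x, forall N, `|\1_(~` E N) x * L x| <= `|L x|}.
  apply: aeW => x N; rewrite normrM ler_piMl// indicE.
  by case: (_ \in _); rewrite ?normr1 ?normr0.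
have m0 : measurable_fun setT (fun _ : T => 0 : R) by exact: measurable_cst.
have [_] := Rintegral_dominated mF m0 (integrable_normr Li) Ff Fg.
by rewrite [X in _ --> X](_ : _ = 0)// /Rintegral integral0.
Qed.

(* [h2] need not be integrable, so it is truncated before testing [w] against it. *)
Lemma weak_star_affine (h1 : T -> R) (h2 : T -> V) (L : T -> R) :
  measurable_fun setT h1 -> (forall i, measurable_fun setT (fun x => h2 x 0 i)) ->
  integ L -> {ae mu, forall x, forall y, M y -> `|h1 x + dotv (h2 x) y| <= L x} ->
  (forall w, adm w -> integ (fun x => h1 x + dotv (h2 x) (w x))) /\
  \int[mu]_x (h1 x + dotv (h2 x) (w j x)) @[j --> \oo] -->
    \int[mu]_x (h1 x + dotv (h2 x) (w0 x)).
Proof.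
move=> mh1 mh2 Li hL.
have int w' : adm w' -> integ (fun x => h1 x + dotv (h2 x) (w' x)).
  move=> [mw Mw]; apply: (integrable_dom _ Li).
    by apply: measurable_funD => //; exact: dotv_measurable.
  by apply: filterS2 hL Mw => x; apply.
split => //.
pose S x := \sum_(i < m) `|h2 x 0 i|.
have mS : measurable_fun setT S.
  by apply: measurable_sum => i; apply: measurableT_comp.
pose E (N : nat) := S @^-1` `]-oo, N%:R].
have mE N : measurable (E N).
  by rewrite -[X in measurable X]setTI; apply: mS => //; exact: measurable_itv.
have E0 x : exists N0, forall N, (N0 <= N)%N -> E N x.
  exists (Num.truncn (S x)).+1 => N NN; rewrite /E/= in_itv/=.
  by apply: le_trans (ltW (truncnS_gt _)) _; rewrite ler_nat.
(* The factor 2 pays for the integrands of [w0] and of [w j] outside [E N], with a bound that does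
   not depend on [j]. *)
have c0 := cut_cvg mE E0 (integrable_scale 2 Li).
apply/cvgrPdist_le => e e0; have e20 : 0 < e / 2 by rewrite divr_gt0.
have /cvgrPdist_le/(_ _ e20)[N _ /(_ N (leqnn N))] := c0.
rewrite sub0r normrN => /(le_trans (ler_norm _)) NE.
pose f x : V := \1_(E N) x *: h2 x.
have fi i : integ (fun x => f x 0 i).
  apply: (integrable_dom _ (integrable_cst N%:R)).
    rewrite (_ : (fun x => f x 0 i) = fun x => \1_(E N) x * h2 x 0 i).
      by apply: measurable_funM => //; exact: measurable_indic.
    by apply/funext => x; rewrite !mxE.
  apply: aeW => x; rewrite !mxE indicE.
  have [xE|xE] := boolP (x \in E N); last by rewrite mul0r normr0.
  rewrite mul1r; move: xE; rewrite inE /E/= in_itv/=; apply: le_trans.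
  by rewrite /S (bigD1 i)//= lerDl sumr_ge0.
have := w_cvg fi => /cvgrPdist_le/(_ _ e20); apply: filterS => j jh.
have fN x i : `|f x 0 i| <= `|h2 x 0 i|.
  rewrite !mxE normrM ler_piMl// indicE; case: (_ \in _); by rewrite ?normr1 ?normr0.
have dfi w' : adm w' -> integ (fun x => dotv (w' x) (f x)).
  move=> [mw Mw].
  have ib : integ (fun x => (\sum_(i < m) `|f x 0 i|) * CM).
    under eq_fun do rewrite mulrC.
    by apply: integrable_scale; apply: integrable_sumr => i; exact: integrable_normr.
  apply: (integrable_dom _ ib).
    by apply: dotv_measurable => // i; exact: integrable_meas.
  by apply: filterS Mw => x Mx; rewrite dotvC; exact: dotv_le (MC Mx).
have intB := integrable_sub (int _ w0A) (int _ (wA j)).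
have dB := integrable_sub (dfi _ w0A) (dfi _ (wA j)).
have i1 : integ (fun x => \1_(~` E N) x * (2 * L x)).
  apply: (integrable_dom _ (integrable_normr (integrable_scale 2 Li))).
    apply: measurable_funM; last by apply: (@integrable_meas _ _ _ mu); exact: integrable_scale.
    by apply: measurable_indic; exact: measurableC.
  apply: aeW => x; rewrite normrM ler_piMl// indicE.
  by case: (_ \in _); rewrite ?normr1 ?normr0.
rewrite -RintegralB//; last 2 first.
  exact: int. exact: int.
have pt : {ae mu, forall x,
    `|(h1 x + dotv (h2 x) (w0 x) - (h1 x + dotv (h2 x) (w j x))) -
      (dotv (w0 x) (f x) - dotv (w j x) (f x))| <= \1_(~` E N) x * (2 * L x)}.
  have [[_ M0] [_ Mj]] := (w0A, wA j).
  apply: filterS3 hL M0 Mj => x hx M0 Mj.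
  rewrite -!(dotvC (f x)) /f !dotvZl !indicE in_setC.
  case: (x \in E N) => /=.
    by rewrite !mul1r mul0r normr_le0; apply/eqP; ring.
  rewrite !mul0r subr0 subr0 mul1r.
  apply: le_trans (ler_normB _ _) _; rewrite mulr_natl mulr2n.
  by apply: lerD; exact: hx.
have s1 : `|\int[mu]_x (h1 x + dotv (h2 x) (w0 x) - (h1 x + dotv (h2 x) (w j x))) -
    \int[mu]_x (dotv (w0 x) (f x) - dotv (w j x) (f x))| <= e / 2.
  rewrite -RintegralB//; apply: le_trans NE.
  apply: le_trans (le_normr_Rintegral _ _) _ => //.
    exact: (integrable_sub intB dB).
  apply: le_Rintegral_ae => //.
  by apply: integrable_normr; exact: (integrable_sub intB dB).
rewrite [\int[mu]_x (dotv (w0 x) (f x) - _)](RintegralB measurableT (dfi _ w0A) (dfi _ (wA j))) in s1.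
rewrite [leRHS]splitr; apply: le_trans (lerD s1 jh).
by apply: le_trans _ (ler_normD _ _); rewrite subrK.
Qed.

Variables (g1 : T -> R -> R) (g2 : T -> R -> V).
Hypotheses (mg1 : forall f, measurable_fun setT f -> measurable_fun setT (fun x => g1 x (f x)))
  (mg2 : forall i f, measurable_fun setT f -> measurable_fun setT (fun x => g2 x (f x) 0 i))
  (cg1 : forall x, continuous (g1 x))
  (cg2 : forall x i, continuous (fun s => g2 x s 0 i)).
Variables (b : R) (beta gamma Lam : T -> R) (v : T -> R) (vj : nat -> T -> R).
Hypotheses (betaL : L2 beta) (gammaL : integ gamma) (LamL : integ Lam)
  (vL : L2 v) (vjL : forall j, L2 (vj j)).
Hypothesis lower : {ae mu, forall x, forall s y, M y ->
  - b * s ^+ 2 - beta x * s - gamma x <= g1 x s + dotv (g2 x s) y}.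
Hypothesis upper : {ae mu, forall x, forall y, M y ->
  g1 x (v x) + dotv (g2 x (v x)) y <= Lam x}.
Hypothesis upperj : forall j, integ (fun x => g1 x (vj j x) + dotv (g2 x (vj j x)) (w j x)).
Hypothesis vj_ae : {ae mu, forall x, vj ^~ x @ \oo --> v x}.
Hypothesis vj_L2 : ip mu (fun x => vj j x - v x) (fun x => vj j x - v x) @[j --> \oo] --> 0.

(* Fatou's lemma for integrands depending on [j]: with [r] the quadratic minorant and
   [ep j] the pointwise error, [g(vj) + r(vj) >= g(v) + r(v) - min (ep j) L] almost everywhere,
   where [g(v) + r(v) <= L] covers the case [L < ep j] by positivity of the left-hand side. *)
Lemma lsc_integrand :
  integ (fun x => g1 x (v x) + dotv (g2 x (v x)) (w0 x)) /\
  forall e, 0 < e -> \forall j \near \oo,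
    \int[mu]_x (g1 x (v x) + dotv (g2 x (v x)) (w0 x)) - e <=
    \int[mu]_x (g1 x (vj j x) + dotv (g2 x (vj j x)) (w j x)).
Proof.
pose r (u : T -> R) x := b * (u x * u x) + beta x * u x + gamma x.
have ri u : L2 u -> integ (r u).
  move=> uL; apply: integrable_add => //; apply: integrable_add; last exact: L2_mul.
  by apply: integrable_scale; exact: L2_mul.
have rE u : L2 u -> \int[mu]_x r u x = b * ip mu u u + ip mu beta u + \int[mu]_x gamma x.
  move=> uL; rewrite /r RintegralD//; last first.
    by apply: integrable_add; [apply: integrable_scale; exact: L2_mul|exact: L2_mul].
  rewrite RintegralD//; [|by apply: integrable_scale; exact: L2_mul|exact: L2_mul].
  by rewrite RintegralZl//; exact: L2_mul.
pose L x := Lam x + r v x.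
have Li : integ L by apply: integrable_add => //; exact: ri.
have lowr : {ae mu, forall x, forall u y, M y -> 0 <= g1 x (u x) + dotv (g2 x (u x)) y + r u x}.
  apply: filterS lower => x h u y /(h (u x)); rewrite /r expr2.
  by move: (g1 _ _ + _) => q; lra.
have mv := L2_meas vL.
have bnd : {ae mu, forall x, forall y, M y ->
    `|g1 x (v x) + dotv (g2 x (v x)) y| <= `|L x| + `|r v x|}.
  apply: filterS2 lowr upper => x lx ux y My.
  have := lx v y My; have := ux y My; rewrite /L ler_norml.
  have := ler_norm (Lam x + r v x); have := ler_norm (r v x); have := ler_norm (- r v x).
  rewrite normrN; move: (normr_ge0 (Lam x + r v x)) (normr_ge0 (r v x)).
  move: (g1 _ _ + _) (`|_|) (`|_|) => q p1 p2 *; apply/andP; split; lra.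
have [vint vcvg] := weak_star_affine (mg1 mv) (fun i => mg2 i mv)
  (integrable_add (integrable_normr Li) (integrable_normr (ri _ vL))) bnd.
split; first exact: vint.
pose ge (u : T -> R) (w' : T -> V) x := g1 x (u x) + dotv (g2 x (u x)) (w' x).
have mge u w' : measurable_fun setT u -> adm w' -> measurable_fun setT (ge u w').
  move=> mu' [mw _]; apply: measurable_funD; first exact: mg1.
  by apply: dotv_measurable => // i; exact: mg2.
pose ep j x := `|ge (vj j) (w j) x - ge v (w j) x| + `|r (vj j) x - r v x|.
pose mm j x := Num.min (ep j x) (L x).
have mvj j := L2_meas (vjL j).
have mmm j : measurable_fun setT (mm j).
  apply: measurable_minr; last exact: (integrable_meas Li).
  apply: measurable_funD; apply: measurableT_comp => //; apply: measurable_funB.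
  - exact: mge.
  - exact: mge.
  - exact: (integrable_meas (ri _ (vjL j))).
  - exact: (integrable_meas (ri _ vL)).
have wall : {ae mu, forall x, forall j, M (w j x)} by apply: ae_countable => j; have [] := wA j.
have L0 : {ae mu, forall x, 0 <= L x}.
  have [_ Mw0] := w0A; apply: filterS3 lowr upper Mw0 => x lx ux Mw0.
  apply: le_trans (lx v _ Mw0) _; rewrite /L lerD2r; exact: ux.
(* Since [w j x] stays in the bounded set [M], the error from [g2] is controlled by [CM] and
   continuity alone, although [w j x] itself need not converge. *)
have mm0 : {ae mu, forall x, mm ^~ x @ \oo --> (0 : R)}.
  apply: filterS3 vj_ae wall L0 => x vx wx Lx.
  pose S j := `|g1 x (vj j x) - g1 x (v x)| +
    (\sum_(i < m) `|g2 x (vj j x) 0 i - g2 x (v x) 0 i|) * CM + `|r (vj j) x - r v x|.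
  have S0 : S @ \oo --> (0 : R).
    have c0 (h : R -> R) : continuous h -> `|h (vj j x) - h (v x)| @[j --> \oo] --> (0 : R).
      move=> ch; rewrite -[X in _ --> X](normr0 R) -(subrr (h (v x))).
      apply: cvg_norm; apply: cvgB; last exact: cvg_cst.
      exact: (cvg_comp _ _ vx (ch (v x))).
    rewrite (_ : 0 = 0 + (\sum_(i < m) 0) * CM + 0); last by rewrite big1// mul0r !addr0.
    apply: cvgD; last first.
      apply: (c0 (fun s => b * (s * s) + beta x * s + gamma x)) => s.
      apply: cvgD; last exact: cvg_cst.
      by apply: cvgD; (apply: cvgM; first exact: cvg_cst); [apply: cvgM; exact: cvg_id|exact: cvg_id].
    apply: cvgD; first exact: c0.
    apply: cvgM; last exact: cvg_cst.
    by apply: cvgn_sum => i; exact: (c0 (fun s => g2 x s 0 i)).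
  apply: (@cvg_dist_le _ _ S) => // j.
  have ep0 : 0 <= ep j x by rewrite addr_ge0.
  rewrite subr0 ger0_norm; last by rewrite le_min ep0.
  rewrite ge_min; apply/orP; left; rewrite /ep /S lerD2r /ge.
  rewrite (_ : _ - _ = (g1 x (vj j x) - g1 x (v x)) +
    dotv (g2 x (vj j x) - g2 x (v x)) (w j x)); last by rewrite dotvBl; ring.
  apply: le_trans (ler_normD _ _) _; rewrite lerD2l.
  apply: le_trans (dotv_le _ (MC (wx j))) _.
  by rewrite le_eqVlt; apply/orP; left; apply/eqP; congr (_ * _); apply: eq_bigr => i _; rewrite !mxE.
have mmL : {ae mu, forall x, forall j, `|mm j x| <= `|L x|}.
  apply: filterS L0 => x Lx j.
  have ep0 : 0 <= ep j x by rewrite addr_ge0.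
  rewrite ger0_norm; last by rewrite le_min ep0.
  by rewrite ge_min ler_norm orbT.
have m0 : measurable_fun setT (fun _ : T => 0 : R) by exact: measurable_cst.
have [_ cmm] := Rintegral_dominated mmm m0 (integrable_normr Li) mm0 mmL.
rewrite [X in _ --> X](_ : _ = 0) in cmm; last by rewrite /Rintegral integral0.
have mmi j : integ (mm j).
  apply: (integrable_dom (mmm j) (integrable_normr Li)).
  by apply: filterS mmL => x; exact.
have cr : \int[mu]_x r (vj j) x @[j --> \oo] --> \int[mu]_x r v x.
  under eq_fun do rewrite rE//; rewrite rE//.
  apply: cvgD; last exact: cvg_cst.
  apply: cvgD; last by under eq_fun do rewrite ipC; rewrite ipC; exact: (ip_cvg vjL vL betaL vj_L2).
  by apply: cvgM; [exact: cvg_cst|exact: (ip_sqr_cvg vjL vL vj_L2)].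
have ineq j : \int[mu]_x ge v (w j) x + \int[mu]_x r v x - \int[mu]_x r (vj j) x -
    \int[mu]_x mm j x <= \int[mu]_x ge (vj j) (w j) x.
  have gi := vint _ (wA j).
  rewrite lerBlDr lerBlDr -!RintegralD//; last 4 first.
  - by apply: integrable_add => //; exact: upperj.
  - exact: ri.
  - exact: upperj.
  - exact: ri.
  apply: le_Rintegral_ae.
  - by apply: integrable_add => //; exact: ri.
  - by apply: integrable_add; [apply: integrable_add => //; exact: upperj|exact: ri].
  have [_ Mj] := wA j.
  apply: filterS3 lowr upper Mj => x lx ux Mj.
  have h1 := lx (vj j) _ Mj; have h2 := ux _ Mj.
  rewrite -/(ge (vj j) (w j) x) in h1; rewrite -/(ge v (w j) x) in h2.
  rewrite /mm /ep; have e1 := ler_norm (ge v (w j) x - ge (vj j) (w j) x).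
  rewrite distrC in e1; have e2 := ler_norm (r v x - r (vj j) x); rewrite distrC in e2.
  move: h1 h2 e1 e2; rewrite /L minElt; move: (ge _ _ x) (ge _ _ x) (r _ x) (r _ x).
  move=> q1 q2 q3 q4; move: `|q1 - q2| `|q3 - q4| => n1 n2 *.
  by case: ifPn => _; lra.
move=> e e0; have e40 : 0 < e / 4 by rewrite divr_gt0.
have /cvgrPdist_le/(_ _ e40) n1 := vcvg.
have /cvgrPdist_le/(_ _ e40) n2 := cr.
have /cvgrPdist_le/(_ _ e40) n3 := cmm.
apply: filterS3 n1 n2 n3 => j.
rewrite sub0r normrN => /(le_trans (ler_norm _)) n1 n2 /(le_trans (ler_norm _)) n3.
apply: le_trans (ineq j).
have {}n2 : \int[mu]_x r (vj j) x - \int[mu]_x r v x <= e / 4.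
  by apply: le_trans n2; rewrite distrC; exact: ler_norm.
move: n1 n2 n3; rewrite /ge.
move: (\int[mu]_x (g1 x (v x) + _)) (\int[mu]_x (g1 x (v x) + _)) (\int[mu]_x r _ x)
  (\int[mu]_x r _ x) (\int[mu]_x mm j x) => a1 a2 a3 a4 a5; lra.
Qed.

End lower_semicontinuity.

(** * Saddle points *)

Section saddle.
Context {R : realType} {n m : nat} {Om : lipschitz_domain R n}.
Variables (E : dirichlet_system Om) (alpha : R).
Hypotheses (n_gt0 : (0 < n)%N) (alpha_gt0 : 0 < alpha).
Local Notation T := 'rV[R]_n.
Local Notation V := 'rV[R]_m.
Local Notation mu := (lebesgue_on Om).
Local Notation L2 f := (f \in Lfun mu 2%:E).
Local Notation integ f := (mu.-integrable setT (EFin \o f)).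
Local Notation fH := (fracH E alpha).
Local Notation X := (fracHH E alpha).
Local Notation sqn := (sqn E alpha).
Local Notation om0 := (om E alpha 0).

Lemma coercive (b : R) (beta gamma : T -> R) :
  2 * b < om0 -> L2 beta -> integ gamma ->
  exists t c, 0 < t /\ forall v h, fH v -> integ h ->
    {ae mu, forall x, - b * v x ^+ 2 - beta x * v x - gamma x <= h x} ->
    t * sqn v - c <= 2^-1 * sqn v + \int[mu]_x h x.
Proof.
move=> bo bL gi; have o0 : 0 < om0 by exact: om_gt0.
(* With [b'] nonnegative the margin [d] is at most [om0], so the coefficient [d / 4 / om0] does not
   exceed 1/2. *)
pose b' := Num.max b 0; have bb : b <= b' by rewrite le_max lexx.
have b0 : 0 <= b' by rewrite le_max lexx orbT.
have bo' : 2 * b' < om0 by rewrite /b'; case: (leP b 0); rewrite ?mulr0.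
pose d := om0 - 2 * b'; have d0 : 0 < d by rewrite subr_gt0.
(* Poincare leaves [d / 2] times the squared L2 norm. Half of it absorbs the linear term by Young's
   inequality, at the cost [d^-1 * ip beta beta]; the other half, put together with
   [k * (sqn v - om0 * ip v v)] where [k = d / 4 / om0], gives [k * sqn v]. *)
exists (d / 4 / om0), (d^-1 * ip mu beta beta + \int[mu]_x gamma x); split.
  by rewrite !divr_gt0.
move=> v h vH hi lo; have vL := fH_L2 vH.
have i1 : integ (fun x => - b * (v x * v x)) by apply: integrable_scale; exact: L2_mul.
have i2 : integ (fun x => beta x * v x) by exact: L2_mul.
have i12 := integrable_sub i1 i2.
have i3 := integrable_sub i12 gi.
have := le_Rintegral_ae i3 hi; rewrite RintegralB// RintegralB// RintegralZl//; last exact: L2_mul.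
have -> : \int[mu]_x (v x * v x) = ip mu v v by [].
have -> : \int[mu]_x (beta x * v x) = ip mu beta v by [].
have ae : {ae mu, forall x, - b * (v x * v x) - beta x * v x - gamma x <= h x}.
  by apply: filterS lo => x; rewrite expr2.
move=> /(_ ae) H; apply: le_trans (lerD (lexx _) H) => {H ae i1 i2 i12 i3 lo}.
have d20 : 0 < d / 2 by rewrite divr_gt0.
have := ip_young d20 vL bL; rewrite (ipC mu v beta) => yg.
have := L2_le_sqn n_gt0 alpha_gt0 vH => LQ.
have lN := ler_norm (ip mu beta v).
have bbN : b * ip mu v v <= b' * ip mu v v by rewrite ler_wpM2r ?ip_ge0.
have k0 : 0 <= d / 4 / om0 <= 1 / 2.
  rewrite !divr_ge0 ?(ltW d0) ?(ltW o0)//= ler_pdivrMr// /d; lra.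
have dk : d / 4 = d / 4 / om0 * om0 by rewrite divfK// gt_eqF.
have dE : d = om0 - 2 * b' by [].
have di : (d / 2)^-1 = 2 * d^-1 by rewrite invf_div.
rewrite di in yg; move: k0 dk dE bbN lN LQ yg (ip_ge0 mu v).
move: (d / 4 / om0) (d^-1) (ip mu v v) (ip mu beta beta) (ip mu beta v) (`|ip mu beta v|).
move: (sqn v) (\int[mu]_x gamma x) => Q S k d' N B y ay.
clearbody d b'; move: (om0) => o /andP[k0 k1] dk dE bbN lN LQ yg N0.
have H1 : k * (Q - o * N) <= 1 / 2 * (Q - o * N) by rewrite ler_wpM2r ?subr_ge0.
have H2 : k * (o * N) = d / 4 * N by rewrite dk mulrA.
rewrite mulrBr H2 in H1.
have H3 : d * N = o * N - 2 * (b' * N) by rewrite dE mulrBl mulrA.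
have H4 : 2 * ay <= d * N / 2 + 2 * (d' * B).
  by apply: le_trans yg _; rewrite -[2 * d' * B]mulrA lerD2r mulrAC.
have H5 : d / 4 * N = d * N / 4 by rewrite mulrAC.
rewrite H5 in H1 H2; rewrite mulNr.
move: (d' * B) (k * Q) (b * N) (b' * N) (o * N) (d * N) H1 H2 H3 bbN H4 lN.
move=> ? ? ? ? ? ?; lra.
Qed.

Lemma Rintegral_oppr (f : T -> R) : integ f -> \int[mu]_x (- f x) = - \int[mu]_x f x.
Proof.
move=> fi; rewrite -mulN1r -RintegralZl//.
by apply: eq_Rintegral => x _; rewrite mulN1r.
Qed.

Lemma sqn_0 : sqn (fun=> 0) = 0.
Proof.
have [_] := fH_scale n_gt0 0 (fH_0 E alpha n_gt0).
have -> : (fun x : T => 0 * (fun=> 0) x) = (fun=> 0) :> (T -> R).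
  by apply/funext => x; rewrite mul0r.
by rewrite expr0n mul0r.
Qed.

Variables (M : set V) (CM : R) (H1 : T -> R -> R -> R) (H2 : T -> R -> R -> V).
Hypothesis MC : forall y, M y -> forall i, `|y 0 i| <= CM.
Hypotheses (nice1 : everywhere_caratheodory H1)
  (nice2 : forall i, everywhere_caratheodory (fun x a b => H2 x a b 0 i)).
Hypothesis lower_growth : forall u, fH u -> exists b beta gamma,
  [/\ 2 * b < om0, L2 beta, integ gamma & {ae mu, forall x, forall s y, M y ->
    - b * s ^+ 2 - beta x * s - gamma x <= H1 x (u x) s + dotv (H2 x (u x) s) y}].
Hypothesis upper_growth : forall v, fH v -> exists b beta gamma,
  [/\ 2 * b < om0, L2 beta, integ gamma & {ae mu, forall x, forall s y, M y ->
    H1 x s (v x) + dotv (H2 x s (v x)) y <= b * s ^+ 2 + beta x * s + gamma x}].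

Local Notation adm := (adm mu M).

Definition density (w : T -> V) (u v : T -> R) (x : T) : R :=
  H1 x (u x) (v x) + dotv (H2 x (u x) (v x)) (w x).

Definition coupling w u v := \int[mu]_x density w u v x.

Definition energy w u v := 2^-1 * sqn v - 2^-1 * sqn u + coupling w u v.

Lemma growth_integrable b beta gamma (u : T -> R) : L2 u -> L2 beta -> integ gamma ->
  integ (fun x => b * u x ^+ 2 + beta x * u x + gamma x).
Proof.
move=> uL bL gi; apply: integrable_add => //; apply: integrable_add; last exact: L2_mul.
by under [X in integ X]eq_fun do rewrite expr2; apply: integrable_scale; exact: L2_mul.
Qed.

(** The lower bound for [u] is read at [s = v x] and the upper bound for [v] at [s = u x]; neither
    depends on [y]. *)
Lemma density_bound u v : fH u -> fH v -> exists2 L : T -> R, integ L &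
  {ae mu, forall x, forall y, M y ->
    `|H1 x (u x) (v x) + dotv (H2 x (u x) (v x)) y| <= L x}.
Proof.
move=> uH vH; have [b [be [ga [_ beL gaL lo]]]] := lower_growth uH.
have [b' [be' [ga' [_ beL' gaL' up]]]] := upper_growth vH.
have i1 := growth_integrable b (fH_L2 vH) beL gaL.
have i2 := growth_integrable b' (fH_L2 uH) beL' gaL'.
exists (fun x => `|b * v x ^+ 2 + be x * v x + ga x| +
   `|b' * u x ^+ 2 + be' x * u x + ga' x|).
  by apply: integrable_add; exact: integrable_normr.
apply: filterS2 lo up => x lx ux y My.
have := lx (v x) y My; have := ux (u x) y My.
have -> : - b * v x ^+ 2 - be x * v x - ga x = - (b * v x ^+ 2 + be x * v x + ga x).
  by rewrite mulNr !opprD.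
move: (H1 _ _ _ + _) (b * _ + _ + _) (b' * _ + _ + _) => g p q gq pg.
rewrite ler_norml; have := ler_norm q; have := ler_norm p.
by have := normr_ge0 q; have := normr_ge0 p; lra.
Qed.

Lemma density_integrable w u v : adm w -> fH u -> fH v -> integ (density w u v).
Proof.
move=> wA uH vH; have [L Li bd] := density_bound uH vH.
have [mu_ mv_] := (L2_meas (fH_L2 uH), L2_meas (fH_L2 vH)).
apply: (@integrable_dom _ _ _ mu _ L) => //; last first.
  by apply: filterS2 bd wA.2 => x; apply.
apply: measurable_funD; first exact: nice1.2.
by apply: dotv_measurable => i; [exact: (nice2 i).2|exact: wA.1].
Qed.

Section convergence.
Variables (W : nat -> T -> V) (w0 : T -> V).
Hypotheses (WA : forall j, adm (W j)) (w0A : adm w0).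
Hypothesis W_cvg : forall f : T -> V, (forall i, integ (fun x => f x 0 i)) ->
  \int[mu]_x dotv (W j x) (f x) @[j --> \oo] --> \int[mu]_x dotv (w0 x) (f x).
Variables (U : nat -> T -> R) (u0 : T -> R).
Hypotheses (UH : forall j, fH (U j)) (u0H : fH u0).
Hypothesis U_fast : forall j,
  ip mu (fun x => U j x - u0 x) (fun x => U j x - u0 x) <= 8^-1 ^+ j.

Lemma fast_ae : {ae mu, forall x, U ^~ x @ \oo --> u0 x}.
Proof. exact: (L2_fast_ae (fun j => fH_L2 (UH j)) (fH_L2 u0H) U_fast). Qed.

Lemma fast_cvg :
  ip mu (fun x => U j x - u0 x) (fun x => U j x - u0 x) @[j --> \oo] --> 0.
Proof.
apply: (@squeeze_cvgr _ _ _ _ (fun=> 0) (fun j => 8^-1 ^+ j)).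
- by near=> j; rewrite ip_ge0 U_fast.
- exact: cvg_cst.
- by apply: cvg_expr; rewrite ger0_norm// invf_lt1// ltr1n.
Unshelve. all: by end_near. Qed.

(** By the parallelogram law the difference is [2 * sqn (U j) + 2 * sqn u0] minus the [sqn] of the
    sum, and the latter is asymptotically at least [4 * sqn u0] by lower semicontinuity. *)
Lemma sqn_diff_limit e : 0 < e -> \forall j \near \oo,
  sqn (U j \- u0) <= 2 * sqn (U j) - 2 * sqn u0 + e.
Proof.
move=> e0; have [d0H _ D] := fH_add_sub n_gt0 u0H u0H.
have sH j : fH (fun x => U j x + u0 x) by have [] := fH_add_sub n_gt0 (UH j) u0H.
have zE : (fun x => u0 x - u0 x) = (fun=> 0) by apply/funext => x; exact: subrr.
rewrite zE sqn_0 addr0 in D.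
have c : ip mu (fun x => U j x + u0 x - (u0 x + u0 x)) (fun x => U j x + u0 x - (u0 x + u0 x))
    @[j --> \oo] --> 0.
  apply: cvg_trans fast_cvg; apply: near_eq_cvg; near=> j.
  by congr (ip mu _ _); apply/funext => x; rewrite opprD addrA addrK.
have := sqn_lsc n_gt0 sH d0H c e0; rewrite D; apply: filterS => j.
have [_ _] := fH_add_sub n_gt0 (UH j) u0H.
rewrite -[sqn (fun x => U j x - u0 x)]/(sqn (U j \- u0)).
move: (sqn _) (sqn _) (sqn _) (sqn _) => a b f g; lra.
Unshelve. all: by end_near. Qed.

Lemma coupling_lsc_snd u e : fH u -> 0 < e -> \forall j \near \oo,
  coupling w0 u u0 - e <= coupling (W j) u (U j).
Proof.
move=> uH e0; have [b [be [ga [_ beL gaL lo]]]] := lower_growth uH.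
have [L Li bd] := density_bound uH u0H.
have mu_ := L2_meas (fH_L2 uH).
pose g1 x s := H1 x (u x) s; pose g2 x s := H2 x (u x) s.
have mg1 f : measurable_fun setT f -> measurable_fun setT (fun x => g1 x (f x)).
  by move=> mf; exact: nice1.2.
have mg2 i f : measurable_fun setT f -> measurable_fun setT (fun x => g2 x (f x) 0 i).
  by move=> mf; exact: (nice2 i).2.
have cg1 x : continuous (g1 x).
  move=> s; apply: (cvg_comp _ _ (@cvg_pair _ _ _ _ (nbhs (u x)) (nbhs s) _ _ _ _ _
    (cvg_cst _) cvg_id) (nice1.1 x (u x, s))).
have cg2 x i : continuous (fun s => g2 x s 0 i).
  move=> s; apply: (cvg_comp _ _ (@cvg_pair _ _ _ _ (nbhs (u x)) (nbhs s) _ _ _ _ _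
    (cvg_cst _) cvg_id) ((nice2 i).1 x (u x, s))).
have up : {ae mu, forall x, forall y, M y -> g1 x (u0 x) + dotv (g2 x (u0 x)) y <= L x}.
  by apply: filterS bd => x h y /h; apply: le_trans; exact: ler_norm.
have upj j : integ (fun x => g1 x (U j x) + dotv (g2 x (U j x)) (W j x)).
  exact: (density_integrable (WA j) uH (UH j)).
have [_] := lsc_integrand (domain_finite Om) MC WA w0A W_cvg mg1 mg2 cg1 cg2 beL gaL Li
  (fH_L2 u0H) (fun j => fH_L2 (UH j)) lo up upj fast_ae fast_cvg.
by move=> /(_ e e0).
Qed.

(** Lower semicontinuity applied to the opposite integrand in its first argument, for which the
    upper growth condition supplies the quadratic minorant. *)
Lemma coupling_usc_fst v e : fH v -> 0 < e -> \forall j \near \oo,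
  coupling (W j) (U j) v <= coupling w0 u0 v + e.
Proof.
move=> vH e0; have [b [be [ga [_ beL gaL lo]]]] := upper_growth vH.
have [L Li bd] := density_bound u0H vH.
have mv_ := L2_meas (fH_L2 vH).
pose g1 x s := - H1 x s (v x); pose g2 x s := - H2 x s (v x).
have gE x s y : g1 x s + dotv (g2 x s) y = - (H1 x s (v x) + dotv (H2 x s (v x)) y).
  by rewrite /g2 -scaleN1r dotvZl mulN1r opprD.
have mg1 f : measurable_fun setT f -> measurable_fun setT (fun x => g1 x (f x)).
  by move=> mf; apply: measurable_funN; exact: nice1.2.
have mg2 i f : measurable_fun setT f -> measurable_fun setT (fun x => g2 x (f x) 0 i).
  move=> mf; under eq_fun do rewrite mxE; apply: measurable_funN; exact: (nice2 i).2.
have cg1 x : continuous (g1 x).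
  move=> s; apply: cvgN; apply: (cvg_comp _ _ (@cvg_pair _ _ _ _ (nbhs s) (nbhs (v x)) _ _ _ _ _
    cvg_id (cvg_cst _)) (nice1.1 x (s, v x))).
have cg2 x i : continuous (fun s => g2 x s 0 i).
  have -> : (fun s => g2 x s 0 i) = (fun s => - H2 x s (v x) 0 i).
    by apply/funext => s; rewrite mxE.
  move=> s; apply: cvgN; apply: (cvg_comp _ _ (@cvg_pair _ _ _ _ (nbhs s) (nbhs (v x)) _ _ _ _ _
    cvg_id (cvg_cst _)) ((nice2 i).1 x (s, v x))).
have up : {ae mu, forall x, forall y, M y -> g1 x (u0 x) + dotv (g2 x (u0 x)) y <= L x}.
  by apply: filterS bd => x h y /h; apply: le_trans; rewrite gE -normrN ler_norm.
have lo' : {ae mu, forall x, forall s y, M y ->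
    - b * s ^+ 2 - be x * s - ga x <= g1 x s + dotv (g2 x s) y}.
  apply: filterS lo => x h s y My; rewrite gE mulNr -!opprD lerN2; exact: h.
have gI w u : integ (density w u v) ->
    \int[mu]_x (g1 x (u x) + dotv (g2 x (u x)) (w x)) = - coupling w u v.
  by move=> wi; rewrite -Rintegral_oppr//; apply: eq_Rintegral => x _; exact: gE.
have upj j : integ (fun x => g1 x (U j x) + dotv (g2 x (U j x)) (W j x)).
  have := integrable_oppr (density_integrable (WA j) (UH j) vH).
  by congr (integ _); apply/funext => x; rewrite gE.
have [_] := lsc_integrand (domain_finite Om) MC WA w0A W_cvg mg1 mg2 cg1 cg2 beL gaL Li
  (fH_L2 u0H) (fun j => fH_L2 (UH j)) lo' up upj fast_ae fast_cvg.
move=> /(_ e e0); apply: filterS => j.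
rewrite (gI _ _ (density_integrable w0A u0H vH)) (gI _ _ (density_integrable (WA j) (UH j) vH)).
by rewrite -opprD lerN2.
Qed.

End convergence.

(** The Nikaido-Isoda function of the zero-sum game with payoff [energy]. *)
Definition gap w (p z : X) :=
  energy w (fracHH_fst z) (fracHH_snd p) - energy w (fracHH_fst p) (fracHH_snd z).

Lemma gapE w p z : gap w p z = 2^-1 * sqnn p - 2^-1 * sqnn z +
  (coupling w (fracHH_fst z) (fracHH_snd p) - coupling w (fracHH_fst p) (fracHH_snd z)).
Proof.
rewrite /gap /energy /sqnn; move: (coupling _ _ _) (coupling _ _ _) => c c'.
move: (sqn _) (sqn _) (sqn _) (sqn _) => a b a' b'; ring.
Qed.

Lemma gap_diag w p : gap w p p = 0. Proof. exact: subrr. Qed.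

Definition origin : X := fracHH_pair (fH_0 E alpha n_gt0) (fH_0 E alpha n_gt0).

(** The lower growth at [u = 0] makes the second component coercive, the upper growth at [v = 0] the
    first. The threshold 1 covers saddle points and the almost-saddle points of the existence proof
    alike. *)
Lemma gap_bound : exists r, forall w p, adm w -> gap w p origin <= 1 -> sqnn p <= r.
Proof.
have z0 := fH_0 E alpha n_gt0.
have [b [be [ga [bo beL gaL lo]]]] := lower_growth z0.
have [b' [be' [ga' [bo' beL' gaL' up]]]] := upper_growth z0.
have [t [c [t0 tP]]] := coercive bo beL gaL.
have [t' [c' [t0' tP']]] := coercive bo' beL' gaL'.
exists ((1 + c + c') / Num.min t t') => w p wA.
have m0 : 0 < Num.min t t' by rewrite lt_min t0.
rewrite ler_pdivlMr// gapE.
have -> : sqnn origin = 0 by rewrite /sqnn /= sqn_0 addr0.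
rewrite mulr0 subr0 => gp.
have uH := fracHH_fstP p; have vH := fracHH_sndP p.
have i1 := density_integrable wA z0 vH; have i2 := density_integrable wA uH z0.
have lo1 : {ae mu, forall x, - b * fracHH_snd p x ^+ 2 - be x * fracHH_snd p x - ga x <=
    density w (fun=> 0) (fracHH_snd p) x}.
  by apply: filterS2 lo wA.2 => x h Mx; exact: h.
have lo2 : {ae mu, forall x, - b' * fracHH_fst p x ^+ 2 - be' x * fracHH_fst p x - ga' x <=
    - density w (fracHH_fst p) (fun=> 0) x}.
  by apply: filterS2 up wA.2 => x h Mx; rewrite mulNr -!opprD lerN2; exact: h.
have := tP _ _ vH i1 lo1; have := tP' _ _ uH (integrable_oppr i2) lo2.
have -> : \int[mu]_x (- density w (fracHH_fst p) (fun=> 0) x) =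
    - coupling w (fracHH_fst p) (fun=> 0).
  exact: Rintegral_oppr.
have -> : \int[mu]_x density w (fun=> 0) (fracHH_snd p) x =
    coupling w (fun=> 0) (fracHH_snd p) by [].
have {gp} : 2^-1 * (sqn (fracHH_fst p) + sqn (fracHH_snd p)) +
  (coupling w (fun=> 0) (fracHH_snd p) - coupling w (fracHH_fst p) (fun=> 0)) <= 1 by exact: gp.
rewrite /sqnn; move: (coupling w _ (fun=> 0)) (coupling w (fun=> 0) _) => e e'.
have := sqn_ge0 E alpha (fracHH_fst p); have := sqn_ge0 E alpha (fracHH_snd p).
have m1 : Num.min t t' <= t by rewrite ge_min lexx.
have m2 : Num.min t t' <= t' by rewrite ge_min lexx orbT.
move: (Num.min t t') m0 m1 m2 (sqn (fracHH_fst p)) (sqn (fracHH_snd p)) => k k0 k1 k2 q q' q0' q0.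
have : k * q <= t' * q by rewrite ler_wpM2r.
have : k * q' <= t * q' by rewrite ler_wpM2r.
rewrite mulrDl [q * k]mulrC [q' * k]mulrC.
move: (k * q) (k * q') (t * q') (t' * q) => a1 a2 a3 a4; lra.
Qed.

Lemma fast_fst (P : nat -> X) p0 : (forall j, dist2 (P j) p0 <= 8^-1 ^+ j) -> forall j,
  ip mu (fun x => fracHH_fst (P j) x - fracHH_fst p0 x)
        (fun x => fracHH_fst (P j) x - fracHH_fst p0 x) <= 8^-1 ^+ j.
Proof. by move=> H j; apply: le_trans (H j); rewrite lerDl ip_ge0. Qed.

Lemma fast_snd (P : nat -> X) p0 : (forall j, dist2 (P j) p0 <= 8^-1 ^+ j) -> forall j,
  ip mu (fun x => fracHH_snd (P j) x - fracHH_snd p0 x)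
        (fun x => fracHH_snd (P j) x - fracHH_snd p0 x) <= 8^-1 ^+ j.
Proof. by move=> H j; apply: le_trans (H j); rewrite lerDr ip_ge0. Qed.

Section gap_limit.
Variables (W : nat -> T -> V) (w0 : T -> V).
Hypotheses (WA : forall j, adm (W j)) (w0A : adm w0).
Hypothesis W_cvg : forall f : T -> V, (forall i, integ (fun x => f x 0 i)) ->
  \int[mu]_x dotv (W j x) (f x) @[j --> \oo] --> \int[mu]_x dotv (w0 x) (f x).
Variables (P : nat -> X) (p0 : X).
Hypothesis P_fast : forall j, dist2 (P j) p0 <= 8^-1 ^+ j.

Lemma sqnn_lsc e : 0 < e -> \forall j \near \oo, sqnn p0 - e <= sqnn (P j).
Proof.
move=> e0; have e20 : 0 < e / 2 by rewrite divr_gt0.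
have l1 := sqn_lsc n_gt0 (fun j => fracHH_fstP (P j)) (fracHH_fstP p0)
  (fast_cvg (fast_fst P_fast)) e20.
have l2 := sqn_lsc n_gt0 (fun j => fracHH_sndP (P j)) (fracHH_sndP p0)
  (fast_cvg (fast_snd P_fast)) e20.
apply: filterS2 l1 l2 => j; rewrite /sqnn.
move: (sqn _) (sqn _) (sqn _) (sqn _) => a b c d; lra.
Qed.

Lemma coupling_lsc (z : X) e : 0 < e -> \forall j \near \oo,
  coupling w0 (fracHH_fst z) (fracHH_snd p0) - coupling w0 (fracHH_fst p0) (fracHH_snd z) - e
  <= coupling (W j) (fracHH_fst z) (fracHH_snd (P j))
     - coupling (W j) (fracHH_fst (P j)) (fracHH_snd z).
Proof.
move=> e0; have e20 : 0 < e / 2 by rewrite divr_gt0.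
have l1 := coupling_lsc_snd WA w0A W_cvg (fun j => fracHH_sndP (P j)) (fracHH_sndP p0)
  (fast_snd P_fast) (fracHH_fstP z) e20.
have l2 := coupling_usc_fst WA w0A W_cvg (fun j => fracHH_fstP (P j)) (fracHH_fstP p0)
  (fast_fst P_fast) (fracHH_sndP z) e20.
apply: filterS2 l1 l2 => j.
move: (coupling _ _ _) (coupling _ _ _) (coupling _ _ _) (coupling _ _ _) => a b c d; lra.
Qed.

Lemma gap_limit z : (forall e, 0 < e -> \forall j \near \oo, gap (W j) (P j) z <= e) ->
  gap w0 p0 z <= 0.
Proof.
move=> H; apply/ler_addgt0Pr => e e0; rewrite add0r.
have e40 : 0 < e / 4 by rewrite divr_gt0.
have [j [l1 [l2 l3]]] : exists j, sqnn p0 - e / 4 <= sqnn (P j) /\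
    coupling w0 (fracHH_fst z) (fracHH_snd p0) - coupling w0 (fracHH_fst p0) (fracHH_snd z) - e / 4
    <= coupling (W j) (fracHH_fst z) (fracHH_snd (P j))
     - coupling (W j) (fracHH_fst (P j)) (fracHH_snd z) /\ gap (W j) (P j) z <= e / 4.
  apply: (@filter_ex _ (\oo : set_system nat)).
  by apply: filterS3 (sqnn_lsc e40) (coupling_lsc z e40) (H _ e40) => j.
move: l3 l2 l1; rewrite !gapE.
move: (coupling _ _ _) (coupling _ _ _) (coupling _ _ _) (coupling _ _ _) => a b c d.
move: (sqnn _) (sqnn _) (sqnn _) => x y t; lra.
Qed.

(* Taking [z = p0] bounds the limsup of the norms; the parallelogram law does the rest. *)
Lemma strong_limit : (forall e, 0 < e -> \forall j \near \oo, gap (W j) (P j) p0 <= e) ->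
  forall e, 0 < e -> \forall j \near \oo, fracHH_dist (P j) p0 < e.
Proof.
(* At [z = p0] the coupling part is at least [- a] and the gap at most [a], so
   [sqnn (P j) - sqnn p0 <= 4 * a]; the squared distance is then at most
   [8 * a + 2 * a = e ^+ 2 / 2]. *)
move=> H e e0; pose a := e ^+ 2 / 20.
have a0 : 0 < a by rewrite divr_gt0// exprn_gt0.
have l1 := sqn_diff_limit (fun j => fracHH_fstP (P j)) (fracHH_fstP p0) (fast_fst P_fast) a0.
have l2 := sqn_diff_limit (fun j => fracHH_sndP (P j)) (fracHH_sndP p0) (fast_snd P_fast) a0.
have l12 : \forall j \near \oo,
    sqn (fracHH_fst (P j) \- fracHH_fst p0) + sqn (fracHH_snd (P j) \- fracHH_snd p0) <=
    2 * sqnn (P j) - 2 * sqnn p0 + 2 * a.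
  apply: filterS2 l1 l2 => j; rewrite /sqnn; clearbody a.
  move: (sqn (_ \- _)) (sqn (_ \- _)) => x y.
  move: (sqn _) (sqn _) (sqn _) (sqn _) => p q r s; lra.
apply: filterS3 l12 (coupling_lsc p0 a0) (H _ a0) => j h1 h3 h4.
rewrite subrr sub0r in h3; rewrite gapE in h4.
have eE : e = Num.sqrt (e ^+ 2) by rewrite sqrtr_sqr ger0_norm// ltW.
rewrite /fracHH_dist /fracHH_norm [ltRHS]eE ltr_sqrt ?exprn_gt0//.
rewrite -/(sqn _) -/(sqn _); apply: le_lt_trans h1 _.
move: h4 h3; rewrite /a.
move: (coupling _ _ _) (coupling _ _ _) => c d.
have : 0 < e ^+ 2 by rewrite exprn_gt0.
move: (sqnn _) (sqnn _) (e ^+ 2) => x y f; lra.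
Qed.

End gap_limit.

Lemma fH_comb t u v : fH u -> fH v -> fH (fun x => t * u x + (1 - t) * v x).
Proof.
move=> uH vH; have [tu _] := fH_scale n_gt0 t uH; have [tv _] := fH_scale n_gt0 (1 - t) vH.
by have [] := fH_add_sub n_gt0 tu tv.
Qed.

Definition comb t (p q : X) : X :=
  fracHH_pair (fH_comb t (fracHH_fstP p) (fracHH_fstP q))
              (fH_comb t (fracHH_sndP p) (fracHH_sndP q)).

Lemma saddle_exists w : adm w ->
  (forall u v v' t, fH u -> fH v -> fH v' -> 0 <= t <= 1 ->
    energy w u (fun x => t * v x + (1 - t) * v' x) <=
    t * energy w u v + (1 - t) * energy w u v') ->
  (forall u u' v t, fH u -> fH u' -> fH v -> 0 <= t <= 1 ->
    t * energy w u v + (1 - t) * energy w u' v <=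
    energy w (fun x => t * u x + (1 - t) * u' x) v) ->
  exists p, forall z, gap w p z <= 0.
Proof.
move=> wA energy_convex energy_concave.
have cx z : conv_fun comb (gap w ^~ z).
  move=> t p q t01.
  have := energy_convex _ _ _ _ (fracHH_fstP z) (fracHH_sndP p) (fracHH_sndP q) t01.
  have := energy_concave _ _ _ _ (fracHH_fstP p) (fracHH_fstP q) (fracHH_sndP z) t01.
  rewrite /gap /=; move: (energy _ _ _) (energy _ _ _) (energy _ _ _) => a b c.
  move: (energy _ _ _) (energy _ _ _) (energy _ _ _) => d f g.
  rewrite !mulrBr; move: (t * _) (t * _) ((1 - t) * _) ((1 - t) * _) => ? ? ? ?; lra.
have cv p t z z' : 0 <= t <= 1 ->
    t * gap w p z + (1 - t) * gap w p z' <= gap w p (comb t z z').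
  move=> t01.
  have := energy_convex _ _ _ _ (fracHH_fstP p) (fracHH_sndP z) (fracHH_sndP z') t01.
  have := energy_concave _ _ _ _ (fracHH_fstP z) (fracHH_fstP z') (fracHH_sndP p) t01.
  rewrite /gap /=; move: (energy _ _ _) (energy _ _ _) (energy _ _ _) => a b c.
  move: (energy _ _ _) (energy _ _ _) (energy _ _ _) => d f g.
  rewrite !mulrBr; move: (t * _) (t * _) ((1 - t) * _) ((1 - t) * _) => ? ? ? ?; lra.
pose A (s : seq X) (k : nat) : set X := [set p | forall z, z \in s -> gap w p z < k.+1%:R^-1].
(* By the finite minimax theorem the almost-saddle sets [A s k] generate a proper filter. *)
pose F : set_system X := [set B | exists s k, A s k `<=` B].
have FF : ProperFilter F.
  split; last split.
  - move=> [s [k sub]]; have k0 : 0 < k.+1%:R^-1 :> R by rewrite invr_gt0 ltr0n.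
    have [p pP] := finite_saddle cx cv origin s (gap_diag w) k0.
    exact: (sub p pP).
  - by exists [::], 0%N.
  - move=> B C [s [k sB]] [s' [k' sC]]; exists (s ++ s'), (maxn k k') => p pA.
    split; [apply: sB => z zs|apply: sC => z zs].
      apply: lt_le_trans (pA z _) _; first by rewrite mem_cat zs.
      by rewrite lef_pV2 ?posrE ?ltr0n// ler_nat ltnS leq_maxl.
    apply: lt_le_trans (pA z _) _; first by rewrite mem_cat zs orbT.
    by rewrite lef_pV2 ?posrE ?ltr0n// ler_nat ltnS leq_maxr.
  - by move=> B C BC [s [k sB]]; exists s, k; exact: subset_trans BC.
have [r rP] := gap_bound.
have Fr : F [set p | sqnn p <= r].
  exists [:: origin], 0%N => p pA; apply: (rP w p wA); apply: ltW.
  by have := pA origin; rewrite mem_head invr1; apply.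
have [p0 p0P] := fracHH_compact n_gt0 alpha_gt0 FF Fr.
exists p0 => z.
(* [p0] was fixed before [z]; each [z] gets its own sequence tending to [p0]. The control is
   constant, so its weak-* convergence is trivial. *)
have [P PP] : {P : nat -> X & forall j, gap w (P j) z < j.+1%:R^-1 /\
    dist2 (P j) p0 <= 8^-1 ^+ j}.
  apply: (@choice _ _ (fun (j : nat) p => gap w p z < j.+1%:R^-1 /\
    dist2 p p0 <= 8^-1 ^+ j)) => j.
  have [||p pA pd] := p0P (A [:: z] j) (8^-1 ^+ j); first by exists [:: z], j.
    by rewrite exprn_gt0// invr_gt0.
  by exists p; split => //; apply: pA; rewrite mem_head.
apply: (@gap_limit (fun=> w) w (fun=> wA) wA (fun f _ => cvg_cst _) P p0) => [j|e e0].
  exact: (PP j).2.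
have [J _ JP] : \forall j \near \oo, (j.+1%:R^-1 : R) < e.
  exact: near_infty_natSinv_lt (PosNum e0).
by exists J => // j /= /JP je; exact: ltW (lt_trans (PP j).1 je).
Qed.

(** * Strong cluster points of sequences of saddle points *)

Section stability.
Variables (W : nat -> T -> V) (w0 : T -> V).
Hypotheses (WA : forall j, adm (W j)) (w0A : adm w0).
Hypothesis W_cvg : forall f : T -> V, (forall i, integ (fun x => f x 0 i)) ->
  \int[mu]_x dotv (W j x) (f x) @[j --> \oo] --> \int[mu]_x dotv (w0 x) (f x).
Variable x : nat -> X.
Hypothesis x_saddle : forall j z, gap (W j) (x j) z <= 0.

Lemma subsequence_cvg (s : nat -> nat) : (forall j, (j <= s j)%N) ->
  forall f : T -> V, (forall i, integ (fun x => f x 0 i)) ->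
  \int[mu]_x dotv (W (s j) x) (f x) @[j --> \oo] --> \int[mu]_x dotv (w0 x) (f x).
Proof.
move=> sj f fi; apply: cvg_comp (W_cvg fi) => A [N _ NA].
by exists N => // j /= Nj; apply: NA => /=; exact: leq_trans (sj j).
Qed.

(** Compactness gives only an L2 cluster point; the saddle inequality tested at that very point
    upgrades the convergence to the strong one. *)
Lemma saddle_cluster : exists p0, cluster (x @ \oo) p0.
Proof.
have [r rP] := gap_bound.
have xr : (x @ \oo) [set p | sqnn p <= r].
  by exists 0%N => // j _; apply: (rP (W j)) => //; exact: le_trans (x_saddle j _) ler01.
have [p0 p0P] := fracHH_compact n_gt0 alpha_gt0 (fmap_proper_filter x eventually_filter) xr.
have [s sP] : {s : nat -> nat & forall j, (j <= s j)%N /\ dist2 (x (s j)) p0 <= 8^-1 ^+ j}.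
  apply: (@choice _ _ (fun (j k : nat) => (j <= k)%N /\ dist2 (x k) p0 <= 8^-1 ^+ j)) => j.
  have [||_ [k jk <-] kd] := p0P (x @` [set k | (j <= k)%N]) (8^-1 ^+ j).
  - by exists j => // k /= jk; exists k.
  - by rewrite exprn_gt0// invr_gt0.
  - by exists k.
exists p0 => A B [N _ NA] /nbhs_ballP[e /= e0 eB].
have sle j : (j <= s j)%N by exact: (sP j).1.
have gap_le e1 : 0 < e1 -> \forall j \near \oo, gap ((W \o s) j) ((x \o s) j) p0 <= e1.
  by move=> e10; exists 0%N => // j _; exact: le_trans (x_saddle _ _) (ltW e10).
have [J _ JP] := @strong_limit (W \o s) w0 (fun j => WA (s j)) w0A (subsequence_cvg sle)
  (x \o s) p0 (fun j => (sP j).2) gap_le e e0.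
exists (x (s (maxn N J))); split.
  by apply: NA => /=; exact: leq_trans (leq_maxl N J) (sle _).
apply/eB/ball_sym; exact: (JP (maxn N J) (leq_maxr N J)).
Qed.

Lemma cluster_saddle y : cluster (x @ \oo) y -> forall z, gap w0 y z <= 0.
Proof.
move=> xy z.
have [s sP] : {s : nat -> nat & forall j, (j <= s j)%N /\ dist2 (x (s j)) y <= 8^-1 ^+ j}.
  apply: (@choice _ _ (fun (j k : nat) => (j <= k)%N /\ dist2 (x k) y <= 8^-1 ^+ j)) => j.
  have o0 : 0 < om0 by exact: om_gt0.
  (* [om0 * dist2] is at most the squared strong distance, so this strong ball lies inside the L2
     ball wanted. *)
  have c0 : 0 < Num.sqrt (om0 * 8^-1 ^+ j).
    by rewrite sqrtr_gt0 mulr_gt0// exprn_gt0// invr_gt0.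
  have [||_ [[k jk <-] kd]] := xy (x @` [set k | (j <= k)%N]) (ball y (Num.sqrt (om0 * 8^-1 ^+ j))).
  - by exists j => // k /= jk; exists k.
  - exact: nbhsx_ballx.
  exists k; split => //.
  have {kd} : fracHH_dist (x k) y < Num.sqrt (om0 * 8^-1 ^+ j) by apply: ball_sym kd.
  rewrite /fracHH_dist /fracHH_norm ltr_sqrt; last by rewrite -sqrtr_gt0.
  move=> /ltW kd; rewrite -(ler_pM2l o0); apply: le_trans kd.
  have [_ sH1 _] := fH_add_sub n_gt0 (fracHH_fstP (x k)) (fracHH_fstP y).
  have [_ sH2 _] := fH_add_sub n_gt0 (fracHH_sndP (x k)) (fracHH_sndP y).
  by rewrite mulrDr; apply: lerD; exact: L2_le_sqn.
have sle j : (j <= s j)%N by exact: (sP j).1.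
apply: (@gap_limit (W \o s) w0 (fun j => WA (s j)) w0A (subsequence_cvg sle)
  (x \o s) y (fun j => (sP j).2)) => e e0.
by exists 0%N => // j _; exact: le_trans (x_saddle _ _) (ltW e0).
Qed.

End stability.
End saddle.

(** * Reduction to integrands defined everywhere *)

Section dense_bounds.
Context d (T : measurableType d) (R : realType) (mu : {measure set T -> \bar R}) (m : nat).
Local Notation V := 'rV[R]_m.

Lemma rat_approx (x e : R) : 0 < e -> exists q : rat, `|ratr q - x| < e.
Proof.
move=> e0; have xr : x - e < x + e by lra.
have [q] := rat_in_itvoo xr; rewrite in_itv/= => qx; exists q.
by rewrite ltr_distlC; lra.
Qed.

Lemma harmonic_cvg0 : (2 * k.+1%:R^-1 : R) @[k --> \oo] --> 0.
Proof.
rewrite -[X in _ --> X](mulr0 2); apply: cvgM; first exact: cvg_cst.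
exact: cvg_harmonic.
Qed.

(* [M] is an arbitrary set, so a countable dense subset is extracted by choosing a point of
   [M] in each rational box that meets it. *)
Lemma ae_forall_bound (M : set V) (h : T -> R -> V -> R) :
  (forall x (s_ : nat -> R) (s : R) (y_ : nat -> V) (y : V), s_ @ \oo --> s ->
    (forall i, y_ k 0 i @[k --> \oo] --> y 0 i) ->
    h x (s_ k) (y_ k) @[k --> \oo] --> h x s y) ->
  (forall (s : R) (y : V), M y -> {ae mu, forall x, 0 <= h x s y}) ->
  {ae mu, forall x, forall (s : R) (y : V), M y -> 0 <= h x s y}.
Proof.
move=> hc H.
pose box (p : rat * 'rV[rat]_m * rat) : set V :=
  [set y | M y /\ forall i, `|ratr (p.1.2 0 i) - y 0 i| < ratr p.2].
(* If the box misses [M], [Y p] is the default 0, possibly outside [M]; hence the guard [M (Y p)] in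
   [HY]. *)
pose Y p : V := xget 0 (box p).
have HY (p : rat * 'rV[rat]_m * rat) :
    {ae mu, forall x, M (Y p) -> 0 <= h x (ratr p.1.1) (Y p)}.
  have [MY|MY] := pselect (M (Y p)).
    by apply: filterS (H (ratr p.1.1) _ MY) => x.
  by apply: aeW => x /MY.
apply: filterS (ae_countable HY) => x hx s y My.
have e0 k : 0 < k.+1%:R^-1 :> R by rewrite invr_gt0 ltr0n.
have step k : exists p : rat * 'rV[rat]_m * rat,
    `|ratr p.1.1 - s| <= 2 * k.+1%:R^-1 /\ box p y /\ ratr p.2 < k.+1%:R^-1 :> R.
  have [q qs] := rat_approx s (e0 k).
  have [r] := rat_in_itvoo (e0 k); rewrite in_itv/= => /andP[r0 rk].
  have [c cy] : {c : 'I_m -> rat & forall i, `|ratr (c i) - y 0 i| < (ratr r : R)}.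
    by apply: (@choice _ _ (fun i q => `|ratr q - y 0 i| < (ratr r : R))) => i; exact: rat_approx.
  exists (q, \row_i c i, r); split => /=.
    by apply: le_trans (ltW qs) _; rewrite -[leLHS]mul1r ler_wpM2r ?ler1n// ltW.
  by split => //; split => // i; rewrite mxE.
have [p pP] := choice step.
have Yp k : M (Y (p k)) /\ forall i, `|Y (p k) 0 i - y 0 i| <= 2 * k.+1%:R^-1.
  have [_ [yb rk]] := pP k; have [MY Yb] : box (p k) (Y (p k)) by apply: xgetPex; exists y.
  split => // i; have := Yb i; have := yb.2 i; move: rk.
  move: (ratr _) (ratr _) (k.+1%:R^-1) (Y _ 0 i) (y 0 i) => a b t f g.
  rewrite !ltr_norml ler_norml => bt /andP[? ?] /andP[? ?].
  by apply/andP; split; lra.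
have c : h x (ratr (p k).1.1) (Y (p k)) @[k --> \oo] --> h x s y.
  apply: hc => [|i]; first by apply: cvg_dist_le harmonic_cvg0 => k; exact: (pP k).1.
  by apply: cvg_dist_le harmonic_cvg0 => k; exact: (Yp k).2.
by apply: (cvgn_ge (K := 0%N) c) => k _; apply: hx; exact: (Yp k).1.
Qed.

End dense_bounds.

Section reduction.
Context {R : realType} {n m : nat} (Om : lipschitz_domain R n).
Local Notation T := 'rV[R]_n.
Local Notation V := 'rV[R]_m.
Local Notation mu := (lebesgue_on Om).
Local Notation L2 f := (f \in Lfun mu 2%:E).
Local Notation integ f := (mu.-integrable setT (EFin \o f)).

Lemma bounded_coord (M : set V) : bounded_set M ->
  exists CM, forall y, M y -> forall i, `|y 0 i| <= CM.
Proof.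
move=> [C [_ CP]]; exists (C + 1) => y My i.
have := CP (C + 1); rewrite ltrDl ltr01 => /(_ isT y My).
apply: le_trans; rewrite [leRHS]mx_normrE.
exact: (le_bigmax _ (fun ij => `|y ij.1 ij.2|) (0, i)).
Qed.

(** One null set serves [G1] and all components of [G2]; it also swallows the complement of [Om], so
    later almost-everywhere statements can drop the condition of lying in [Om]. *)
Lemma caratheodory_modification (G1 : T -> R -> R -> R) (G2 : T -> R -> R -> V) :
  caratheodory Om G1 -> (forall i, caratheodory Om (component G2 i)) ->
  exists (H1 : T -> R -> R -> R) (H2 : T -> R -> R -> V) N,
  [/\ everywhere_caratheodory H1, forall i, everywhere_caratheodory (fun x a b => H2 x a b 0 i) &
    [/\ measurable N, mu N = 0%E &
      forall x, ~ N x -> domain_set Om x /\ forall a b, H1 x a b = G1 x a b /\ H2 x a b = G2 x a b]].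
Proof.
move=> c1 c2; have [N1 [mN1 N10 nice1]] := caratheodory_nice c1.
have [N2 N2P] : {N2 : 'I_m -> set T & forall i, [/\ measurable (N2 i), mu (N2 i) = 0%E &
    forall N', measurable N' -> N2 i `<=` N' -> everywhere_caratheodory (zero_on N' (component G2 i))]}.
  apply: (@choice _ _ (fun i N => [/\ measurable N, mu N = 0%E &
    forall N', measurable N' -> N `<=` N' ->
      everywhere_caratheodory (zero_on N' (component G2 i))])) => i.
  exact: caratheodory_nice.
have ae1 : {ae mu, forall x, ~ N1 x} by exact: null_ae mN1 N10 _.
have ae2 : {ae mu, forall x, forall i, ~ N2 i x}.
  apply: ae_countable => i; have [mN N0 _] := N2P i; exact: null_ae mN N0 _.
have /ae_null[N [mN N0 NP]] : {ae mu, forall x,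
    ~ N1 x /\ (forall i, ~ N2 i x) /\ domain_set Om x}.
  by apply: filterS3 ae1 ae2 (ae_domain Om) => x.
exists (zero_on N G1), (fun x a b => if x \in N then 0 else G2 x a b), N; split => //.
- by apply: nice1 => // x N1x; apply: contrapT => /NP[].
- move=> i; have [mNi Ni0 nicei] := N2P i.
  have -> : (fun x a b => (if x \in N then 0 else G2 x a b) 0 i) = zero_on N (component G2 i).
    apply/funext => x; apply/funext => a; apply/funext => b.
    by rewrite /zero_on; case: ifP => //; rewrite mxE.
  by apply: nicei => // x Nix; apply: contrapT => /NP[_ [/(_ i)]].
- split => // x xN; split; first by have [_ []] := NP x xN.
  by move=> a b; rewrite /zero_on memNset.
Qed.

Lemma admissible_adm (M : set V) w : admissible Om M w -> adm mu M w.
Proof.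
move=> [wL wM]; split; last exact: ae_domainE.
by move=> i; have := wL i; rewrite inE => /andP[+ _]; rewrite inE.
Qed.

Lemma Rintegral_quadratic (f g h : T -> R) : L2 f -> L2 g -> integ h ->
  \int[mu]_x (2^-1 * (g x * g x) - 2^-1 * (f x * f x) + h x) =
  2^-1 * ip mu g g - 2^-1 * ip mu f f + \int[mu]_x h x.
Proof.
move=> fL gL hi.
have iu : integ (fun x => f x * f x) by exact: L2_mul.
have iv : integ (fun x => g x * g x) by exact: L2_mul.
have i1 := integrable_scale 2^-1 iu; have i2 := integrable_scale 2^-1 iv.
have i21 := integrable_sub i2 i1.
by rewrite RintegralD// RintegralB// !RintegralZl.
Qed.

Variables (G1 H1 : T -> R -> R -> R) (G2 H2 : T -> R -> R -> V) (N : set T).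
Hypotheses (nice1 : everywhere_caratheodory H1)
  (nice2 : forall i, everywhere_caratheodory (fun x a b => H2 x a b 0 i)).
Hypotheses (mN : measurable N) (N0 : mu N = 0%E).
Hypothesis HG : forall x, ~ N x ->
  domain_set Om x /\ forall a b, H1 x a b = G1 x a b /\ H2 x a b = G2 x a b.

Lemma pair_cvg (a_ b_ : nat -> R) (a b : R) : a_ @ \oo --> a -> b_ @ \oo --> b ->
  (a_ k, b_ k) @[k --> \oo] --> (a, b).
Proof. by move=> ca cb; apply: (@cvg_pair _ _ _ _ (nbhs a) (nbhs b)). Qed.

Lemma integrand_cvg x (a_ b_ : nat -> R) (a b : R) (y_ : nat -> V) (y : V) :
  a_ @ \oo --> a -> b_ @ \oo --> b -> (forall i, y_ k 0 i @[k --> \oo] --> y 0 i) ->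
  H1 x (a_ k) (b_ k) + dotv (H2 x (a_ k) (b_ k)) (y_ k) @[k --> \oo] -->
  H1 x a b + dotv (H2 x a b) y.
Proof.
move=> ca cb cy; have cab := pair_cvg ca cb; apply: cvgD.
  exact: (cvg_comp _ _ cab (nice1.1 x (a, b))).
apply: cvgn_sum => i; apply: cvgM; last exact: cy.
exact: (cvg_comp _ _ cab ((nice2 i).1 x (a, b))).
Qed.

Lemma quadratic_cvg (b c g : R) (s_ : nat -> R) (s : R) : s_ @ \oo --> s ->
  b * s_ k ^+ 2 + c * s_ k + g @[k --> \oo] --> b * s ^+ 2 + c * s + g.
Proof.
move=> cs; apply: cvgD; last exact: cvg_cst.
apply: cvgD; apply: cvgM => //; try exact: cvg_cst.
by apply: cvgM.
Qed.

(** The exceptional set of the hypothesis may depend on [s] and [y]. Continuity of [H1] and [H2] in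
    [s], and of the pairing in [y], reduces to countably many values and so to a single null set. *)
Lemma lower_transfer (M : set V) b beta gamma u :
  (forall (s : R) (y : V), M y -> {ae mu, forall x, domain_set Om x ->
    - b * `|s| ^+ 2 - beta x * s - gamma x <= integrand G1 G2 x (u x) s y}) ->
  {ae mu, forall x, forall s y, M y ->
    - b * s ^+ 2 - beta x * s - gamma x <= H1 x (u x) s + dotv (H2 x (u x) s) y}.
Proof.
move=> H; pose h x s y := H1 x (u x) s + dotv (H2 x (u x) s) y +
  (b * s ^+ 2 + beta x * s + gamma x).
have hE x s y : (0 <= h x s y) =
    (- b * s ^+ 2 - beta x * s - gamma x <= H1 x (u x) s + dotv (H2 x (u x) s) y).
  by rewrite mulNr -!opprD -[RHS]subr_ge0 opprK.
suff ae : {ae mu, forall x, forall (s : R) (y : V), M y -> 0 <= h x s y}.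
  by apply: filterS ae => x hx s y My; rewrite -hE; exact: hx.
apply: ae_forall_bound => [x s_ s y_ y cs cy|s y My].
  by apply: cvgD; [apply: integrand_cvg => //; exact: cvg_cst|exact: quadratic_cvg].
apply: filterS2 (H s y My) (null_ae mN N0 HG) => x hx [Ox Hx].
rewrite hE; have := hx Ox; rewrite real_normK ?num_real// /integrand.
by have [-> ->] := Hx (u x) s.
Qed.

Lemma upper_transfer (M : set V) b beta gamma v :
  (forall (s : R) (y : V), M y -> {ae mu, forall x, domain_set Om x ->
    integrand G1 G2 x s (v x) y <= b * `|s| ^+ 2 + beta x * s + gamma x}) ->
  {ae mu, forall x, forall s y, M y ->
    H1 x s (v x) + dotv (H2 x s (v x)) y <= b * s ^+ 2 + beta x * s + gamma x}.
Proof.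
move=> H; pose h x s y := b * s ^+ 2 + beta x * s + gamma x -
  (H1 x s (v x) + dotv (H2 x s (v x)) y).
suff ae : {ae mu, forall x, forall (s : R) (y : V), M y -> 0 <= h x s y}.
  by apply: filterS ae => x hx s y My; rewrite -subr_ge0; exact: hx.
apply: ae_forall_bound => [x s_ s y_ y cs cy|s y My].
  by apply: cvgB; [exact: quadratic_cvg|apply: integrand_cvg => //; exact: cvg_cst].
apply: filterS2 (H s y My) (null_ae mN N0 HG) => x hx [Ox Hx].
rewrite subr_ge0; have := hx Ox; rewrite real_normK ?num_real// /integrand.
by have [-> ->] := Hx s (v x).
Qed.

(** The squares of the fractional Laplacians integrate to [sqn], and [Rintegral_null] exchanges
    [G1], [G2] for [H1], [H2] inside the integral. *)
Lemma functional_energy (E : dirichlet_system Om) alpha w u v : (0 < n)%N ->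
  fracH E alpha u -> fracH E alpha v -> integ (density H1 H2 w u v) ->
  functional E alpha G1 G2 w u v = energy E alpha H1 H2 w u v.
Proof.
move=> n_gt0 uH vH di.
have [uL uE] := frac_laplacian_sqn n_gt0 uH; have [vL vE] := frac_laplacian_sqn n_gt0 vH.
rewrite /energy -uE -vE -Rintegral_quadratic//.
apply: (Rintegral_null mN N0) => x /HG[_ Hx].
rewrite -!expr2 !real_normK ?num_real// /density /integrand.
by have [-> ->] := Hx (u x) (v x).
Qed.

End reduction.

Lemma convex_functionE (R : realType) (T : Type) (D : set (T -> R)) (f : (T -> R) -> R)
    t x y : convex_function D f -> 0 <= t <= 1 -> D x -> D y ->
  f (fun z => t * x z + (1 - t) * y z) <= t * f x + (1 - t) * f y.
Proof.
move=> cf /andP[t0 t1] Dx Dy.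
exact: (cf (Itv01 t0 t1) x y (mem_set Dx) (mem_set Dy)).
Qed.

Theorem proposition4 (R : realType) (n m : nat) (hn : (3 <= n)%N)
    (Om : lipschitz_domain R n) (E : dirichlet_system Om)
    (alpha : R) (halpha : 1 < alpha < 2)
    (M : set 'rV[R]_m) (Mconvex : convex_set M) (Mbounded : bounded_set M)
    (G1 : 'rV[R]_n -> R -> R -> R) (G2 : 'rV[R]_n -> R -> R -> 'rV[R]_m)
    (A1 : caratheodory_C1 Om G1 /\ forall i, caratheodory_C1 Om (component G2 i))
    (A2 : exists s c : R,
      [/\ 1 < s < 2 * n%:R / (n%:R - alpha), 0 < c &
       {ae lebesgue_on Om, forall x, domain_set Om x -> forall u v : R,
         let growth := c * (1 + `|u| `^ (s - 1) + `|v| `^ (s - 1)) in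
         [/\ `|partialu G1 x u v| <= growth, `|partialv G1 x u v| <= growth,
             enorm (partialu_vec G2 x u v) <= growth
           & enorm (partialv_vec G2 x u v) <= growth]}])
    (A3 : forall u, fracH E alpha u ->
      exists (b : R) (beta gamma : 'rV[R]_n -> R),
      [/\ 2 * b < eigval E 0 `^ (alpha / 2),
          beta \in Lfun (lebesgue_on Om) 2%:E,
          gamma \in Lfun (lebesgue_on Om) 1%:E
        & forall (v : R) (y : 'rV[R]_m), M y ->
          {ae lebesgue_on Om, forall x, domain_set Om x ->
            - b * `|v| ^+ 2 - beta x * v - gamma x
              <= integrand G1 G2 x (u x) v y}])
    (A4 : forall v, fracH E alpha v ->
      exists (B : R) (beta gamma : 'rV[R]_n -> R),
      [/\ 2 * B < eigval E 0 `^ (alpha / 2),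
          beta \in Lfun (lebesgue_on Om) 2%:E,
          gamma \in Lfun (lebesgue_on Om) 1%:E
        & forall (u : R) (y : 'rV[R]_m), M y ->
          {ae lebesgue_on Om, forall x, domain_set Om x ->
            integrand G1 G2 x u (v x) y
              <= B * `|u| ^+ 2 + beta x * u + gamma x}])
    (A5 : forall w, admissible Om M w ->
      (forall v, fracH E alpha v ->
        convex_function (fracH E alpha)
          (fun u => - functional E alpha G1 G2 w u v)) /\
      (forall u, fracH E alpha u ->
        convex_function (fracH E alpha)
          (fun v => functional E alpha G1 G2 w u v)))
    (w : nat -> 'rV[R]_n -> 'rV[R]_m) (hw : forall k, admissible Om M (w k))
    (w_cvg : weak_star_cvg Om w (w 0%N)) :
  Kuratowski_Limsup (fun k => saddle_points E alpha G1 G2 (w k.+1)) !=set0 /\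
  Kuratowski_Limsup (fun k => saddle_points E alpha G1 G2 (w k.+1)) `<=`
    saddle_points E alpha G1 G2 (w 0%N).

Proof.
have n_gt0 : (0 < n)%N by exact: leq_trans hn.
have alpha_gt0 : 0 < alpha by have /andP[a1 _] := halpha; exact: lt_trans a1.
have [CM MC] := bounded_coord Mbounded.
have [H1 [H2 [N [nice1 nice2 [mN N0 HG]]]]] : exists (H1 : _ -> R -> R -> R)
    (H2 : _ -> R -> R -> 'rV[R]_m) N,
  [/\ everywhere_caratheodory H1, forall i, everywhere_caratheodory (fun x a b => H2 x a b 0 i) &
    [/\ measurable N, lebesgue_on Om N = 0%E &
      forall x, ~ N x -> domain_set Om x /\ forall a b, H1 x a b = G1 x a b /\ H2 x a b = G2 x a b]].
  by apply: caratheodory_modification; [case: A1 => -[]|move=> i; case: (A1.2 i)].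
have low u : fracH E alpha u -> exists b beta gamma,
  [/\ 2 * b < om E alpha 0, beta \in Lfun (lebesgue_on Om) 2%:E,
    (lebesgue_on Om).-integrable setT (EFin \o gamma) &
    {ae lebesgue_on Om, forall x, forall s y, M y ->
    - b * s ^+ 2 - beta x * s - gamma x <= H1 x (u x) s + dotv (H2 x (u x) s) y}].
  move=> /A3[b [beta [gamma [bo bL gL lo]]]]; exists b, beta, gamma; split => //.
    exact/Lfun1_integrable.
  exact: (lower_transfer nice1 nice2 mN N0 HG lo).
have upp v : fracH E alpha v -> exists b beta gamma,
  [/\ 2 * b < om E alpha 0, beta \in Lfun (lebesgue_on Om) 2%:E,
    (lebesgue_on Om).-integrable setT (EFin \o gamma) &
    {ae lebesgue_on Om, forall x, forall s y, M y ->
    H1 x s (v x) + dotv (H2 x s (v x)) y <= b * s ^+ 2 + beta x * s + gamma x}].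
  move=> /A4[b [beta [gamma [bo bL gL lo]]]]; exists b, beta, gamma; split => //.
    exact/Lfun1_integrable.
  exact: (upper_transfer nice1 nice2 mN N0 HG lo).
have FE k u v : fracH E alpha u -> fracH E alpha v ->
    functional E alpha G1 G2 (w k) u v = energy E alpha H1 H2 (w k) u v.
  move=> uH vH; apply: (functional_energy mN N0 HG n_gt0 uH vH).
  exact: (density_integrable nice1 nice2 low upp (admissible_adm (hw k)) uH vH).
have saddleP k p : saddle_points E alpha G1 G2 (w k) p <->
    forall z, gap H1 H2 (w k) p z <= 0.
  have uH := fracHH_fstP p; have vH := fracHH_sndP p.
  split=> [ps z|pz u v u'H v'H].
    have /andP[s1 s2] := ps _ _ (fracHH_fstP z) (fracHH_sndP z).
    have uzH := fracHH_fstP z; have vzH := fracHH_sndP z.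
    by rewrite /gap subr_le0 -!FE//; exact: le_trans s1 s2.
  (* Test points that share one component with [p] separate the two saddle inequalities. *)
  rewrite !FE//; apply/andP; split.
    by have := pz (fracHH_pair u'H vH); rewrite subr_le0.
  by have := pz (fracHH_pair uH v'H); rewrite subr_le0.
have wA k := admissible_adm (hw k).
(* The upper limit is built from selections with a point in every set, so it can be nonempty only if
   no set of saddle points is empty. *)
have exS k : saddle_points E alpha G1 G2 (w k) !=set0.
  have [cv cu] := A5 _ (hw k).
  have [u v v' t uH vH v'H t01|u u' v t uH u'H vH t01|p pP] :=
      saddle_exists n_gt0 alpha_gt0 MC nice1 nice2 low upp (wA k); last first.
  - by exists p; exact/saddleP.
  - have uuH := fH_comb n_gt0 t uH u'H; rewrite -!FE//.
    rewrite -lerN2; apply: le_trans (convex_functionE (cv _ vH) t01 uH u'H) _.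
    by rewrite !mulrN opprD.
  - have vvH := fH_comb n_gt0 t vH v'H; rewrite -!FE//.
    exact: (convex_functionE (cu _ uH) t01 vH v'H).
(* Index 0 holds the limit control, so the sequence proper starts at index 1. *)
have wc (f : 'rV[R]_n -> 'rV[R]_m) :
    (forall i, (lebesgue_on Om).-integrable setT (EFin \o (fun x => f x 0 i))) ->
    \int[lebesgue_on Om]_x dotv (w j.+1 x) (f x) @[j --> \oo] -->
    \int[lebesgue_on Om]_x dotv (w 0%N x) (f x).
  move=> fi; have /w_cvg c : forall i, (fun x => f x 0 i) \in Lfun (lebesgue_on Om) 1%:E.
    by move=> i; exact/Lfun1_integrable.
  by apply: (cvg_comp _ _ (cvg_addnl 1%N) c).
split.
  have [x xS] := choice (fun k => exS k.+1).
  have xG j z := (saddleP j.+1 (x j)).1 (xS j) z.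
  have [p0 p0x] := saddle_cluster n_gt0 alpha_gt0 MC nice1 nice2 low upp
    (fun j => wA j.+1) (wA 0%N) wc xG.
  by exists p0; exists x.
move=> y [x xS xy]; apply/saddleP.
exact: (cluster_saddle n_gt0 alpha_gt0 MC nice1 nice2 low upp
    (fun j => wA j.+1) (wA 0%N) wc (fun j z => (saddleP j.+1 (x j)).1 (xS j) z) xy).
Qed.
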